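(* Let $B[1..n]$ be a binary string and suppose we are given a straight-line program for $B$ with $g$ rules. Then in $O(g^{2/3} n^{4/3})$ time we can build an index occupying $2 n H_0(B) + o(n)$ bits such that, given integers $m$ and $c$, in $O(1)$ time we can determine whether there is a substring of $B$ of length $m$ containing exactly $c$ copies of 1.
   Context: A straight-line program (SLP) for a string $B$ with $g$ rules is a context-free grammar with $g$ rules in Chomsky normal form that generates $B$ and only $B$. $H_0(B)$ denotes the 0th-order empirical entropy of $B$: if $B$ contains $n_1$ ones and $n_0 = n - n_1$ zeros, then $H_0(B) = \frac{n_0}{n}\log_2\frac{n}{n_0} + \frac{n_1}{n}\log_2\frac{n}{n_1}$ (with $0\log(\cdot) = 0$), so $H_0(B) \le 1$. Running times are in the standard word RAM model. *)

(* Defs.v *)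
From HB Require Import structures.
From Stdlib Require Import Relation_Operators.
From mathcomp Require Import all_boot all_order all_algebra.
From mathcomp Require Import all_classical all_reals all_analysis.
Set Implicit Arguments.
Unset Strict Implicit.
Unset Printing Implicit Defensive.
Import Order.TTheory GRing.Theory Num.Theory.

Local Open Scope nat_scope.

(** * Straight-line programs

    Right-hand sides in Chomsky normal form.  The g rules are indexed by the g
    nonterminals: every nonterminal is the left-hand side of exactly one rule.
    Neither an ordering of the rules nor the absence of useless rules is
    assumed. *)

Inductive rule (g : nat) :=
| Term of bool
| Pair of 'I_g & 'I_g.
Arguments Term {g} _.

Record grammar (g : nat) := Grammar {
  start : 'I_g;
  rhs : 'I_g -> rule g
}.

Definition sform (g : nat) := seq (bool + 'I_g).

Definition rhs_sform g (r : rule g) : sform g :=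
  match r with
  | Term b => [:: inl b]
  | Pair X Y => [:: inr X; inr Y]
  end.

Inductive rewrites g (G : grammar g) : sform g -> sform g -> Prop :=
| Rewrites (u v : sform g) (X : 'I_g) :
    rewrites G (u ++ inr X :: v) (u ++ rhs_sform (rhs G X) ++ v).

Definition generates g (G : grammar g) (s : seq bool) : Prop :=
  clos_refl_trans_1n _ (rewrites G) [:: inr (start G)] (map inl s).

Definition is_slp_for g (G : grammar g) (B : seq bool) : Prop :=
  forall s : seq bool, generates G s <-> s = B.

(** * Word RAM

    A machine with w-bit words: a program uses finitely many registers, and a
    memory addressed by the contents of registers.  Every instruction takes
    unit time and results are reduced modulo 2 ^ w.  Since w is a parameter of
    the machine, it is available to programs, through [WordSize]. *)

Inductive binop :=
  OpAdd | OpSub | OpMul | OpDiv | OpMod | OpAnd | OpOr | OpXor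
| OpShl | OpShr | OpLtn | OpEqn.

(* [x %/ 0 = 0] and [x %% 0 = x]. *)
Definition eval_binop (w : nat) (o : binop) (x y : nat) : nat :=
  match o with
  | OpAdd => (x + y) %% 2 ^ w
  | OpSub => (x + 2 ^ w - y) %% 2 ^ w
  | OpMul => (x * y) %% 2 ^ w
  | OpDiv => x %/ y
  | OpMod => x %% y
  | OpAnd => Nat.land x y
  | OpOr  => Nat.lor x y
  | OpXor => Nat.lxor x y
  | OpShl => (x * 2 ^ y) %% 2 ^ w
  | OpShr => x %/ 2 ^ y
  | OpLtn => x < y
  | OpEqn => x == y
  end.

Inductive instr :=
| Const of nat & nat               (* r := c *)
| WordSize of nat                  (* r := w *)
| Binop of binop & nat & nat & nat (* r := a op b *)
| Read of nat & nat                (* r := ram[a] *)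
| Write of nat & nat               (* ram[a] := b *)
| Jz of nat & nat                  (* if r = 0 then go to l *)
| Halt.

Definition program := seq instr.

Record state := State {
  pc : nat;
  reg : nat -> nat;
  ram : nat -> nat
}.

(* [None] means that the machine has halted; running past the end of the
   program also halts. *)
Definition step (w : nat) (P : program) (s : state) : option state :=
  let: State i f M := s in
  match nth Halt P i with
  | Const r c => Some (State i.+1 [eta f with r |-> c %% 2 ^ w] M)
  | WordSize r => Some (State i.+1 [eta f with r |-> w] M)
  | Binop o r a b =>
      Some (State i.+1 [eta f with r |-> eval_binop w o (f a) (f b)] M)
  | Read r a => Some (State i.+1 [eta f with r |-> M (f a)] M)
  | Write a b => Some (State i.+1 f [eta M with f a |-> f b])
  | Jz r l => Some (State (if f r == 0 then l else i.+1) f M)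
  | Halt => None
  end.

Fixpoint run (w : nat) (P : program) (t : nat) (s : state) : state :=
  if t is t'.+1 then
    if step w P s is Some s' then run w P t' s' else s
  else s.

Definition halts_within (w : nat) (P : program) (t : nat) (s s' : state) :=
  run w P t s = s' /\ step w P s' = None.

(* Registers not listed in [args] are 0. *)
Definition init (args : seq nat) (M : nat -> nat) : state :=
  State 0 (nth 0 args) M.

(** * Input and output conventions *)

(* Rule i occupies the memory cells 3i, 3i + 1, 3i + 2. *)
Definition encode_rule g (r : rule g) : seq nat :=
  match r with
  | Term b => [:: 0; nat_of_bool b; 0]
  | Pair X Y => [:: 1; nat_of_ord X; nat_of_ord Y]
  end.

Definition grammar_mem g (G : grammar g) : nat -> nat :=
  nth 0 (flatten [seq encode_rule (rhs G X) | X <- enum 'I_g]).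

Definition init_grammar g (G : grammar g) : state :=
  init [:: g; nat_of_ord (start G)] (grammar_mem G).

(* The a-th w-bit word of the bit string [I], least significant bit first and
   padded with zeros. *)
Definition word_of_bits (w : nat) (I : seq bool) (a : nat) : nat :=
  \sum_(i < w) nth false I (a * w + i) * 2 ^ i.

(* [I] is stored in consecutive cells from the address in register 0, and its
   length in bits is in register 1. *)
Definition outputs_bits (w : nat) (s : state) (I : seq bool) : Prop :=
  [/\ reg s 1 = size I,
      forall a, a * w < size I -> reg s 0 + a < 2 ^ w
    & forall a, a * w < size I -> ram s (reg s 0 + a) = word_of_bits w I a].

(* A query sees m, c and the bits of the index, and nothing else. *)
Definition init_query (w : nat) (I : seq bool) (m c : nat) : state :=
  init [:: m; c] (word_of_bits w I).

(** * Jumbled matching and entropy *)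

Definition jumbled_occurs (B : seq bool) (m c : nat) : Prop :=
  exists s : seq bool, [/\ infix s B, size s = m & count_mem true s = c].

Local Open Scope ring_scope.

Definition log2 (R : realType) (x : R) : R := ln x / ln 2.

(* If b does not occur in B, its summand is 0 because of the factor 0. *)
Definition H0 (R : realType) (B : seq bool) : R :=
  let n : R := (size B)%:R in
  let n0 : R := (count_mem false B)%:R in
  let n1 : R := (count_mem true B)%:R in
  n0 / n * log2 (n / n0) + n1 / n * log2 (n / n1).

(* Main.v *)
(** For every length m the numbers of ones in the windows of length m fill an
    interval [n_m, x_m], and both x_m and n_m increase by 0 or 1 with m.  A query
    is thus two comparisons, and the index is a bit string D of length 2n, the
    increments of x followed by those of n, in which prefix sums must be computed
    in constant time.  D has 2 n_1 ones, where n_1 is the number of ones of B, so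
    a rank structure storing every block of logarithmic length by its number k of
    ones and its position among the blocks with k ones takes 2 n H_0(B) + o(n)
    bits: with p = n_1/n and q = 1 - p, the number N_k of blocks of length b with
    k ones satisfies N_k p^k q^(b-k) <= 1.

    For the construction, let b be about (n/g)^(2/3) and cut B along the parse
    tree into blocks of length at most b, merging two neighbouring blocks that
    meet at a node whenever the result has length at most b.  Two consecutive
    blocks have total length more than b, so there are O(n/b) blocks, and a block
    is determined by a nonterminal, so there are at most g types of blocks.  For
    each pair of types, all sums of a suffix of one and a prefix of the other are
    tabulated by total length in O(b^2) steps; then each of the O((n/b)^2) pairs
    of blocks is combined with the string between them in O(b) steps.  The total
    is O(g^2 b^2 + n^2/b). *)

(* The programs are not verified instruction by instruction. They are written in a small language
   whose cost semantics admits a run only if every stored value and address is below a bound [S]; a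
   compiler, proved correct once, turns such runs into machine runs. With [S = 2 ^ (w / 32)] as the
   distance between arrays, 32 arrays fit into memory, and [(n + g) ^ 1024 <= 2 ^ w] makes [S] at
   least [(n + g) ^ 31]. A query knows neither [n] nor the layout, so the index starts with a header
   that describes itself. The tables record the largest numbers of ones and of zeros, because both
   can grow from memory filled with 0; the least number of ones is [m] minus the largest number of
   zeros. Fractional powers are avoided: [b] is the least number with [n^2 <= b^3 g^2], and running
   times are compared after cubing. The blocks of D have length about log_16 n. Base 16 makes the
   number of possible blocks about the fourth root of [n], so the decoding table is o(n); the
   directory costs O(n log log n / log n) bits. *)
From Stdlib Require Import PeanoNat Relation_Operators.
Require Import Defs.
From mathcomp Require Import all_boot.
From mathcomp Require Import zify.
Set Implicit Arguments.
Unset Strict Implicit.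
Unset Printing Implicit Defensive.

(** * A structured language with a cost semantics *)

(* [Ld a e] is the [e]-th entry of array [a] in the construction, and the field
   of [e] bits at position [a] in queries. *)
Inductive nexp :=
| Var of nat
| Cst of nat
| Add of nexp & nexp
| Sub of nexp & nexp
| Mul of nexp & nexp
| Div of nexp & nexp
| Mod of nexp & nexp
| Lt of nexp & nexp
| Eq of nexp & nexp
| Ld of nexp & nexp.

Declare Scope nexp_scope.
Delimit Scope nexp_scope with nexp.
Bind Scope nexp_scope with nexp.
Coercion Cst : nat >-> nexp.
Notation "$ x" := (Var x) (at level 1, format "$ x") : nexp_scope.
Notation At a e := (Ld (Cst a) e).
Infix "+" := Add : nexp_scope.
Infix "-" := Sub : nexp_scope.
Infix "*" := Mul : nexp_scope.
Infix "%/" := Div : nexp_scope.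
Infix "%%" := Mod : nexp_scope.
Infix "<" := Lt : nexp_scope.
Infix "==" := Eq : nexp_scope.

(** Arithmetic is over unbounded naturals with truncated subtraction. Agreement with machine words
    is a separate matter, settled by bounds on the values. *)
Fixpoint ev (f : nat -> nat) (ld : nat -> nat -> nat) (e : nexp) : nat :=
  match e with
  | Var x => f x
  | Cst c => c
  | Add a b => ev f ld a + ev f ld b
  | Sub a b => ev f ld a - ev f ld b
  | Mul a b => ev f ld a * ev f ld b
  | Div a b => ev f ld a %/ ev f ld b
  | Mod a b => ev f ld a %% ev f ld b
  | Lt a b => ev f ld a < ev f ld b
  | Eq a b => ev f ld a == ev f ld b
  | Ld a b => ld (ev f ld a) (ev f ld b)
  end.

(** Loads are restricted because an index past the end of an array would address the next array. *)
Fixpoint safe (ok : nat -> nat -> Prop) f ld (e : nexp) : Prop :=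
  match e with
  | Var _ | Cst _ => True
  | Ld a b => [/\ safe ok f ld a, safe ok f ld b & ok (ev f ld a) (ev f ld b)]
  | Add a b | Sub a b | Mul a b | Div a b | Mod a b | Lt a b | Eq a b =>
      safe ok f ld a /\ safe ok f ld b
  end.

(* Scalar registers, arrays, and the output bits. *)
Record st := St { V : nat -> nat; A : nat -> nat -> nat; O : seq bool }.

Notation upd f c v := (fun i => if Nat.eqb i c then v else f i).
Definition setv s x v := St (upd (V s) x v) (A s) (O s).
Definition seta s j i v :=
  St (V s) (fun k => if Nat.eqb k j then upd (A s j) i v else A s k) (O s).
Definition emit s b := St (V s) (A s) (rcons (O s) b).

Inductive cmd :=
| Skip
| Asg of nat & nexp
| Sto of nat & nexp & nexp
| Emit of nexp
| Seq of cmd & cmd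
| If of nexp & cmd & cmd
| While of nexp & cmd.

Declare Scope cmd_scope.
Delimit Scope cmd_scope with cmd.
Bind Scope cmd_scope with cmd.
Infix ";;" := Seq (at level 60, right associativity) : cmd_scope.
Infix "::=" := Asg (at level 55, no associativity) : cmd_scope.
Open Scope cmd_scope.

Definition For x e body :=
  Asg x (Cst 0) ;; While (Lt (Var x) e) (body ;; Asg x (Add (Var x) (Cst 1))).

(** * Costs, frame conditions and rules for total correctness *)

Section Triples.
Variable S : nat.

Notation eval s e := (ev (V s) (A s) e).
Notation safes s e := (safe (fun _ i => i < S) (V s) (A s) e).

(* Everything assigned stays below [S], so that words never overflow. *)
Inductive exec : cmd -> st -> nat -> st -> Prop :=
| XSkip s : exec Skip s 0 s
| XAsg s x e : safes s e -> eval s e < S ->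
    exec (Asg x e) s 1 (setv s x (eval s e))
| XSto s j a e : safes s a -> safes s e -> eval s a < S -> eval s e < S ->
    exec (Sto j a e) s 1 (seta s j (eval s a) (eval s e))
| XEmit s e : safes s e -> (size (O s)).+1 < S ->
    exec (Emit e) s 1 (emit s (eval s e != 0))
| XSeq c1 c2 s1 t1 s2 t2 s3 : exec c1 s1 t1 s2 -> exec c2 s2 t2 s3 ->
    exec (Seq c1 c2) s1 (t1 + t2) s3
| XIf1 e c1 c2 s t s' : safes s e -> eval s e != 0 -> exec c1 s t s' ->
    exec (If e c1 c2) s t.+1 s'
| XIf0 e c1 c2 s t s' : safes s e -> eval s e = 0 -> exec c2 s t s' ->
    exec (If e c1 c2) s t.+1 s'
| XWh0 e c s : safes s e -> eval s e = 0 -> exec (While e c) s 1 s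
| XWh1 e c s t1 s1 t2 s2 : safes s e -> eval s e != 0 -> exec c s t1 s1 ->
    exec (While e c) s1 t2 s2 -> exec (While e c) s (t1 + t2).+1 s2.

Fixpoint modv c := match c with
  | Skip | Sto _ _ _ | Emit _ => [::]
  | Asg x _ => [:: x]
  | Seq a b | If _ a b => modv a ++ modv b
  | While _ a => modv a
  end.
Fixpoint moda c := match c with
  | Skip | Asg _ _ | Emit _ => [::]
  | Sto j _ _ => [:: j]
  | Seq a b | If _ a b => moda a ++ moda b
  | While _ a => moda a
  end.
Fixpoint emits c := match c with
  | Skip | Asg _ _ | Sto _ _ _ => false
  | Emit _ => true
  | Seq a b | If _ a b => emits a || emits b
  | While _ a => emits a
  end.

(** A membership test that computes, so that the frame side conditions at concrete registers are
    closed by [erefl]. *)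
Fixpoint occ x s := if s is y :: s' then Nat.eqb x y || occ x s' else false.

Lemma occ_cat x s t : occ x (s ++ t) = occ x s || occ x t.
Proof. by elim: s => //= y s ->; rewrite orbA. Qed.

(** A frame condition read off the syntax of [c]. Every rule hands it on, so postconditions need to
    mention only what changes. *)
Definition agree c s s' :=
  [/\ forall x, occ x (modv c) = false -> V s' x = V s x,
      forall j, occ j (moda c) = false -> A s' j = A s j
    & emits c = false -> O s' = O s].

Lemma agree_refl c s : agree c s s. Proof. by []. Qed.

Lemma agree_trans c s1 s2 s3 : agree c s1 s2 -> agree c s2 s3 -> agree c s1 s3.
Proof.
move=> [a b d] [a' b' d']; split.
- by move=> x H; rewrite a' // a.
- by move=> x H; rewrite b' // b.
by move=> H; rewrite d' // d.
Qed.

Lemma agree_setv c s s' x v : occ x (modv c) ->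
  agree c s s' -> agree c s (setv s' x v).
Proof.
move=> h [a b d]; split=> //= y; case: Nat.eqb_spec => [->|_]; last exact: a.
by rewrite h.
Qed.

Lemma agree_seta c s s' j i v : occ j (moda c) ->
  agree c s s' -> agree c s (seta s' j i v).
Proof.
move=> h [a b d]; split=> //= y; case: Nat.eqb_spec => [->|_]; last exact: b.
by rewrite h.
Qed.

Lemma agree_emit c s s' x : emits c -> agree c s s' -> agree c s (emit s' x).
Proof. by move=> h [a b d]; split=> //=; rewrite h. Qed.

Lemma agree_sub c c' s s' :
  (forall x, occ x (modv c') = false -> occ x (modv c) = false) ->
  (forall x, occ x (moda c') = false -> occ x (moda c) = false) ->
  (emits c' = false -> emits c = false) -> agree c s s' -> agree c' s s'.
Proof.
move=> Hv Ha He [a b d]; split.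
- by move=> x /Hv /a.
- by move=> x /Ha /b.
by move=> /He /d.
Qed.

Lemma exec_agree c s t s' : exec c s t s' -> agree c s s'.
Proof.
elim => {c s t s'} //=.
- move=> s x e _ _; split=> //= y; by case: Nat.eqb.
- move=> s j a e _ _ _ _; split=> //= y; by case: Nat.eqb.
- move=> c1 c2 s1 t1 s2 t2 s3 _ H1 _ H2.
  apply: (@agree_trans _ _ s2); [move: H1|move: H2]; apply: agree_sub => /=.
  + by move=> x; rewrite occ_cat => /norP [/negbTE ->].
  + by move=> x; rewrite occ_cat => /norP [/negbTE ->].
  + by case: emits.
  + by move=> x; rewrite occ_cat => /norP [_ /negbTE ->].
  + by move=> x; rewrite occ_cat => /norP [_ /negbTE ->].
  + by case: (emits c1).
- move=> e c1 c2 s t s' _ _ _; apply: agree_sub => /=.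
  + by move=> x; rewrite occ_cat => /norP [/negbTE ->].
  + by move=> x; rewrite occ_cat => /norP [/negbTE ->].
  + by case: emits.
- move=> e c1 c2 s t s' _ _ _; apply: agree_sub => /=.
  + by move=> x; rewrite occ_cat => /norP [_ /negbTE ->].
  + by move=> x; rewrite occ_cat => /norP [_ /negbTE ->].
  + by case: (emits c1).
- by move=> e c s t1 s1 t2 s2 _ _ _ + _; apply: agree_trans.
Qed.

(** Total correctness with a time bound: a run is asserted to exist, so termination, the bound [S]
    and the range of all accesses are part of the claim. *)
Definition tri c s T (Q : st -> Prop) :=
  exists t s', [/\ exec c s t s', t <= T & Q s'].

Lemma tri_weak c s T T' (Q Q' : st -> Prop) :
  tri c s T Q -> T <= T' -> (forall s', agree c s s' -> Q s' -> Q' s') ->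
  tri c s T' Q'.
Proof.
move=> [t [s' [X tT Qs]]] le H; exists t, s'; split=> //.
  exact: leq_trans tT le.
exact: H (exec_agree X) Qs.
Qed.

Lemma tri_skip s T (Q : st -> Prop) : Q s -> tri Skip s T Q.
Proof. by move=> ?; exists 0, s; split=> //; constructor. Qed.

Lemma tri_asg s x e T (Q : st -> Prop) :
  safes s e -> eval s e < S -> Q (setv s x (eval s e)) -> 0 < T ->
  tri (Asg x e) s T Q.
Proof. by move=> *; exists 1; eexists; split; [constructor| |eassumption]. Qed.

Lemma tri_sto s j a e T (Q : st -> Prop) :
  safes s a -> safes s e -> eval s a < S -> eval s e < S ->
  Q (seta s j (eval s a) (eval s e)) -> 0 < T -> tri (Sto j a e) s T Q.
Proof. by move=> *; exists 1; eexists; split; [constructor| |eassumption]. Qed.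

Lemma tri_emit s e T (Q : st -> Prop) :
  safes s e -> (size (O s)).+1 < S -> Q (emit s (eval s e != 0)) -> 0 < T ->
  tri (Emit e) s T Q.
Proof. by move=> *; exists 1; eexists; split; [constructor| |eassumption]. Qed.

Lemma tri_skip_eq s T : tri Skip s T (fun s' => s' = s).
Proof. exact: tri_skip. Qed.

Lemma tri_asg_eq s x e T : safes s e -> eval s e < S -> 0 < T ->
  tri (Asg x e) s T (fun s' => s' = setv s x (eval s e)).
Proof. by move=> *; exact: tri_asg. Qed.

Lemma tri_sto_eq s j a e T :
  safes s a -> safes s e -> eval s a < S -> eval s e < S -> 0 < T ->
  tri (Sto j a e) s T (fun s' => s' = seta s j (eval s a) (eval s e)).
Proof. by move=> *; exact: tri_sto. Qed.

Lemma tri_seq T1 T2 c1 c2 s T (Q1 Q : st -> Prop) :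
  tri c1 s T1 Q1 -> T1 + T2 <= T ->
  (forall s', agree c1 s s' -> Q1 s' -> tri c2 s' T2 Q) ->
  tri (Seq c1 c2) s T Q.
Proof.
move=> [t1 [s1 [X1 le1 q1]]] le /(_ _ (exec_agree X1) q1)[t2 [s2 [X2 le2 q2]]].
exists (t1 + t2), s2; split=> //; first exact: XSeq X1 X2.
by apply: leq_trans le; apply: leq_add.
Qed.

Lemma tri_asgs s x e c T (Q : st -> Prop) :
  safes s e -> eval s e < S -> tri c (setv s x (eval s e)) T Q ->
  tri (Asg x e ;; c) s T.+1 Q.
Proof.
move=> h1 h2 h; apply: (@tri_seq 1 T _ _ _ _ (fun s' => s' = setv s x (eval s e))) => //.
  exact: tri_asg.
by move=> ? _ ->.
Qed.

Lemma tri_stos s j a e c T (Q : st -> Prop) :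
  safes s a -> safes s e -> eval s a < S -> eval s e < S ->
  tri c (seta s j (eval s a) (eval s e)) T Q ->
  tri (Sto j a e ;; c) s T.+1 Q.
Proof.
move=> h1 h2 h3 h4 h.
apply: (@tri_seq 1 T _ _ _ _ (fun s' => s' = seta s j (eval s a) (eval s e))) => //.
  exact: tri_sto.
by move=> ? _ ->.
Qed.

Lemma tri_if s e c1 c2 T (Q : st -> Prop) :
  safes s e -> (eval s e != 0 -> tri c1 s T Q) ->
  (eval s e = 0 -> tri c2 s T Q) -> tri (If e c1 c2) s T.+1 Q.
Proof.
move=> h H1 H0; case: (eqVneq (eval s e) 0) => [E|E].
  case: (H0 E) => t [s' [X le q]]; exists t.+1, s'; split=> //; exact: XIf0.
case: (H1 E) => t [s' [X le q]]; exists t.+1, s'; split=> //; exact: XIf1.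
Qed.

Lemma tri_while0 s e c T (Q : st -> Prop) :
  safes s e -> eval s e = 0 -> 0 < T -> Q s -> tri (While e c) s T Q.
Proof. by move=> *; exists 1, s; split=> //; constructor. Qed.

Lemma tri_while1 T1 T2 s e c T (Q1 Q : st -> Prop) :
  safes s e -> eval s e != 0 -> tri c s T1 Q1 -> T1 + T2 < T ->
  (forall s', agree c s s' -> Q1 s' -> tri (While e c) s' T2 Q) ->
  tri (While e c) s T Q.
Proof.
move=> h1 h2 [t1 [s1 [X1 le1 q1]]] le /(_ _ (exec_agree X1) q1).
move=> [t2 [s2 [X2 le2 q2]]].
exists (t1 + t2).+1, s2; split=> //; first exact: XWh1 h1 h2 X1 X2.
by apply: leq_trans le; rewrite ltnS leq_add.
Qed.

(** A round costs [c], one test and one increment; the final 2 is the initialisation and the failing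
    test. The body must establish the invariant for the state with the counter already advanced,
    since [For] increments after the body. *)
Lemma tri_for x e body s0 N c (Inv : nat -> st -> Prop) T :
  occ x (modv body) = false ->
  (forall s, agree (For x e body) s0 s -> safes s e /\ eval s e = N) ->
  N < S -> N * (c + 2) + 2 <= T ->
  Inv 0 (setv s0 x 0) ->
  (forall i s, agree (For x e body) s0 s -> V s x = i -> i < N -> Inv i s ->
    tri body s c (fun s' => Inv i.+1 (setv s' x i.+1))) ->
  tri (For x e body) s0 T (fun s => V s x = N /\ Inv N s).
Proof.
move=> xb HE NS leT I0 Hb.
have SE : S = S.-1.+1 by rewrite prednK //; apply: leq_ltn_trans NS.
have agS s i : agree (For x e body) s0 s -> agree (For x e body) s0 (setv s x i).
  move=> [a b d]; split=> //= y; case E: (Nat.eqb y x) => //= H.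
  by apply: a; rewrite /= E.
suff H : forall k i s, agree (For x e body) s0 s -> V s x = i -> i + k = N -> Inv i s ->
   tri (While (Lt (Var x) e) (body;; Asg x (Add (Var x) (Cst 1)))) s (k * (c + 2) + 1)
     (fun s => V s x = N /\ Inv N s).
  have A1 := agS s0 0 (agree_refl _ _).
  have A2 : V (setv s0 x 0) x = 0 by rewrite /= (Nat.eqb_refl x).
  case: (H N 0 _ A1 A2 (add0n N) I0) => t [s' [X le q]].
  exists t.+1, s'; split=> //; last by lia.
  have X0 : exec (Asg x (Cst 0)) s0 1 (setv s0 x 0).
    by apply: (@XAsg s0 x (Cst 0)) => //=; lia.
  exact: (XSeq X0 X).
elim=> [|k IH] i s ag Vi iN Ii.
  have [se ee] := HE s ag.
  have iN' : i = N by lia.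
  apply: tri_while0 => //=.
    by rewrite ee Vi iN' ltnn.
  by rewrite -iN' /= Vi.
have [se ee] := HE s ag.
have lt : i < N by lia.
apply: (@tri_while1 (c + 1) (k * (c + 2) + 1) _ _ _ _
   (fun s' => agree (For x e body) s0 s' /\ V s' x = i.+1 /\ Inv i.+1 s')) => //=.
- by rewrite ee Vi lt.
- apply: tri_seq (Hb i s ag Vi lt Ii) (leqnn _) _ => s' ag' Is'.
  have Vx : V s' x = i by case: ag' => /(_ x xb) ->.
  apply: tri_asg => //=; rewrite ?Vx ?addn1; first by lia.
  rewrite (Nat.eqb_refl x); split=> //.
  apply: agS; apply: agree_trans ag _; move: ag'; apply: agree_sub => /=.
  + by move=> y /norP [_]; rewrite occ_cat => /norP [/negbTE].
  + by move=> y; rewrite occ_cat => /norP [/negbTE].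
  + by case: emits.
- by lia.
move=> s' _ [ag' [Vx Is]]; apply: IH Is => //; lia.
Qed.

Lemma agV c s s' : agree c s s' -> forall x, occ x (modv c) = false -> V s' x = V s x.
Proof. by case. Qed.
Lemma agA c s s' : agree c s s' -> forall x, occ x (moda c) = false -> A s' x = A s x.
Proof. by case. Qed.
Lemma agO c s s' : agree c s s' -> emits c = false -> O s' = O s.
Proof. by case. Qed.

End Triples.

Ltac fr ag := match type of ag with agree _ ?s ?s' =>
  repeat match goal with
  | |- context [V s' ?x] => rewrite (@agV _ _ _ ag x erefl)
  | |- context [A s' ?x] => rewrite (@agA _ _ _ ag x erefl)
  | |- context [O s'] => rewrite (@agO _ _ _ ag erefl)
  end end.
Ltac side := rewrite /=;
  repeat match goal with
  | |- _ /\ _ => split | |- and3 _ _ _ => split | |- True => exact I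
  end; try done; try lia.
Ltac asg := apply: tri_asgs; [side|side|rewrite /=].
Ltac sto := apply: tri_stos; [side|side|side|side|rewrite /=].
Ltac ifc := apply: tri_if; [side|rewrite /=|rewrite /=].
Ltac fineq := first [apply: tri_skip_eq | apply: tri_asg_eq; side | apply: tri_sto_eq; side].
Ltac agr := repeat first [ exact: agree_refl | assumption
  | apply: agree_setv; [exact: erefl|] | apply: agree_seta; [exact: erefl|]
  | apply: agree_emit; [exact: erefl|] ].

(** * Compilation to the word RAM *)

(* Registers from [tmp] on hold intermediate values of expressions; [rS] holds the
   stride [S] of the arrays and [rO] the number of bits output so far. *)
Notation tmp := 102.
Notation rS := 100.
Notation rO := 101.

Inductive mexp :=
| MVar of nat
| MCst of nat
| MWs
| MBin of binop & mexp & mexp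
| MRaw of mexp.

Fixpoint mev w (f M : nat -> nat) e := match e with
  | MVar x => f x
  | MCst c => c %% 2 ^ w
  | MWs => w
  | MBin o a b => eval_binop w o (mev w f M a) (mev w f M b)
  | MRaw a => M (mev w f M a)
  end.

Fixpoint mwf e := match e with
  | MVar x => x < tmp
  | MCst _ | MWs => true
  | MBin _ a b => mwf a && mwf b
  | MRaw a => mwf a
  end.

(** Registers from [tmp + d] on form an evaluation stack, and the value is left in [tmp + d]. There
    is no move instruction; the bitwise or of a register with itself copies it. *)
Fixpoint cexp e d : seq instr := match e with
  | MVar x => [:: Binop OpOr (tmp + d) x x]
  | MCst c => [:: Const (tmp + d) c]
  | MWs => [:: WordSize (tmp + d)]
  | MBin o a b => cexp a d ++ cexp b d.+1 ++ [:: Binop o (tmp + d) (tmp + d) (tmp + d.+1)]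
  | MRaw a => cexp a d ++ [:: Read (tmp + d) (tmp + d)]
  end.

Inductive mcmd :=
| MSkip
| MAsg of nat & mexp
| MSto of mexp & mexp
| MSeq of mcmd & mcmd
| MIf of mexp & mcmd & mcmd
| MWhile of mexp & mcmd.

Fixpoint mcwf c := match c with
  | MSkip => true
  | MAsg x e => (x < tmp) && mwf e
  | MSto a e => mwf a && mwf e
  | MSeq a b => mcwf a && mcwf b
  | MIf e a b => [&& mwf e, mcwf a & mcwf b]
  | MWhile e a => mwf e && mcwf a
  end.

(** Jumps are absolute, hence the address [o] of the first instruction as an argument. An
    unconditional jump is a [Jz] on a register that has just been set to 0. *)
Fixpoint cmpl o c : seq instr := match c with
  | MSkip => [::]
  | MAsg x e => cexp e 0 ++ [:: Binop OpOr x tmp tmp]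
  | MSto a e => cexp a 0 ++ cexp e 1 ++ [:: Write tmp tmp.+1]
  | MSeq a b => let ka := cmpl o a in ka ++ cmpl (o + size ka) b
  | MIf e a b =>
      let ce := cexp e 0 in
      let ka := cmpl (o + size ce + 1) a in
      let o2 := o + size ce + 1 + size ka + 2 in
      let kb := cmpl o2 b in
      ce ++ [:: Jz tmp o2] ++ ka ++ [:: Const tmp 0; Jz tmp (o2 + size kb)] ++ kb
  | MWhile e a =>
      let ce := cexp e 0 in
      let ka := cmpl (o + size ce + 1) a in
      ce ++ [:: Jz tmp (o + size ce + 1 + size ka + 2)] ++ ka ++ [:: Const tmp 0; Jz tmp o]
  end.

(** * Correctness of the compiled code *)

Section Machine.
Variable w : nat.

Inductive mexec : mcmd -> (nat -> nat) -> (nat -> nat) -> nat -> (nat -> nat) -> (nat -> nat) -> Prop :=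
| MXSkip f M : mexec MSkip f M 0 f M
| MXAsg x e f M : mexec (MAsg x e) f M 1 [eta f with x |-> mev w f M e] M
| MXSto a e f M : mexec (MSto a e) f M 1 f [eta M with mev w f M a |-> mev w f M e]
| MXSeq c1 c2 f M t1 f1 M1 t2 f2 M2 : mexec c1 f M t1 f1 M1 -> mexec c2 f1 M1 t2 f2 M2 ->
    mexec (MSeq c1 c2) f M (t1 + t2) f2 M2
| MXIf1 e c1 c2 f M t f' M' : mev w f M e != 0 -> mexec c1 f M t f' M' ->
    mexec (MIf e c1 c2) f M t.+1 f' M'
| MXIf0 e c1 c2 f M t f' M' : mev w f M e = 0 -> mexec c2 f M t f' M' ->
    mexec (MIf e c1 c2) f M t.+1 f' M'
| MXWh0 e c f M : mev w f M e = 0 -> mexec (MWhile e c) f M 1 f M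
| MXWh1 e c f M t1 f1 M1 t2 f2 M2 : mev w f M e != 0 -> mexec c f M t1 f1 M1 ->
    mexec (MWhile e c) f1 M1 t2 f2 M2 -> mexec (MWhile e c) f M (t1 + t2).+1 f2 M2.

Definition code_at (P : program) o c :=
  forall i, i < size c -> nth Halt P (o + i) = nth Halt c i.

Lemma code_at_cat P o a b : code_at P o (a ++ b) ->
  code_at P o a /\ code_at P (o + size a) b.
Proof.
move=> H; split=> i ia.
  by rewrite H ?size_cat ?ltn_addr // nth_cat ia.
by rewrite -addnA H ?size_cat ?ltn_add2l // nth_cat ltnNge leq_addr /= addKn.
Qed.

Lemma run_add P t1 t2 s : run w P (t1 + t2) s = run w P t2 (run w P t1 s).
Proof.
elim: t1 s => //= t1 IH s; case E: (step w P s) => [s'|]; first exact: IH.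
by case: (t2) => //= t; rewrite E.
Qed.

Lemma nth_code P o i c : code_at P o (i :: c) -> nth Halt P o = i.
Proof. by move=> /(_ 0 isT); rewrite addn0. Qed.

Lemma code_at_cons P o i c : code_at P o (i :: c) -> nth Halt P o = i /\ code_at P (o + 1) c.
Proof.
move=> H; split; first exact: nth_code H.
by move=> j jc; rewrite -addnA add1n (H j.+1).
Qed.

Definition feq (f g : nat -> nat) := forall x, x < tmp -> f x = g x.

Lemma mev_ext f g M e : mwf e -> feq f g -> mev w f M e = mev w g M e.
Proof.
move=> + E; elim: e => //= [o a IHa b IHb /andP[/IHa -> /IHb ->] //|a IH /IH -> //].
Qed.

(** Code at depth [d] writes only to registers from [tmp + d] on, so the left operand survives the
    evaluation of the right one at depth [d + 1]. *)
Lemma cexp_ok P e d o f M : code_at P o (cexp e d) -> mwf e -> 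
  exists f', [/\ run w P (size (cexp e d)) (State o f M) = State (o + size (cexp e d)) f' M,
    f' (tmp + d) = mev w f M e & forall x, x < tmp + d -> f' x = f x].
Proof.
have T (v : nat) (h : nat -> nat) d' x : x < tmp + d' -> [eta h with tmp + d' |-> v] x = h x.
  by move=> h' /=; case: eqP => // E; rewrite E ltnn in h'.
elim: e d o f => [x|c| |op a IHa b IHb|a IHa] d o f.
- move=> /nth_code E _; exists [eta f with tmp + d |-> f x]; split.
  + by rewrite /= E addn1 /= Nat.lor_diag.
  + by rewrite /= eqxx.
  + exact: T.
- move=> /nth_code E _; eexists; split; [by rewrite /= E addn1| by rewrite /= eqxx|exact: T].
- move=> /nth_code E _; eexists; split; [by rewrite /= E addn1| by rewrite /= eqxx|exact: T].
- move=> /= /code_at_cat[Ca /code_at_cat[Cb /nth_code Ci]] /andP[wa wb].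
  have [f1 [R1 v1 e1]] := IHa d o f Ca wa.
  have [f2 [R2 v2 e2]] := IHb d.+1 _ f1 Cb wb.
  exists [eta f2 with tmp + d |-> eval_binop w op (mev w f M a) (mev w f M b)]; split.
  + rewrite !size_cat /= !run_add R1 R2 /= Ci v2 e2; last by rewrite ltn_add2l.
    rewrite v1 (@mev_ext f1 f M b wb); last by move=> x xt; apply: e1; apply: ltn_addr.
    by rewrite addn1 !addnS !addnA.
  + by rewrite /= eqxx.
  + by move=> x h; rewrite T // e2 ?e1 //; apply: ltn_trans h _; rewrite ltn_add2l.
- move=> /= /code_at_cat[Ca /nth_code Ci] wa.
  have [f1 [R1 v1 e1]] := IHa d o f Ca wa.
  exists [eta f1 with tmp + d |-> M (mev w f M a)]; split.
  + by rewrite size_cat /= run_add R1 /= Ci v1 addn1 !addnS.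
  + by rewrite /= eqxx.
  + by move=> x h; rewrite T // e1.
Qed.

(** One step of the structured semantics passes at most once through the code of its command, so the
    slowdown is the length of the code, a constant of the program. *)
Lemma cmpl_ok c f M t f' M' : mexec c f M t f' M' -> mcwf c -> forall P o f0,
  code_at P o (cmpl o c) -> feq f f0 ->
  exists t' f0', [/\ t' <= t * size (cmpl o c),
    run w P t' (State o f0 M) = State (o + size (cmpl o c)) f0' M' & feq f' f0'].
Proof.
elim=> {c f M t f' M'} /=.
- by move=> f M _ P o f0 _ E; exists 0, f0; rewrite addn0.
- move=> x e f M /andP[xt we] P o f0 /code_at_cat[Ca /nth_code Ci] E.
  have [f1 [R1 v1 e1]] := cexp_ok f0 M Ca we; rewrite addn0 in v1 e1.
  exists (size (cexp e 0) + 1), [eta f1 with x |-> mev w f M e]; split.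
  + by rewrite mul1n size_cat.
  + rewrite run_add R1 /= Ci v1 /= Nat.lor_diag size_cat /= addn1 addnS.
    by rewrite (mev_ext _ we E).
  + by move=> y yt /=; case: eqP => // _; rewrite e1 // E.
- move=> a e f M /andP[wa we] P o f0 /code_at_cat[Ca /code_at_cat[Cb /nth_code Ci]] E.
  have [f1 [R1 v1 e1]] := cexp_ok f0 M Ca wa; rewrite addn0 in v1 e1.
  have [f2 [R2 v2 e2]] := cexp_ok f1 M Cb we; rewrite addn1 in v2 e2.
  exists (size (cexp a 0) + (size (cexp e 1) + 1)), f2; split.
  + by rewrite mul1n !size_cat.
  + rewrite !run_add R1 R2 /= Ci v2 e2 // v1 !size_cat /= addn1 !addnS !addnA.
    rewrite -(mev_ext _ wa E) (@mev_ext f1 f M e we) //.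
    by move=> x xt; rewrite e1 // E.
  + by move=> y yt; rewrite e2 ?e1 ?E // ltnW.
- move=> c1 c2 f M t1 f1 M1 t2 f2 M2 _ IH1 _ IH2 /andP[w1 w2] P o f0 /code_at_cat[C1 C2] E.
  have [t1' [f1' [l1 R1 E1]]] := IH1 w1 P o f0 C1 E.
  have [t2' [f2' [l2 R2 E2]]] := IH2 w2 P _ f1' C2 E1.
  exists (t1' + t2'), f2'; split=> //.
  + rewrite size_cat mulnDl; apply: leq_add.
      by apply: leq_trans l1 _; rewrite leq_mul2l leq_addr orbT.
    by apply: leq_trans l2 _; rewrite leq_mul2l leq_addl orbT.
  + by rewrite run_add R1 R2 size_cat addnA.
- move=> e c1 c2 f M t f' M' nz _ IH /and3P[we w1 w2] P o f0.
  move=> /code_at_cat[Ca /code_at_cons[Cj /code_at_cat[C1 /code_at_cons[Ck1 /code_at_cons[Ck2 _]]]]] E.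
  have [f1 [R1 v1 e1]] := cexp_ok f0 M Ca we; rewrite addn0 in v1 e1.
  have E1 : feq f f1 by move=> x xt; rewrite e1 // E.
  have [t1' [f1' [l1 R1' E1']]] := IH w1 P _ f1 C1 E1.
  rewrite addn1 in Ck2.
  exists (size (cexp e 0) + (1 + (t1' + 2))), [eta f1' with tmp |-> 0 %% 2 ^ w]; split.
  + rewrite !size_cat /= mulSn; move: l1; rewrite !size_cat /=.
    set z1 := size (cmpl _ c1); set z2 := size (cmpl _ c2); move: z1 z2 (size _) => z1 z2 z3; nia.
  + rewrite !run_add R1 /= Cj v1 -(mev_ext _ we E) (negbTE nz) -addn1 R1' /= Ck1 /= Ck2 /= mod0n /=.
    by congr State; rewrite !size_cat /= ?size_cat /=; lia.
  + by move=> y yt /=; case: eqP => [Ey|_]; [rewrite Ey in yt|apply: E1'].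
- move=> e c1 c2 f M t f' M' nz _ IH /and3P[we w1 w2] P o f0.
  move=> /code_at_cat[Ca /code_at_cons[Cj /code_at_cat[C1 /code_at_cons[_ /code_at_cons[_ C2]]]]] E.
  rewrite -(addnA _ 1 1) (_ : 1 + 1 = 2) // in C2.
  have [f1 [R1 v1 e1]] := cexp_ok f0 M Ca we; rewrite addn0 in v1 e1.
  have E1 : feq f f1 by move=> x xt; rewrite e1 // E.
  have [t1' [f1' [l1 R1' E1']]] := IH w2 P _ f1 C2 E1.
  exists (size (cexp e 0) + (1 + t1')), f1'; split=> //.
  + rewrite !size_cat /= mulSn; move: l1; rewrite !size_cat /=.
    set z1 := size (cmpl _ c1); set z2 := size (cmpl _ c2); move: z1 z2 (size _) => z1 z2 z3; nia.
  + rewrite !run_add R1 /= Cj v1 -(mev_ext _ we E) nz /= R1' /=.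
    by congr State; rewrite !size_cat /= ?size_cat /=; lia.
- move=> e c f M z /andP[we wc] P o f0 /code_at_cat[Ca /code_at_cons[Cj _]] E.
  have [f1 [R1 v1 e1]] := cexp_ok f0 M Ca we; rewrite addn0 in v1 e1.
  exists (size (cexp e 0) + 1), f1; split.
  + rewrite mul1n !size_cat /=; lia.
  + rewrite !run_add R1 /= Cj v1 -(mev_ext _ we E) z /=.
    by congr State; rewrite !size_cat /= ?size_cat /=; lia.
  + by move=> x xt; rewrite e1 // E.
- move=> e c f M t1 f1 M1 t2 f2 M2 nz _ IH1 _ IH2 wec P o f0 C E.
  have /andP[we wc] := wec.
  move: (C) => /code_at_cat[Ca /code_at_cons[Cj /code_at_cat[C1 /code_at_cons[Ck1 /code_at_cons[Ck2 _]]]]].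
  have [g1 [R1 v1 e1]] := cexp_ok f0 M Ca we; rewrite addn0 in v1 e1.
  have E1 : feq f g1 by move=> x xt; rewrite e1 // E.
  have [t1' [f1' [l1 R1' E1']]] := IH1 wc P _ g1 C1 E1.
  rewrite addn1 in Ck2.
  have E2 : feq f1 [eta f1' with tmp |-> 0 %% 2 ^ w].
    by move=> y yt /=; case: eqP => [Ey|_]; [rewrite Ey in yt|apply: E1'].
  (* The jump at the end of the body returns to [o], so the remaining rounds run the same code; this
     is why [C] was kept. *)
  have [t2' [f2' [l2 R2' E2']]] := IH2 wec P o _ C E2.
  exists (size (cexp e 0) + (1 + (t1' + (2 + t2')))), f2'; split=> //.
  + move: l1 l2; rewrite !size_cat /= !size_cat /=.
    set z1 := size (cmpl _ c); move: z1 (size _) => z1 z3; nia.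
  + rewrite !run_add R1 /= Cj v1 -(mev_ext _ we E) (negbTE nz) -addn1 R1' /= Ck1 /= Ck2 /= mod0n /= -R2'.
    by congr (run _ _ _ (State _ (fun x => _) _)); rewrite mod0n.
Qed.

Lemma mprog_ok c f M t f' M' : mexec c f M t f' M' -> mcwf c ->
  exists t' f0', [/\ t' <= t * size (cmpl 0 c),
    halts_within w (cmpl 0 c) t' (State 0 f M) (State (size (cmpl 0 c)) f0' M') & feq f' f0'].
Proof.
move=> X wc; have [|t' [f0' [l R E]]] := cmpl_ok X wc (P := cmpl 0 c) (o := 0) (f0 := f) _ (fun _ _ => erefl).
  by move=> i _; rewrite add0n.
exists t', f0'; split=> //; split; first by rewrite R.
by rewrite /= nth_default.
Qed.

Lemma halts_mono P t t' s s' : halts_within w P t s s' -> t <= t' -> halts_within w P t' s s'.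
Proof.
move=> [R H] le; split=> //; rewrite -(subnKC le) run_add R.
by case: (t' - t) => //= m; rewrite H.
Qed.
End Machine.

(** * Translation of expressions without overflow *)

Section Translate.
Variable trld : mexp -> mexp -> mexp.

(** Machine subtraction wraps around; multiplying by the comparison of the operands turns it into
    truncated subtraction. *)
Fixpoint tr e := match e with
  | Var x => MVar x
  | Cst c => MCst c
  | Add a b => MBin OpAdd (tr a) (tr b)
  | Sub a b => MBin OpMul (MBin OpSub (tr a) (tr b)) (MBin OpLtn (tr b) (tr a))
  | Mul a b => MBin OpMul (tr a) (tr b)
  | Div a b => MBin OpDiv (tr a) (tr b)
  | Mod a b => MBin OpMod (tr a) (tr b)
  | Lt a b => MBin OpLtn (tr a) (tr b)
  | Eq a b => MBin OpEqn (tr a) (tr b)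
  | Ld a b => trld (tr a) (tr b)
  end.

(** If variables, constants and loads are below [S], the value is below [S ^ deg e]. The limit 31 in
    [wfe] therefore keeps all intermediate results within a word. *)
Fixpoint deg e := match e with
  | Var _ | Cst _ | Lt _ _ | Eq _ _ | Ld _ _ => 1
  | Add a b | Mul a b => deg a + deg b
  | Sub a _ | Div a _ | Mod a _ => deg a
  end.

Variable wfld : nexp -> nexp -> bool.
Fixpoint wfe e := match e with
  | Var x => x < rS
  | Cst c => c <= 2000
  | Ld a b => [&& wfe a, wfe b & wfld a b]
  | Add a b | Sub a b | Mul a b | Div a b | Mod a b | Lt a b | Eq a b =>
      [&& wfe a, wfe b & deg a + deg b <= 31]
  end.

End Translate.

Lemma deg_gt0 e : 0 < deg e.
Proof. by elim: e => //= a Ha b Hb; rewrite addn_gt0 Ha. Qed.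

Lemma modsub x y W : x < W -> y < W -> ((x + W - y) %% W * (y < x)) %% W = x - y.
Proof.
move=> xW yW; case: ltnP => h.
  rewrite muln1 (_ : x + W - y = x - y + W); last by lia.
  by rewrite modnDr modn_mod modn_small //; lia.
by rewrite muln0 mod0n; apply/esym/eqP; rewrite subn_eq0.
Qed.

Lemma modaddr j s v W : j * s + v < W -> 0 < s -> ((j %% W * s) %% W + v) %% W = j * s + v.
Proof.
move=> h s0; have h1 : j * s < W by apply: leq_ltn_trans h; apply: leq_addr.
have h2 : j < W by apply: leq_ltn_trans h1; apply: leq_pmulr.
by rewrite (modn_small h2) (modn_small h1) modn_small.
Qed.

Section TranslateOk.
Variables (trld : mexp -> mexp -> mexp) (wfld : nexp -> nexp -> bool).
Variables (w S : nat) (f M : nat -> nat) (F : nat -> nat) (ld : nat -> nat -> nat).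
Variable ok : nat -> nat -> Prop.
Hypothesis S0 : 2000 < S.
Hypothesis Sw : S ^ 31 <= 2 ^ w.
Hypothesis EF : forall x, x < rS -> f x = F x /\ F x < S.
Hypothesis Hld : forall a b, wfld a b -> ok (ev F ld a) (ev F ld b) ->
  mev w f M (tr trld a) = ev F ld a -> mev w f M (tr trld b) = ev F ld b ->
  mev w f M (trld (tr trld a) (tr trld b)) = ld (ev F ld a) (ev F ld b) /\
  ld (ev F ld a) (ev F ld b) < S.

Lemma tr_ok e : wfe wfld e -> safe ok F ld e ->
  mev w f M (tr trld e) = ev F ld e /\ ev F ld e < S ^ deg e.
Proof.
have Sp d : 0 < d -> S <= S ^ d.
  by case: d => // d _; rewrite expnS leq_pmulr // expn_gt0; lia.
have Sd d : d <= 31 -> S ^ d <= 2 ^ w.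
  by move=> h; apply: leq_trans Sw; rewrite leq_pexp2l //; lia.
have b2w (b : bool) : b < S by case: b; lia.
elim: e => /=.
- by move=> x xr _; rewrite expn1; case: (EF xr) => -> h.
- move=> c cl _; rewrite expn1; split; last by lia.
  by rewrite modn_small //; apply: leq_trans (Sd 1 isT); rewrite expn1; lia.
- move=> a Ha b Hb /and3P[wa wb dd] [sa sb].
  have [-> la] := Ha wa sa; have [-> lb] := Hb wb sb.
  have da := deg_gt0 a; have db := deg_gt0 b; have := Sp _ da; have := Sp _ db => h1 h2.
  have l : ev F ld a + ev F ld b < S ^ (deg a + deg b) by rewrite expnD; nia.
  by split=> //; rewrite modn_small // (leq_trans l) // Sd.
- move=> a Ha b Hb /and3P[wa wb dd] [sa sb].
  have [-> la] := Ha wa sa; have [-> lb] := Hb wb sb.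
  have da := deg_gt0 a; have db := deg_gt0 b.
  have la' : ev F ld a < 2 ^ w by apply: leq_trans la _; apply: Sd; lia.
  have lb' : ev F ld b < 2 ^ w by apply: leq_trans lb _; apply: Sd; lia.
  by split; [exact: modsub|apply: leq_ltn_trans la; apply: leq_subr].
- move=> a Ha b Hb /and3P[wa wb dd] [sa sb].
  have [-> la] := Ha wa sa; have [-> lb] := Hb wb sb.
  have l : ev F ld a * ev F ld b < S ^ (deg a + deg b) by rewrite expnD; apply: ltn_mul.
  by split=> //; rewrite modn_small // (leq_trans l) // Sd.
- move=> a Ha b Hb /and3P[wa wb dd] [sa sb].
  have [-> la] := Ha wa sa; have [-> lb] := Hb wb sb.
  by split=> //; apply: leq_ltn_trans la; apply: leq_div.
- move=> a Ha b Hb /and3P[wa wb dd] [sa sb].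
  have [-> la] := Ha wa sa; have [-> lb] := Hb wb sb.
  by split=> //; apply: leq_ltn_trans la; apply: leq_mod.
- move=> a Ha b Hb /and3P[wa wb dd] [sa sb].
  have [-> la] := Ha wa sa; have [-> lb] := Hb wb sb.
  by rewrite expn1.
- move=> a Ha b Hb /and3P[wa wb dd] [sa sb].
  have [-> la] := Ha wa sa; have [-> lb] := Hb wb sb.
  by rewrite expn1.
move=> a Ha b Hb /and3P[wa wb wl] [sa sb so].
by rewrite expn1; apply: Hld => //; [case: Ha|case: Hb].
Qed.
End TranslateOk.

(* Entry i of array j is at address j * S + i; the output is array 31. *)
Definition bld (j i : mexp) := MRaw (MBin OpAdd (MBin OpMul j (MVar rS)) i).
Definition bwf (j i : nexp) := if j is Cst c then c < 31 else false.
Notation wfb := (wfe bwf).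
Notation trb := (tr bld).

Definition mS := MVar rS.
Definition mP := MVar rO.
Definition maddr j i := MBin OpAdd (MBin OpMul (MCst j) mS) i.
(** Testing for zero twice normalises the value to 0 or 1. *)
Definition mtest e := MBin OpEqn (MBin OpEqn e (MCst 0)) (MCst 0).

(** [Emit] adds the new bit to the last word of array 31; addition does what a bitwise or would do,
    because that bit is still 0. *)
Fixpoint trc c := match c with
  | Skip => MSkip
  | Asg x e => MAsg x (trb e)
  | Sto j a e => MSto (maddr j (trb a)) (trb e)
  | Emit e => MSeq
      (MSto (maddr 31 (MBin OpDiv mP MWs))
        (MBin OpAdd (MRaw (maddr 31 (MBin OpDiv mP MWs)))
          (MBin OpMul (mtest (trb e)) (MBin OpShl (MCst 1) (MBin OpMod mP MWs)))))
      (MAsg rO (MBin OpAdd mP (MCst 1)))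
  | Seq a b => MSeq (trc a) (trc b)
  | If e a b => MIf (trb e) (trc a) (trc b)
  | While e a => MWhile (trb e) (trc a)
  end.

(** Array 0 holds the grammar and is read-only; array 31 is reserved for the output. *)
Fixpoint wfc c := match c with
  | Skip => true
  | Asg x e => (x < rS) && wfb e
  | Sto j a e => [&& 0 < j < 31, wfb a & wfb e]
  | Emit e => wfb e
  | Seq a b => wfc a && wfc b
  | If e a b => [&& wfb e, wfc a & wfc b]
  | While e a => wfb e && wfc a
  end.

Lemma tr_wf e : wfb e -> mwf (trb e).
Proof.
elim: e => //=; try (by move=> a Ha b Hb /and3P[/Ha -> /Hb -> _]).
  by move=> x h; apply: ltn_trans h _.
Qed.

Lemma trc_wf c : wfc c -> mcwf (trc c).
Proof.
elim: c => //=.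
- by move=> x e /andP[h /tr_wf ->]; rewrite (ltn_trans h).
- by move=> j a e /and3P[_ /tr_wf -> /tr_wf ->].
- by move=> e /tr_wf ->.
- by move=> a Ha b Hb /andP[/Ha -> /Hb ->].
- by move=> e a Ha b Hb /and3P[/tr_wf -> /Ha -> /Hb ->].
- by move=> e a Ha /andP[/tr_wf -> /Ha ->].
Qed.

Lemma word_rcons w I b a : 0 < w ->
  word_of_bits w (rcons I b) a =
  word_of_bits w I a + (if a == size I %/ w then b * 2 ^ (size I %% w) else 0).
Proof.
move=> w0; rewrite /word_of_bits; have Ed := divn_eq (size I) w.
have lm := ltn_pmod (size I) w0.
case: (a =P size I %/ w) => [->|ne].
  rewrite (bigD1 (Ordinal lm)) //= [in RHS](bigD1 (Ordinal lm)) //=.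
  rewrite -Ed nth_rcons ltnn eqxx nth_default // mul0n add0n addnC; congr (_ + _).
  apply: eq_bigr => i /eqP ne; rewrite nth_rcons; case: ltnP => // h.
  rewrite [in RHS]nth_default //; case: eqP => // E.
  by case: ne; apply: val_inj; apply: (@addnI (size I %/ w * w)); rewrite /= E -Ed.
rewrite addn0; apply: eq_bigr => i _; rewrite nth_rcons; case: ltnP => // h.
rewrite nth_default //; case: eqP => // E; case: ne.
by rewrite -E divnMDl // divn_small ?addn0.
Qed.

Lemma word_lt w I a : word_of_bits w I a < 2 ^ w.
Proof.
rewrite /word_of_bits.
suff H m : \sum_(i < m) nth false I (a * w + i) * 2 ^ i < 2 ^ m by apply: H.
elim: m => [|m IH]; first by rewrite big_ord0.
rewrite big_ord_recr /= expnS mul2n -addnn -addSn; apply: leq_add => //.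
by case: nth; rewrite ?mul1n ?mul0n.
Qed.

Lemma addr_inj S j i k i' : i < S -> i' < S -> j * S + i = k * S + i' -> j = k /\ i = i'.
Proof.
move=> h h' E; have S0 : 0 < S by apply: leq_ltn_trans h.
have Ej : j = k by have := congr1 (divn ^~ S) E; rewrite !divnMDl // !divn_small // !addn0.
by split=> //; rewrite Ej in E; move/addnI: E.
Qed.

(** * Simulation of the structured language on the machine *)

Section Sim.
Variables (w S : nat).
Hypothesis S0 : 2000 < S.
Hypothesis Sw : S ^ 32 <= 2 ^ w.
Hypothesis wS : w < S.
Hypothesis w0 : 0 < w.

(** Arrays are represented only at indices below [S], the only ones that [safe] allows to be
    read. *)
Record sim (s : st) (f M : nat -> nat) : Prop := Sim {
  sim_V : forall x, x < rS -> f x = V s x /\ V s x < S;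
  sim_S : f rS = S;
  sim_P : f rO = size (O s);
  sim_A : forall j i, j < 31 -> i < S -> M (j * S + i) = A s j i /\ A s j i < S;
  sim_O : forall a, a < S -> M (31 * S + a) = word_of_bits w (O s) a;
  sim_size : size (O s) < S
}.

Let Sw31 : S ^ 31 <= 2 ^ w.
Proof. by apply: leq_trans Sw; rewrite leq_pexp2l //; lia. Qed.

Let S2w : S * S <= 2 ^ w.
Proof. by apply: leq_trans Sw; rewrite -[S * S]/(S ^ 2) leq_pexp2l //; lia. Qed.

Lemma maddr_ok f M j i v : f rS = S -> j < 32 -> mev w f M i = v -> v < S ->
  mev w f M (maddr j i) = j * S + v.
Proof.
move=> ES j32 Ei vS; rewrite /= ES Ei.
have h : j * S + v < S * S by nia.
have l := leq_trans h S2w.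
apply: modaddr => //; lia.
Qed.

Lemma trb_ok s f M e : sim s f M -> wfb e -> safe (fun _ i => i < S) (V s) (A s) e ->
  mev w f M (trb e) = ev (V s) (A s) e.
Proof.
move=> R we se; have [] := @tr_ok bld bwf w S f M (V s) (A s) (fun _ i => i < S) S0 Sw31 (sim_V R) _ e we se.
  move=> [] //= c b cb iS _ Eb.
  have := @maddr_ok f M c (trb b) _ (sim_S R) (leqW cb) Eb iS; rewrite /= => ->.
  exact: (sim_A R).
by [].
Qed.

(** The factor 2 comes from [Emit], which becomes a store and an increment. The bounds demanded by
    [exec] exclude both wrap-around and stores that run into another array. *)
Lemma sim_exec c s t s' : exec S c s t s' -> wfc c -> forall f M, sim s f M ->
  exists t' f' M', [/\ mexec w (trc c) f M t' f' M', t' <= 2 * t & sim s' f' M'].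
Proof.
elim=> {c s t s'} /=.
- by move=> s _ f M R; exists 0, f, M; split=> //; constructor.
- move=> s x e se eS /andP[xr we] f M R.
  eexists _, _, _; split; [constructor|by []|].
  rewrite (trb_ok R we se); case: R => RV RS RP RA RO Rs; split=> //=.
  + by move=> y yr; have := RV y yr; case: eqP => [->|]; case: Nat.eqb_spec.
  + by case: eqP => // E; rewrite -E in xr.
  + by case: eqP => // E; rewrite -E in xr.
- move=> s j a e sa se aS eS /and3P[/andP[j0 j31] wa we] f M R.
  eexists _, _, _; split; [constructor|by []|].
  rewrite (trb_ok R we se) (maddr_ok (sim_S R) _ (trb_ok R wa sa) aS); last by lia.
  case: R => RV RS RP RA RO Rs; split=> //=.
  + move=> k i k31 iS; case: eqP => [E|ne].
      have [-> ->] := addr_inj iS aS E; by rewrite !Nat.eqb_refl.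
    case: Nat.eqb_spec => [E|_]; last exact: RA.
    case: Nat.eqb_spec => [E'|_]; last by rewrite -E; apply: RA.
    by case: ne; rewrite E E'.
  + move=> i iS; case: eqP => [E|ne]; last exact: RO.
    by have [Ej _] := addr_inj iS aS E; rewrite -Ej in j31.
- move=> s e se OS we f M R.
  have PS := sim_size R.
  have dS : size (O s) %/ w < S by apply: leq_ltn_trans PS; apply: leq_div.
  have Ed : mev w f M (MBin OpDiv mP MWs) = size (O s) %/ w by rewrite /= (sim_P R).
  have Ea := maddr_ok (sim_S R) (isT : 31 < 32) Ed dS.
  have w1 : 1 < 2 ^ w by rewrite -{1}(expn0 2) ltn_exp2l.
  set b := ev (V s) (A s) e != 0.
  have Et : mev w f M (mtest (trb e)) = b.
    by rewrite /= (trb_ok R we se) mod0n /b; case: (ev (V s) (A s) e == 0).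
  have lm := ltn_pmod (size (O s)) w0.
  have pm : 2 ^ (size (O s) %% w) < 2 ^ w by rewrite ltn_exp2l.
  have Ev : mev w f M (MBin OpAdd (MRaw (maddr 31 (MBin OpDiv mP MWs)))
          (MBin OpMul (mtest (trb e)) (MBin OpShl (MCst 1) (MBin OpMod mP MWs)))) =
      word_of_bits w (rcons (O s) b) (size (O s) %/ w).
    have -> : mev w f M (MBin OpAdd (MRaw (maddr 31 (MBin OpDiv mP MWs)))
          (MBin OpMul (mtest (trb e)) (MBin OpShl (MCst 1) (MBin OpMod mP MWs)))) =
       (M (mev w f M (maddr 31 (MBin OpDiv mP MWs))) + 
        (mev w f M (mtest (trb e)) * ((1 %% 2 ^ w * 2 ^ (f rO %% w)) %% 2 ^ w)) %% 2 ^ w) %% 2 ^ w by [].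
    rewrite Ea Et (sim_P R) (sim_O R) // (modn_small w1) mul1n (modn_small pm).
    have Ew := word_rcons (O s) b (size (O s) %/ w) w0; rewrite eqxx in Ew.
    rewrite (modn_small (m := b * _)); last by case: (b); rewrite ?mul1n ?mul0n //; lia.
    by rewrite -Ew modn_small // word_lt.
  eexists _, _, _; split; [apply: MXSeq; [apply: MXSto|apply: MXAsg]|by []|].
  rewrite Ea Ev.
  have P1 : (size (O s) + 1 %% 2 ^ w) %% 2 ^ w = (size (O s)).+1.
    rewrite (modn_small w1) addn1 modn_small //; apply: leq_trans OS _.
    by apply: leq_trans S2w; rewrite leq_pmulr //; lia.
  case: R Ea Ev => RV RS RP RA RO Rs Ea Ev; split=> //=.
  + by move=> x xr; case: eqP => [E|_]; [rewrite E in xr|apply: RV].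
  + by rewrite RP P1 size_rcons.
  + move=> j i j31 iS; case: eqP => [E|_]; last exact: RA.
    by have [Ej _] := addr_inj iS dS E; rewrite Ej in j31.
  + move=> a aS; case: eqP => [/addnI ->|ne] //.
    rewrite word_rcons // RO //; case: eqP => [E|_]; last by rewrite addn0.
    by case: ne; rewrite E.
  + by rewrite size_rcons; lia.
- move=> c1 c2 s1 t1 s2 t2 s3 _ IH1 _ IH2 /andP[w1 w2] f M R.
  have [t1' [f1 [M1 [X1 l1 R1]]]] := IH1 w1 f M R.
  have [t2' [f2 [M2 [X2 l2 R2]]]] := IH2 w2 f1 M1 R1.
  exists (t1' + t2'), f2, M2; split=> //; [exact: MXSeq X1 X2|lia].
- move=> e c1 c2 s t s' se nz _ IH /and3P[we w1 w2] f M R.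
  have [t' [f' [M' [X l R']]]] := IH w1 f M R.
  by exists t'.+1, f', M'; split=> //; [apply: MXIf1 X; rewrite (trb_ok R)|lia].
- move=> e c1 c2 s t s' se nz _ IH /and3P[we w1 w2] f M R.
  have [t' [f' [M' [X l R']]]] := IH w2 f M R.
  by exists t'.+1, f', M'; split=> //; [apply: MXIf0 X; rewrite (trb_ok R)|lia].
- move=> e c s se z /andP[we wc] f M R.
  by exists 1, f, M; split=> //; apply: MXWh0; rewrite (trb_ok R).
- move=> e c s t1 s1 t2 s2 se nz _ IH1 _ IH2 wec f M R; have /andP[we wc] := wec.
  have [t1' [f1 [M1 [X1 l1 R1]]]] := IH1 wc f M R.
  have [t2' [f2 [M2 [X2 l2 R2]]]] := IH2 wec f1 M1 R1.
  by exists (t1' + t2').+1, f2, M2; split=> //; [apply: MXWh1 X1 X2; rewrite (trb_ok R)|lia].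
Qed.
End Sim.

(** * The layout of the index *)

(** The population count of the [j] lowest binary digits. *)
Definition pref x j := \sum_(i < j) (x %/ 2 ^ i) %% 2.

Lemma pref0 x : pref x 0 = 0. Proof. by rewrite /pref big_ord0. Qed.
Lemma prefS x j : pref x j.+1 = pref x j + (x %/ 2 ^ j) %% 2.
Proof. by rewrite /pref big_ord_recr. Qed.
Lemma prefSl x j : pref x j.+1 = x %% 2 + pref (x %/ 2) j.
Proof.
rewrite /pref big_ord_recl expn0 divn1; congr (_ + _); apply: eq_bigr => i _.
by rewrite -divnMA -expnS.
Qed.
Lemma pref_le x j : pref x j <= j.
Proof.
elim: j => [|j IH]; first by rewrite pref0.
by rewrite prefS -[j.+1]addn1; apply: leq_add => //; rewrite -ltnS ltn_mod.
Qed.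
(** The recurrence that fills the table of population counts: the digit [j - 1] of [x %/ 2] is 0
    when [x < 2 ^ j], so extending the count to it changes nothing. *)
Lemma pref_half x j : x < 2 ^ j -> pref (x %/ 2) j + x %% 2 = pref x j.
Proof. by move=> h; rewrite addnC -prefSl prefS divn_small // mod0n addn0. Qed.

Definition bits w v := mkseq (fun i => odd (v %/ 2 ^ i)) w.
Lemma size_bits w v : size (bits w v) = w. Proof. exact: size_mkseq. Qed.

Definition flat (f : nat -> seq bool) m := flatten (mkseq f m).
Lemma flatS f m : flat f m.+1 = flat f m ++ f m.
Proof. by rewrite /flat mkseqS -cats1 flatten_cat /= cats0. Qed.
Lemma size_flat f m c : (forall i, i < m -> size (f i) = c) -> size (flat f m) = m * c.
Proof.
elim: m => // m IH H; rewrite flatS size_cat IH ?H // ?mulSnr // => i im.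
by apply: H; apply: leqW.
Qed.
Lemma size_flat_sum f m : size (flat f m) = \sum_(i < m) size (f i).
Proof. by elim: m => [|m IH]; rewrite ?big_ord0 // flatS size_cat IH big_ord_recr. Qed.
Lemma flat_split f m i : i < m -> exists r, flat f m = flat f i ++ f i ++ r.
Proof.
elim: m => // m IH; rewrite ltnS leq_eqVlt => /orP [/eqP ->|/IH [r E]].
  by exists [::]; rewrite flatS cats0.
by exists (r ++ f m); rewrite flatS E !catA.
Qed.

Definition fld (I : seq bool) p w := \sum_(i < w) nth false I (p + i) * 2 ^ i.

Lemma sum_bits w v : v < 2 ^ w -> \sum_(i < w) odd (v %/ 2 ^ i) * 2 ^ i = v.
Proof.
elim: w v => [|w IH] v; first by rewrite expn0 big_ord0; case: v.
rewrite expnS => h; rewrite big_ord_recl expn0 divn1 muln1.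
under eq_bigr => i _ do rewrite /= expnS divnMA (mulnCA _ 2).
rewrite -big_distrr /= IH; last by rewrite ltn_divLR // mulnC.
rewrite {3}(divn_eq v 2) modn2 addnC mulnC //.
Qed.

Lemma fld_bits a w v c p : v < 2 ^ w -> p = size a -> fld (a ++ bits w v ++ c) p w = v.
Proof.
move=> h ->; rewrite /fld -[RHS](sum_bits h); apply: eq_bigr => i _.
rewrite nth_cat ltnNge leq_addr /= addKn nth_cat size_bits ltn_ord.
by rewrite nth_mkseq.
Qed.

(* The stored string has length 2 [r_n] and is cut into blocks of length [r_bb];
   [r_l] is the width of a small counter.  Block i is preceded by [r_RK i] ones
   and has [r_KK i] ones; its code is the number [r_OF i], written on [r_WW i]
   bits, [r_PT i] bits after the start of the codes.  [r_XOF] decodes the pair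
   (number of ones, code). *)
Record rrr := RRR { r_n : nat; r_bb : nat; r_l : nat; r_RK : nat -> nat;
  r_PT : nat -> nat; r_KK : nat -> nat; r_WW : nat -> nat; r_OF : nat -> nat;
  r_XOF : nat -> nat }.

Section Index.
Variable r : rrr.
Definition r_P := 2 ^ r_bb r.
(** Width of the global fields. Positions outside the codes are at most [800 * n], and
    [n < 16 ^ bb], so [4 * bb + 10] bits would do; the width chosen is at least that. *)
Definition r_L := 8 * r_bb r + 8.
(** The additional block takes the incomplete rest of the string and lets even position [2 * n] fall
    into a block. *)
Definition r_nb := (2 * r_n r) %/ r_bb r + 1.
Definition r_nsb := (r_nb - 1) %/ r_bb r + 1.
(** The header consists of [r_L] zeros, a one and nine fields of [r_L] bits. *)
Definition r_SB := 10 * r_L + 1.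
Definition r_BLK := r_SB + r_nsb * (2 * r_L).
Definition r_TAB := r_BLK + r_nb * (4 * r_l r).
Definition r_CODE := r_TAB + (r_bb r + 1) * r_P * ((r_bb r + 1) * r_l r).

(* The leading zeros give away the width [r_L] of the fields that follow. *)
Definition hdr := flat (fun=> [:: false]) r_L ++ [:: true] ++
  bits r_L r_L ++ bits r_L (r_n r) ++ bits r_L (r_bb r) ++ bits r_L r_P ++
  bits r_L (r_l r) ++ bits r_L r_SB ++ bits r_L r_BLK ++ bits r_L r_TAB ++
  bits r_L r_CODE.
(** A directory of two levels. Every [bb] blocks form a superblock with absolute counts in [r_L]
    bits; a block stores differences to its superblock, which are at most [bb * bb] and fit into
    [r_l] bits. So the cost per block is only O(log log n). *)
Definition sbs h := bits r_L (r_RK r (h * r_bb r)) ++ bits r_L (r_PT r (h * r_bb r)).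
Definition blkr i := bits (r_l r) (r_RK r i - r_RK r (i %/ r_bb r * r_bb r)) ++
  bits (r_l r) (r_PT r i - r_PT r (i %/ r_bb r * r_bb r)) ++
  bits (r_l r) (r_KK r i) ++ bits (r_l r) (r_WW r i).
(** Row [e] belongs to a pair of a number of ones [k] and a code, with [e = k * 2 ^ bb + code];
    decoding a block and counting within it is a single access. *)
Definition tabr e := flat (fun j => bits (r_l r) (pref (r_XOF r e) j)) (r_bb r + 1).
Definition coder i := bits (r_WW r i) (r_OF r i).
Definition rrr_bits := hdr ++ flat sbs r_nsb ++ flat blkr r_nb ++
  flat tabr ((r_bb r + 1) * r_P) ++ flat coder r_nb.
End Index.

Section IndexSize.
Variable r : rrr.
Lemma size_hdr : size (hdr r) = r_SB r.
Proof.
rewrite /hdr !size_cat !size_bits (size_flat (c := 1)) // /r_SB /=; lia.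
Qed.
Lemma size_sbs h : size (sbs r h) = 2 * r_L r.
Proof. by rewrite /sbs size_cat !size_bits mul2n addnn. Qed.
Lemma size_blkr i : size (blkr r i) = 4 * r_l r.
Proof. rewrite /blkr !size_cat !size_bits; lia. Qed.
Lemma size_tabr e : size (tabr r e) = (r_bb r + 1) * r_l r.
Proof. by rewrite /tabr (size_flat (c := r_l r)) // => i _; rewrite size_bits. Qed.
Lemma size_index : size (rrr_bits r) = r_CODE r + \sum_(i < r_nb r) r_WW r i.
Proof.
rewrite /rrr_bits size_cat size_hdr size_cat (size_flat (c := 2 * r_L r)); last by move=> *; apply: size_sbs.
rewrite size_cat.
rewrite (size_flat (c := 4 * r_l r)); last by move=> *; apply: size_blkr.
rewrite size_cat.
rewrite (size_flat (c := (r_bb r + 1) * r_l r)); last by move=> *; apply: size_tabr.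
rewrite size_flat_sum; under eq_bigr => i _ do rewrite /coder size_bits.
by rewrite /r_CODE /r_TAB /r_BLK !addnA.
Qed.
End IndexSize.

(** * Cutting the string into blocks *)

Notation vg := 0. Notation vst := 1. Notation vn := 2. Notation vcnt := 3.
Notation vb := 4. Notation vk := 5. Notation vT := 6.
Notation vsp := 20. Notation vX := 21. Notation vpos := 22. Notation vp := 23.
Notation vs0 := 24. Notation vl := 25. Notation vo := 26.

Notation aGR := 0. Notation aTK := 1. Notation aST := 2. Notation aPS := 3.
Notation aLEN := 4. Notation aSAE := 5. Notation aTY := 6. Notation aBS := 7.
Notation aID := 8. Notation aREP := 9. Notation aBT := 10.

Inductive ptree := Lf of nat & bool | Nd of nat & ptree & ptree.
Definition root t := match t with Lf X _ | Nd X _ _ => X end.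
Fixpoint yield t := match t with Lf _ c => [:: c] | Nd _ l r => yield l ++ yield r end.
(* Right subtrees come first, so that read backwards this is a postorder. *)
Fixpoint pre t := match t with Lf X _ => [:: X] | Nd X l r => X :: pre r ++ pre l end.

(** Trees are checked against the encoded rules in memory. Recursion over the tree takes the place
    of an ordering of the rules. *)
Fixpoint wft (GR : nat -> nat) g t := match t with
  | Lf X c => [/\ X < g, GR (3 * X) = 0 & GR (3 * X + 1) = c]
  | Nd X l r => [/\ X < g, GR (3 * X) = 1, GR (3 * X + 1) = root l & GR (3 * X + 2) = root r]
      /\ wft GR g l /\ wft GR g r
  end.

Lemma size_pre t : (size (pre t)).+1 = 2 * size (yield t).
Proof. elim: t => //= X l IHl r IHr; rewrite !size_cat; lia. Qed.

Lemma root_lt GR g t : wft GR g t -> root t < g.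
Proof. by case: t => /= [? ? []|? ? ? [[]]]. Qed.

Lemma mkseq_upd (f : nat -> nat) c v : mkseq (upd f c v) c.+1 = rcons (mkseq f c) v.
Proof.
rewrite mkseqS Nat.eqb_refl; congr rcons; apply/eq_in_map => i.
by rewrite mem_iota => ic; case: Nat.eqb_spec => // ?; lia.
Qed.

(** A traversal with an explicit stack. The right child is pushed last and hence expanded first,
    which is the order of [pre]. *)
Definition tok_body : cmd :=
  vsp ::= $vsp - 1 ;;
  vX ::= At aST $vsp ;;
  Sto aTK $vcnt $vX ;;
  vcnt ::= $vcnt + 1 ;;
  If (At aGR (3 * $vX))
   (Sto aST $vsp (At aGR (3 * $vX + 1)) ;;
    Sto aST ($vsp + 1) (At aGR (3 * $vX + 2)) ;;
    vsp ::= $vsp + 2)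
   Skip.
Definition tok_loop := While $vsp tok_body.

Section Tok.
Variables (S g : nat) (GR : nat -> nat).
Hypothesis gS : 3 * g < S.

(** In continuation style: handling the subtree on top of the stack is followed by an arbitrary
    further run of the same loop. This is what lets the induction chain the two subtrees inside one
    [While]. A node costs 8 steps and a loop test. *)
Lemma tok_tree t : wft GR g t -> forall s stk T Q,
  mkseq (A s aST) (V s vsp) = rcons stk (root t) -> A s aGR = GR ->
  V s vcnt + size stk + 2 * size (pre t) < S ->
  (forall s', agree tok_body s s' -> mkseq (A s' aST) (V s' vsp) = stk ->
    V s' vcnt = V s vcnt + size (pre t) ->
    mkseq (A s' aTK) (V s' vcnt) = mkseq (A s aTK) (V s vcnt) ++ pre t ->
    tri S tok_loop s' T Q) ->
  tri S tok_loop s (T + 9 * size (pre t)) Q.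
Proof.
elim: t => [X c|X l IHl r IHr] /= wf s stk T Q Est Egr lS H.
- case: wf => Xg G0 G1.
  have Esp : V s vsp = (size stk).+1.
    by have := congr1 size Est; rewrite size_mkseq size_rcons.
  move: Est; rewrite Esp mkseqS => /rcons_inj[Est ESt].
  have E1 : V s vsp - 1 = size stk by lia.
  apply: (@tri_while1 S 8 T) => //=; first by rewrite Esp.
    asg; rewrite E1.
    asg. rewrite ESt.
    sto. asg. ifc; rewrite Egr G0 //.
    move=> _; fineq.
    lia.
  move=> s' ag Es'; apply: (H s' ag); rewrite Es' //=.
  + by rewrite addn1 mkseq_upd cats1.
- case: wf => -[Xg G0 G1 G2] [wl wr].
  have Esp : V s vsp = (size stk).+1.
    by have := congr1 size Est; rewrite size_mkseq size_rcons.
  move: Est; rewrite Esp mkseqS => /rcons_inj[Est ESt].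
  have E1 : V s vsp - 1 = size stk by lia.
  have rl := root_lt wl; have rr := root_lt wr.
  apply: (@tri_while1 S 8 (T + 9 * size (pre l) + 9 * size (pre r))) => //=; first by rewrite Esp.
    asg; rewrite E1.
    asg. rewrite ESt.
    sto. asg. ifc; rewrite Egr G0 //.
    move=> _. sto; rewrite ?Egr ?G1; try lia.
    sto; rewrite ?Egr ?G2; try lia.
    fineq.
  rewrite size_cat; lia.
  move=> s' ag Es'.
  apply: (IHr wr s' (rcons stk (root l))) => //; try by rewrite Es'.
  + rewrite Es' /= addn2 addn1 mkseq_upd; congr rcons.
    by rewrite mkseq_upd Est.
  + rewrite Es' /= size_rcons; move: lS; rewrite size_cat; lia.
  move=> s2 ag2 E2 C2 K2; apply: (IHl wl s2 stk) => //.
  + by case: ag2 => _ -> //; rewrite Es'.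
  + rewrite C2 Es' /=; move: lS; rewrite size_cat; lia.
  move=> s3 ag3 E3 C3 K3; apply: H => //.
  + exact: agree_trans ag (agree_trans ag2 ag3).
  + by rewrite C3 C2 Es' /= size_cat; lia.
  rewrite K3 K2 Es' /= addn1 mkseq_upd cat_rcons -catA //.
Qed.
End Tok.

Definition tok_cmd : cmd :=
  Sto aST 0 $vst ;; vsp ::= 1 ;; vcnt ::= 0 ;; tok_loop.

Lemma tok_spec S g GR t s : 3 * g < S -> wft GR g t -> A s aGR = GR ->
  V s vst = root t -> 2 * size (pre t) + 2 < S ->
  tri S tok_cmd s (9 * size (pre t) + 9) (fun s' =>
    V s' vcnt = size (pre t) /\ mkseq (A s' aTK) (size (pre t)) = pre t).
Proof.
move=> gS wt Eg Er lS; rewrite addnC.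
have rl := root_lt wt.
sto. asg. asg.
rewrite [X in tri _ _ _ X _](_ : _ = (6 + 9 * size (pre t))); last by lia.
apply: (@tok_tree S g GR gS t wt _ [::]) => //=.
- by rewrite Er.
- lia.
move=> s' ag E1 E2 E3; apply: tri_while0 => /=; try done.
  by have := congr1 size E1; rewrite size_mkseq.
by move: E3; rewrite E2 /=.
Qed.

(** * Merging neighbouring blocks along the parse tree *)

Notation blk := (nat * seq bool)%type.
Notation cont bs := (flatten [seq x.2 | x : blk <- bs]).

(* A block is labelled by the nonterminal at which it was last merged, which
   determines its contents. *)
Definition glue b X (bl br : seq blk) :=
  let x := last (0, [::]) bl in let y := head (0, [::]) br in
  if size x.2 + size y.2 <= b
  then take (size bl).-1 bl ++ (X, x.2 ++ y.2) :: behead br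
  else bl ++ br.

Fixpoint blks b t := match t with
  | Lf X c => [:: (X, [:: c])]
  | Nd X l r => glue b X (blks b l) (blks b r)
  end.

Lemma glue_rcons b X bl x y br : glue b X (rcons bl x) (y :: br) =
  if size x.2 + size y.2 <= b then bl ++ (X, x.2 ++ y.2) :: br
  else rcons bl x ++ y :: br.
Proof.
rewrite /glue last_rcons size_rcons /= -cats1 take_size_cat //.
Qed.

Definition neb (bs : seq blk) := all (fun x : blk => 0 < size x.2) bs.

Lemma blks_split b t : exists bl x y br, blks b t = rcons bl x /\ blks b t = y :: br.
Proof.
elim: t => [X c|X l [bl [x [_ [_ [El _]]]]] r [_ [_ [y [br [_ Er]]]]]] /=.
  by exists [::], (X, [:: c]), (X, [:: c]), [::].
rewrite El Er glue_rcons.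
have H (bs : seq blk) : bs <> [::] -> exists bl x y br, bs = rcons bl x /\ bs = y :: br.
  case: bs => // z bs _; exists (belast z bs), (last z bs), z, bs.
  by rewrite -lastI.
by case: ifP => _; apply: H; [case: (bl)|rewrite cat_rcons; case: (bl)].
Qed.

Lemma cont_cat (a c : seq blk) : cont (a ++ c) = cont a ++ cont c.
Proof. by rewrite map_cat flatten_cat. Qed.

Lemma cont_rcons (a : seq blk) x : cont (rcons a x) = cont a ++ x.2.
Proof. by rewrite -cats1 cont_cat /= cats0. Qed.

Lemma blks_cont b t : cont (blks b t) = yield t.
Proof.
elim: t => //= X l <- r <-.
case: (blks_split b l) => bl [x [_ [_ [-> _]]]].
case: (blks_split b r) => [_ [_ [y [br [_ ->]]]]].
rewrite glue_rcons; case: ifP => _; last by rewrite cont_cat.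
by rewrite cont_cat cont_rcons /= !catA.
Qed.

Lemma blks_size b t : 0 < b -> all (fun x : blk => 0 < size x.2 <= b) (blks b t).
Proof.
move=> b0; elim: t => /= [X c|X l + r]; first by rewrite b0.
case: (blks_split b l) => bl [x [_ [_ [-> _]]]].
case: (blks_split b r) => [_ [_ [y [br [_ ->]]]]].
rewrite glue_rcons all_rcons /= => /andP [hx hl] /andP [hy hr].
case: ifP => h; rewrite all_cat /=; last by rewrite all_rcons hx hl hy hr.
rewrite hl hr size_cat /= andbT; lia.
Qed.

Lemma blks_neb b t : 0 < b -> neb (blks b t).
Proof.
by move=> b0; apply: sub_all (blks_size t b0) => x /andP[].
Qed.

Definition adj b (x y : blk) := b < size x.2 + size y.2.

(** Merging only enlarges a block, so its inequalities with the outer neighbours persist; if the two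
    middle blocks stay apart, the failed test is their inequality. *)
Lemma blks_adj b t : sorted (adj b) (blks b t).
Proof.
elim: t => [//|X l /= + r].
case: (blks_split b l) => bl [x [_ [_ [-> _]]]].
case: (blks_split b r) => [_ [_ [y [br [_ ->]]]]].
rewrite glue_rcons; set z := (X, _).
have Hr : path (adj b) y br -> path (adj b) z br.
  by case: br => //= u br /andP[h ->]; rewrite andbT /adj /= size_cat; move: h; rewrite /adj; lia.
have Hl u : last u bl = last u bl -> path (adj b) u bl && adj b (last u bl) x -> path (adj b) u bl && adj b (last u bl) z.
  by move=> _ /andP[-> h] /=; rewrite /adj /= size_cat; move: h; rewrite /adj; lia.
case: ifP => h.
  case: bl Hl => [|u bl] Hl /=; first by move=> _; apply: Hr.
  rewrite rcons_path cat_path /= => /andP[h1 h2] h3.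
  rewrite h1 Hr // andbT /=; move: h2; rewrite /adj /= size_cat; lia.
have h' : adj b x y by rewrite /adj ltnNge h.
case: bl Hl => [|u bl] Hl /= h1 h2; first by apply/andP.
by rewrite cat_path h1 last_rcons /=; apply/andP.
Qed.

(** Summing the inequalities over consecutive pairs counts every symbol at most twice. *)
Lemma adj_count b (bs : seq blk) : sorted (adj b) bs ->
  size bs * b <= 2 * size (cont bs) + b.
Proof.
case: bs => // x bs /= ; rewrite mulSn addnC leq_add2r.
suff: path (adj b) x bs -> size bs * b + size x.2 <= 2 * size (x.2 ++ cont bs).
  by move=> H /H; lia.
elim: bs x => [|y bs IH] x /=; first by rewrite cats0; lia.
move=> /andP [h /IH]; rewrite !size_cat; move: h; rewrite /adj; lia.
Qed.

(** What a block contains if it was last merged at the root of [t]. *)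
Definition mk b t := match t with
  | Lf X c => [:: c]
  | Nd X l r => (last (0, [::]) (blks b l)).2 ++ (head (0, [::]) (blks b r)).2
  end.

(** A nonterminal has a single rule, so the root fixes the children and, by induction, the whole
    tree. *)
Lemma wft_uniq GR g t t' : wft GR g t -> wft GR g t' -> root t = root t' -> t = t'.
Proof.
elim: t t' => [X c|X l IHl r IHr] [X' c'|X' l' r'] /=.
- move=> [_ _ h] [_ _ h'] E; rewrite E in h *; congr Lf; move: h'; rewrite h.
  by case: (c) (c') => -[].
- by move=> [_ h _] [[_ h' _ _] _] E; subst; rewrite h in h'.
- by move=> [[_ h' _ _] _] [_ h _] E; subst; rewrite h in h'.
move=> [[_ _ h1 h2] [wl wr]] [[_ _ h1' h2'] [wl' wr']] E; subst.
by congr Nd; [apply: IHl => //; rewrite -h1|apply: IHr => //; rewrite -h2].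
Qed.

(** The witness is the subtree at whose root the block was last merged, or its leaf if it never
    was. *)
Lemma blks_mk GR g b t x : wft GR g t -> x \in blks b t ->
  exists t', [/\ wft GR g t', root t' = x.1 & mk b t' = x.2].
Proof.
elim: t => [X c|X l IHl r IHr] /= w.
  by rewrite inE => /eqP ->; exists (Lf X c).
case: (w) => _ [wl wr]; move: {IHl IHr} (IHl wl) (IHr wr).
have E : mk b (Nd X l r) = (last (0, [::]) (blks b l)).2 ++ (head (0, [::]) (blks b r)).2 by [].
move: E.
case: (blks_split b l) => bl [u [_ [_ [-> _]]]].
case: (blks_split b r) => [_ [_ [y [br [_ ->]]]]].
rewrite last_rcons glue_rcons /= => E IHl IHr.
case: ifP => h; rewrite mem_cat.
  case/orP => [h'|]; first by apply: IHl; rewrite mem_rcons inE h' orbT.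
  rewrite inE => /orP [/eqP ->|h']; last by apply: IHr; rewrite inE h' orbT.
  by exists (Nd X l r).
by case/orP => [/IHl|/IHr].
Qed.

(** Blocks with the same label arise from subtrees with the same root, hence from equal trees. So
    there are at most [g] different blocks, one for each label. *)
Lemma blks_label GR g b t x y : wft GR g t -> x \in blks b t -> y \in blks b t ->
  x.1 = y.1 -> x = y.
Proof.
move=> w /(blks_mk w) [t1 [w1 r1 m1]] /(blks_mk w) [t2 [w2 r2 m2]] E.
have Et : t1 = t2 by apply: wft_uniq w1 w2 _; rewrite r1 r2.
by case: x y r1 m1 r2 m2 E => x1 x2 [y1 y2] /=; subst => _ <- _ <- ->.
Qed.

Lemma blks_lt GR g b t x : wft GR g t -> x \in blks b t -> x.1 < g.
Proof. by move=> w /(blks_mk w) [t' [w' <- _]]; apply: root_lt w'. Qed.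

(* A block has its length [LEN] and label [TY] stored at its start, and its start
   [SAE] stored at its end, so that blocks can be merged in constant time. *)
Fixpoint lay (LEN SAE TY : nat -> nat) o (bs : seq blk) :=
  if bs is x :: bs' then
    [/\ LEN o = size x.2, SAE (o + size x.2) = o, TY o = x.1
      & lay LEN SAE TY (o + size x.2) bs']
  else True.

Lemma lay_cat LEN SAE TY o b1 b2 : lay LEN SAE TY o (b1 ++ b2) <->
  lay LEN SAE TY o b1 /\ lay LEN SAE TY (o + size (cont b1)) b2.
Proof.
elim: b1 o => [|x b1 IH] o /=; first by rewrite addn0; tauto.
rewrite size_cat addnA; have := IH (o + size x.2).
by split=> [[? ? ? /H[]]|[[? ? ? ?] ?]]; repeat split=> //; apply/H.
Qed.

Lemma lay_eq LEN SAE TY LEN' SAE' TY' o bs : neb bs ->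
  (forall i, o <= i < o + size (cont bs) -> LEN' i = LEN i /\ TY' i = TY i) ->
  (forall i, o < i <= o + size (cont bs) -> SAE' i = SAE i) ->
  lay LEN SAE TY o bs -> lay LEN' SAE' TY' o bs.
Proof.
elim: bs o => //= x bs IH o /andP[x0 nb]; rewrite size_cat => H1 H2 [h1 h2 h3 h4].
have [E1 E2] := H1 o ltac:(lia).
rewrite E1 E2 H2; last by lia.
split=> //; apply: IH h4 => // i h; [apply: H1|apply: H2]; lia.
Qed.

(** The stack holds the start positions of the finished subtrees. At an inner node the popped
    position [vp] is where the right part starts; the last block of the left part ends there, and
    its start is found in [aSAE]. The start of the left part stays on the stack as that of the
    merged subtree. *)
Definition rpn_body : cmd :=
  vcnt ::= $vcnt - 1 ;;
  vX ::= At aTK $vcnt ;;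
  If (At aGR (3 * $vX))
   (vsp ::= $vsp - 1 ;;
    vp ::= At aST $vsp ;;
    vs0 ::= At aSAE $vp ;;
    vl ::= ($vp - $vs0) + At aLEN $vp ;;
    If ($vl < $vb + 1)
     (Sto aLEN $vs0 $vl ;;
      Sto aSAE ($vs0 + $vl) $vs0 ;;
      Sto aTY $vs0 $vX)
     Skip)
   (Sto aPS ($vpos + 1) (At aPS $vpos + At aGR (3 * $vX + 1)) ;;
    Sto aLEN $vpos 1 ;;
    Sto aSAE ($vpos + 1) $vpos ;;
    Sto aTY $vpos $vX ;;
    Sto aST $vsp $vpos ;;
    vsp ::= $vsp + 1 ;;
    vpos ::= $vpos + 1).
Definition rpn_loop := While $vcnt rpn_body.

Notation lays s := (lay (A s aLEN) (A s aSAE) (A s aTY)).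

Section Rpn.
Variables (S g b : nat) (GR : nat -> nat).
Hypothesis gS : 3 * g < S.
Hypothesis bS : b + 1 < S.
Hypothesis b0 : 0 < b.

(** Again in continuation style. The frame clauses say that a subtree writes nothing that belongs to
    blocks left of its start, so the layout of the left subtree survives the processing of the right
    one. *)
Lemma rpn_tree t : wft GR g t -> forall s rest stk T Q,
  mkseq (A s aTK) (V s vcnt) = rest ++ pre t -> A s aGR = GR -> V s vb = b ->
  mkseq (A s aST) (V s vsp) = stk ->
  size rest + V s vpos + 2 * size (pre t) + size stk + 3 < S ->
  A s aPS (V s vpos) <= V s vpos ->
  (forall s', agree rpn_body s s' -> V s' vcnt = size rest ->
    V s' vpos = V s vpos + size (yield t) ->
    mkseq (A s' aST) (V s' vsp) = rcons stk (V s vpos) ->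
    lays s' (V s vpos) (blks b t) ->
    (forall i, i < V s vpos -> A s' aLEN i = A s aLEN i /\ A s' aTY i = A s aTY i) ->
    (forall i, i <= V s vpos -> A s' aSAE i = A s aSAE i /\ A s' aPS i = A s aPS i) ->
    (forall i, i <= size (yield t) ->
       A s' aPS (V s vpos + i) = A s aPS (V s vpos) + count_mem true (take i (yield t))) ->
    tri S rpn_loop s' T Q) ->
  tri S rpn_loop s (T + 12 * size (pre t)) Q.
Proof.
elim: t => [X c|X l IHl r IHr] wf s rest stk T Q Etk Egr Eb Est lS lP H.
- case: wf => Xg G0 G1; move: Etk; rewrite /= cats1 => Etk.
  have Ec : V s vcnt = (size rest).+1.
    by have := congr1 size Etk; rewrite size_mkseq size_rcons.
  have Esp : V s vsp = size stk by rewrite -Est size_mkseq.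
  move: Etk; rewrite Ec mkseqS => /rcons_inj[Etk ETk].
  have E1 : V s vcnt - 1 = size rest by lia.
  have c1 : c <= 1 by case: (c).
  move: lS => /= lS.
  apply: (@tri_while1 S 11 T) => //=; first by rewrite Ec.
    asg; rewrite E1.
    asg. rewrite ETk.
    ifc; rewrite Egr G0 //.
    move=> _. sto. rewrite Egr G1; lia. rewrite Egr G1.
    sto. sto. sto. sto. asg. fineq.
    lia.
  move=> s' ag Es'; apply: (H s' ag); rewrite Es' //=.
  + by rewrite -Est addn1 mkseq_upd.
  + split=> //; by rewrite ?Nat.eqb_refl.
  + move=> i iv; case: Nat.eqb_spec => //; lia.
  + move=> i iv; case: Nat.eqb_spec => //; lia.
  + move=> [|[|i]] // _; rewrite ?addn0 ?Nat.eqb_refl ?take0 /= ?addn0.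
      case: Nat.eqb_spec => //; lia.
    by rewrite ?addn0; case: (c).
case: (wf) => -[Xg G0 G1 G2] [wl wr].
have ny1 := size_pre l; have ny2 := size_pre r.
move: lS; rewrite /= size_cat => lS.
rewrite (_ : T + _ = ((T + 12) + 12 * size (pre r)) + 12 * size (pre l)); last by lia.
apply: (IHl wl s (rest ++ X :: pre r) stk) => //; rewrite ?size_cat /=; try lia.
  by rewrite Etk /= -catA.
move=> s1 ag1 C1 P1 T1 L1 U1 W1 S1.
have K1 : A s1 aTK = A s aTK by case: ag1 => _ -> .
have GR1 : A s1 aGR = GR by case: ag1 => _ -> .
have Eb1 : V s1 vb = b by case: ag1 => -> .
apply: (IHr wr s1 (rcons rest X) (rcons stk (V s vpos))) => //; rewrite ?size_rcons.
- rewrite K1 C1 cat_rcons.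
  have : mkseq (A s aTK) (V s vcnt) = (rest ++ X :: pre r) ++ pre l by rewrite Etk /= -catA.
  move/(congr1 (take (size rest + (size (pre r)).+1))).
  rewrite take_size_cat ?size_cat //= -map_take take_iota => <-.
  rewrite /mkseq; congr (map _ (iota 0 _)).
  have := congr1 size Etk; rewrite size_mkseq size_cat /= size_cat => ->; lia.
- by rewrite P1; lia.
- rewrite P1 S1 // take_size; apply: leq_add => //; exact: count_size.
move=> s2 ag2 C2 P2 T2 L2 U2 W2 S2.
have K2 : A s2 aTK = A s aTK by case: ag2 => _ -> .
have GR2 : A s2 aGR = GR by case: ag2 => _ -> .
have Eb2 : V s2 vb = b by case: ag2 => -> .
have Ec : V s2 vcnt = (size rest).+1 by rewrite C2.
have Esp : V s2 vsp = (size stk).+2.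
  by have := congr1 size T2; rewrite size_mkseq !size_rcons.
have Etk2 : A s2 aTK (V s2 vcnt - 1) = X.
  rewrite K2 Ec subn1 /=; have := congr1 (nth 0 ^~ (size rest)) Etk.
  rewrite nth_mkseq ?nth_cat ?ltnn ?subnn //=.
  have := congr1 size Etk; rewrite size_mkseq size_cat /=; lia.
move: T2; rewrite Esp mkseqS => /rcons_inj[T2 ESt].
have L1' : lays s2 (V s vpos) (blks b l).
  apply: lay_eq L1; rewrite ?blks_cont; [exact: blks_neb| |] => i hi; [apply: U2|case: (W2 i _) => //]; lia.
case: (blks_split b l) => bl [x [_ [_ [El _]]]].
case: (blks_split b r) => [_ [_ [y [br [_ Er]]]]].
have nl := blks_neb l b0; have nr := blks_neb r b0.
have cl := blks_cont b l; have cr := blks_cont b r.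
move: L1' L2 nl nr cl cr; rewrite El Er cont_rcons -cats1 => /lay_cat[L1' /= [e1 e2 e3 _]].
move=> [f1 f2 f3 f4] nl /andP[y0 nr] cl cr.
have x0 : 0 < size x.2 by move: nl; rewrite /neb all_cat /= => /and3P[].
have {}nl : neb bl by move: nl; rewrite /neb all_cat /= => /and3P[].
set ox := _ + _ in e1 e2 e3.
(* The right part starts where the last block [x] of the left part ends; this one position gives
   access to both blocks to be compared. *)
have Ep : V s1 vpos = ox + size x.2 by rewrite P1 -cl size_cat addnA.
have sl := congr1 size cl; have sr := congr1 size cr; rewrite !size_cat in sl sr.
have oxl : ox = V s vpos + size (cont bl) by [].
have Es0 : A s2 aSAE (V s1 vpos) = ox by rewrite Ep.
set d := size x.2 + size y.2.
have Edd : V s1 vpos - ox + A s2 aLEN (V s1 vpos) = d by rewrite f1 Ep addKn.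
have PSg s' : A s' aPS = A s2 aPS -> (forall i, i <= V s vpos -> A s' aPS i = A s aPS i) /\
  (forall i, i <= size (yield l ++ yield r) ->
    A s' aPS (V s vpos + i) = A s aPS (V s vpos) + count_mem true (take i (yield l ++ yield r))).
  move=> ->; split=> i hi; first by rewrite (W2 _ _).2 ?(W1 _ _).2 //; lia.
  rewrite take_cat; case: ltnP => h.
    by rewrite (W2 _ _).2 ?S1 //; lia.
  have -> : V s vpos + i = V s1 vpos + (i - size (yield l)) by rewrite P1; lia.
  rewrite S2; last by move: hi; rewrite size_cat; lia.
  by rewrite count_cat P1 S1 // take_size addnA.
set c1 := V s2 vcnt - 1 in Etk2.
apply: (@tri_while1 S 11 T _ _ _ _ (fun s' => s' = 
   let s3 := setv (setv (setv (setv (setv (setv s2 vcnt c1) vX X) vsp (size stk).+1) vp (V s1 vpos)) vs0 ox) vl d in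
   if d <= b then seta (seta (seta s3 aLEN ox d) aSAE (ox + d) ox) aTY ox X else s3)) => //=; first by rewrite Ec.
- asg. asg. rewrite Etk2; lia. rewrite Etk2 -/c1.
  ifc; rewrite GR2 G0 // => _.
  asg. rewrite Esp subn1 /=.
  asg; rewrite ?ESt; try lia.
  asg; rewrite ?Es0; try lia.
  asg; rewrite ?Edd ?f1; try lia.
  ifc; rewrite Eb2 addn1 ltnS; case: leqP => // h _; last exact: tri_skip_eq.
  sto. sto. fineq.
- lia.
move=> s' ag Es'.
have ag' : agree rpn_body s s' by apply: agree_trans ag1 (agree_trans ag2 ag).
have Ev : V s' = V (setv (setv (setv (setv (setv (setv s2 vcnt c1) vX X) vsp (size stk).+1) vp (V s1 vpos)) vs0 ox) vl d).
  by rewrite Es'; case: ifP.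
have Es1 : A s' aST = A s2 aST by rewrite Es'; case: ifP.
have Es2 : A s' aPS = A s2 aPS by rewrite Es'; case: ifP.
have [PS1 PS2] := PSg s' Es2.
have F0 i : i < ox + size x.2 -> i != ox -> A s' aLEN i = A s2 aLEN i /\ A s' aTY i = A s2 aTY i.
  move=> h h'; rewrite Es'; case: ifP => //= _.
  by case: Nat.eqb_spec => // E; rewrite E eqxx in h'.
have F1 i : i <= ox + size x.2 -> A s' aSAE i = A s2 aSAE i.
  move=> h; rewrite Es'; case: ifP => //= _.
  case: Nat.eqb_spec => // E; rewrite E /d in h; lia.
apply: (H s' ag') => //.
- by rewrite Ev /= /c1; lia.
- by rewrite Ev /= P2 P1 size_cat; lia.
- by rewrite Ev Es1 /= T2.
- rewrite /= El Er glue_rcons Es' -/d; case: ifP => h; last first.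
    rewrite -cats1 -catA; apply/lay_cat; split=> //=.
    by split=> //; rewrite -Ep.
  apply/lay_cat; split=> /=.
    by apply: lay_eq L1' => // i hi; case: Nat.eqb_spec => // E; lia.
  rewrite -oxl size_cat -/d !Nat.eqb_refl; split=> //.
  rewrite /d addnA -Ep; apply: lay_eq f4 => // i hi; case: Nat.eqb_spec => // E; lia.
- move=> i hi; have [-> ->] := F0 i ltac:(lia) ltac:(lia).
  by have [-> ->] := U2 i ltac:(lia); apply: U1.
- move=> i hi; rewrite PS1 // F1; last by lia.
  by rewrite (W2 _ _).1 ?(W1 _ _).1 //; lia.
Qed.
End Rpn.

(** * The choice of the block length, and the types of blocks *)

Notation vi := 27.

(** A parse tree with [2n - 1] nodes has [n] leaves. Raising [b] from 1 by at most [n] steps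
    suffices, which keeps the search linear. *)
Definition size_cmd : cmd :=
  vn ::= ($vcnt + 1) %/ 2 ;;
  vb ::= 1 ;;
  For vi $vn
    (If ($vb * $vb * $vb * $vg * $vg < $vn * $vn) (vb ::= $vb + 1) Skip).

(* [b] is the least positive integer with n^2 <= b^3 g^2. *)
Definition bspec g n b := [/\ 0 < b, n * n <= b * b * b * g * g &
  b = 1 \/ (b - 1) * (b - 1) * (b - 1) * g * g < n * n].

Lemma bspec_le g n b : 0 < g -> 0 < n -> bspec g n b -> b <= n.
Proof.
move=> g0 n0 [b0 _ [->|h]] //.
suff : b - 1 < n by lia.
rewrite ltnNge; apply/negP => nc; move: h; apply/negP; rewrite -leqNgt.
have c0 : 0 < b - 1 by lia.
apply: (leq_trans (leq_mul nc nc)).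
by rewrite -!(mulnA ((b - 1) * (b - 1))) leq_pmulr // !muln_gt0 g0 c0.
Qed.

Lemma size_spec S g n s : 0 < g -> 0 < n -> 2 * n + 2 < S -> V s vg = g ->
  V s vcnt + 1 = 2 * n ->
  tri S size_cmd s (4 * n + 4) (fun s' => V s' vn = n /\ bspec g n (V s' vb)).
Proof.
move=> g0 n0 nS Eg Ec; rewrite addn4.
have En : (V s vcnt + 1) %/ 2 = n by rewrite Ec mulnC mulnK.
asg; rewrite ?En; try lia. asg.
set s0 := setv (setv s vn n) vb 1.
(* A value that is still too small has been raised in every round, so it equals [i + 1]. After the
   loop it would be [n + 1], which is large enough: a contradiction. *)
apply: (tri_weak (tri_for (N := n) (c := 2) (Inv := fun i s => [/\ 0 < V s vb <= i.+1,
   V s vb = 1 \/ (V s vb - 1) * (V s vb - 1) * (V s vb - 1) * g * g < n * n &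
   V s vb * V s vb * V s vb * g * g < n * n -> V s vb = i.+1]) _ _ _ (leqnn _) _ _)) => //.
- by move=> s1 ag /=; split=> //; fr ag.
- by lia.
- by split=> //=; left.
- move=> i s1 ag Vi iN [h1 h2 h3] /=.
  have E1 : V s1 vg = g by fr ag.
  have E2 : V s1 vn = n by fr ag.
  ifc; rewrite E1 E2; case: ltnP => //= h _.
    apply: tri_asg => //=; first lia.
    have h3' := h3 h; rewrite addn1 subn1 /=.
    by split; [lia|right|move=> _; lia].
  apply: tri_skip => /=; split=> //; [lia|].
  by move=> h'; move: h; rewrite leqNgt h'.
- by lia.
move=> s' ag [Vi [h1 h2 h3]]; split; first by fr ag.
split=> //; first by case/andP: h1.
rewrite leqNgt; apply/negP => h; have E := h3 h; rewrite E in h.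
move: h; apply/negP; rewrite -leqNgt.
apply: (@leq_trans (n.+1 * n.+1)); first by apply: leq_mul.
by rewrite -!(mulnA (n.+1 * n.+1)) leq_pmulr // !muln_gt0 g0.
Qed.

(** [aID] stores the number of a type plus one, so that the initial 0 marks a label not met before.
    [aREP] keeps the start of the first block of each type. *)
Definition bl_body : cmd :=
  vX ::= At aTY $vo ;;
  If (At aID $vX) Skip
    (Sto aREP $vT $vo ;;
     vT ::= $vT + 1 ;;
     Sto aID $vX $vT) ;;
  Sto aBS $vk $vo ;;
  Sto aBT $vk (At aID $vX - 1) ;;
  vk ::= $vk + 1 ;;
  vo ::= $vo + At aLEN $vo.
Definition bl_loop := While ($vo < $vn) bl_body.
Definition bl_cmd : cmd := vo ::= 0 ;; vk ::= 0 ;; vT ::= 0 ;; bl_loop.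

Definition rpn_cmd : cmd := vpos ::= 0 ;; vsp ::= 0 ;; rpn_loop.

Definition ps (B : seq bool) i := count_mem true (take i B).

Lemma ps_le B i : ps B i <= i.
Proof. by rewrite /ps (leq_trans (count_size _ _)) // size_take_min geq_minl. Qed.

Definition d0 : blk := (0, [::]).
Definition off (bs : seq blk) u := size (cont (take u bs)).
Definition len (bs : seq blk) u := size (nth d0 bs u).2.

Lemma offS bs u : u < size bs -> off bs u.+1 = off bs u + len bs u.
Proof.
by move=> h; rewrite /off (take_nth d0) // cont_rcons size_cat.
Qed.

Lemma off_le bs u v : u <= v -> off bs u <= off bs v.
Proof.
move=> uv; rewrite /off -(cat_take_drop u (take v bs)) cont_cat size_cat.
by rewrite take_takel // leq_addr.
Qed.

Lemma off_size bs : off bs (size bs) = size (cont bs).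
Proof. by rewrite /off take_size. Qed.

Lemma ps_off bs u i : u < size bs -> i <= len bs u ->
  ps (cont bs) (off bs u + i) = ps (cont bs) (off bs u) + ps (nth d0 bs u).2 i.
Proof.
move=> us il; rewrite -{1 3}(cat_take_drop u bs) cont_cat (drop_nth d0) //= /ps.
by rewrite [take (off bs u) _]take_size_cat // take_cat ltnNge leq_addr /= addKn takel_cat // count_cat.
Qed.

Lemma size_neb (b : seq blk) : neb b -> size b <= size (cont b).
Proof. elim: b => //= x b IH /andP[? /IH]; rewrite size_cat; lia. Qed.

Section BlockList.
Variables (S g n : nat) (bs : seq blk) (LEN SAE TY : nat -> nat).
Hypothesis gS : g < S.
Hypothesis nS : n + 1 < S.
Hypothesis nb : neb bs.
Hypothesis lb : lay LEN SAE TY 0 bs.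
Hypothesis sn : size (cont bs) = n.
Hypothesis lg : all (fun x : blk => x.1 < g) bs.

Lemma lay_nth u : u < size bs ->
  LEN (off bs u) = len bs u /\ TY (off bs u) = (nth d0 bs u).1.
Proof.
move=> us; move: lb; rewrite -{1}(cat_take_drop u bs) (drop_nth d0) // => /lay_cat[_ /=].
by case.
Qed.

(** [ls] lists the labels met so far in order of first occurrence; the type number is the position
    in this list. *)
Definition BInv j (s : st) := [/\ V s vo = off bs j, V s vk = j,
  forall u, u < j -> A s aBS u = off bs u &
  exists ls : seq nat, [/\ uniq ls, V s vT = size ls,
    forall X, A s aID X = if X \in ls then (index X ls).+1 else 0,
    {subset ls <= map fst (take j bs)} &
    (forall u, u < j -> A s aBT u < size ls /\ nth 0 ls (A s aBT u) = (nth d0 bs u).1) /\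
    (forall x, x < size ls -> exists u, [/\ u < j, A s aREP x = off bs u & (nth d0 bs u).1 = nth 0 ls x])]].

Lemma bl_loop_spec s0 : V s0 vn = n -> A s0 aLEN = LEN -> A s0 aTY = TY ->
  BInv 0 s0 -> tri S bl_loop s0 (11 * size bs + 1) (BInv (size bs)).
Proof.
move=> En El Et.
have kn := size_neb nb.
suff H m : forall j s, j + m = size bs -> agree bl_body s0 s -> BInv j s ->
    tri S bl_loop s (11 * m + 1) (BInv (size bs)).
  by move=> I0; apply: (H (size bs) 0 s0).
elim: m => [|m IH] j s jm ag I.
  have js : j = size bs by lia.
  apply: tri_while0 => //=; last by rewrite -js.
  have -> : V s vn = n by fr ag.
  by case: I => -> _ _ _; rewrite js off_size sn ltnn.
have js : j < size bs by lia.
have En' : V s vn = n by fr ag.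
have El' : A s aLEN = LEN by fr ag.
have Et' : A s aTY = TY by fr ag.
case: I => Eo Ek EBS [ls [uls ET EID sub [HBT HREP]]].
have [lj tj] := lay_nth js.
have oj := offS js; have oj' := off_le bs js; have on := off_le bs js.
have lenj : 0 < len bs j by apply: (allP nb); apply: mem_nth.
have ojn : off bs j.+1 <= n by rewrite -sn -off_size; apply: off_le.
set X := (nth d0 bs j).1.
have Xg : X < g by apply: (allP lg); apply: mem_nth.
have slk : size ls <= j.
  have := uniq_leq_size uls sub; by rewrite size_map size_takel // ltnW.
(* [ls'] is the list of labels after block [j] and [i] the type of that block; either the label is
   known or it is appended. *)
have [i [ls' [il' uls' Els' sub' [isls pre']]]] : exists i ls', [/\ i < size ls', uniq ls', nth 0 ls' i = X,
   {subset ls' <= map fst (take j.+1 bs)} &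
   ((size ls' <= j.+1) /\ ((X \in ls) /\ ls' = ls \/ (X \notin ls) /\ ls' = rcons ls X /\ i = size ls))].
  have sub1 : {subset ls <= map fst (take j.+1 bs)}.
    by move=> y /sub; rewrite (take_nth d0) // map_rcons mem_rcons inE => ->; rewrite orbT.
  case: (boolP (X \in ls)) => Xl.
    exists (index X ls), ls; split; [by rewrite index_mem|done|by rewrite nth_index|done|].
    by split; [exact: leqW|left].
  exists (size ls), (rcons ls X); split=> //; rewrite ?size_rcons ?rcons_uniq ?Xl //.
  - by rewrite nth_rcons ltnn eqxx.
  - move=> y; rewrite mem_rcons inE => /orP [/eqP ->|/sub1 //].
    by rewrite (take_nth d0) // map_rcons mem_rcons inE eqxx.
  by split=> //; right.
apply: (@tri_while1 S 10 (11 * m + 1) _ _ _ _ (BInv j.+1)) => //=.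
- by rewrite Eo En'; lia.
- asg; rewrite ?Eo ?Et' ?tj -/X; try lia.
  apply: (@tri_seq S 4 5 _ _ _ _ (fun s1 => agree bl_body s s1 /\ [/\ V s1 vX = X, V s1 vo = off bs j, V s1 vk = j,
     V s1 vT = size ls' /\ (forall Y, A s1 aID Y = if Y \in ls' then (index Y ls').+1 else 0) &
     (forall x, x < size ls' -> exists u, [/\ u < j.+1, A s1 aREP x = off bs u & (nth d0 bs u).1 = nth 0 ls' x]) /\
     A s1 aBS = A s aBS /\ A s1 aBT = A s aBT])) => //.
    ifc; rewrite EID.
      case: ifP => // Xl _; apply: tri_skip.
      case: pre' => -[Xl' E]; last by rewrite Xl in Xl'.
      split; first by agr.
      rewrite E; split=> //; split=> // x /HREP [u [h1 h2 h3]]; exists u; split=> //; lia.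
    case: ifP => // Xl _.
    case: pre' => -[Xl' E]; first by rewrite Xl in Xl'.
    case: E => E Ei.
    sto. asg.
    apply: tri_sto => //=; try lia.
    split; first by agr.
    rewrite /= Eo Ek ET E size_rcons addn1; split=> //; split=> //.
      move=> Y; case: Nat.eqb_spec => [->|n1].
        by rewrite mem_rcons inE eqxx /= -cats1 index_cat Xl /= eqxx addn0.
      rewrite EID mem_rcons inE; case: eqP => //= _.
      by case: ifP => // YL; rewrite -cats1 index_cat YL.
    move=> x; rewrite ltnS leq_eqVlt => /orP [/eqP ->|h].
      exists j; split=> //; first by rewrite Nat.eqb_refl.
      by rewrite nth_rcons ltnn eqxx.
    have [u [h1 h2 h3]] := HREP x h; exists u; split=> //; first lia.
      by case: Nat.eqb_spec => // E'; lia.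
    by rewrite nth_rcons h.
  move=> s1 _ [ag1 [E1 E2 E3 [E4 E5] [H1 [E6 E7]]]].
  have El1 : A s1 aLEN = LEN by rewrite -El'; fr ag1.
  sto.
  have Xin : X \in ls' by rewrite -Els' mem_nth.
  have iX : index X ls' < size ls' by rewrite index_mem.
  sto; rewrite ?E1 ?E3 ?E5 ?Xin; try lia.
  asg; rewrite ?E3; try lia.
  apply: tri_asg => //=; rewrite ?E2 ?El1 ?lj; [by side|by side|].
  split=> //=; rewrite ?addn1 ?oj //; try lia.
  - move=> u; rewrite ltnS leq_eqVlt => /orP [/eqP ->|h]; first by rewrite Nat.eqb_refl.
    by case: Nat.eqb_spec => [->//|_]; rewrite E6 EBS.
  exists ls'; split=> //; split.
    move=> u; rewrite ltnS leq_eqVlt => /orP [/eqP ->|h].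
      by rewrite Nat.eqb_refl subn1 /= nth_index.
    case: Nat.eqb_spec => [E|_]; first by lia.
    rewrite E7; have [h1 h2] := HBT u h.
    case: pre' => -[_ E]; first by rewrite E.
    case: E => -> _; rewrite size_rcons nth_rcons h1; split=> //; lia.
  by [].
- lia.
move=> s' ag' I'; apply: (IH j.+1) => //; first by lia.
exact: agree_trans ag ag'.
Qed.
End BlockList.

Record blocksP (B : seq bool) b g (bs : seq blk) (s : st) : Prop := BlocksP {
  bp_cont : cont bs = B;
  bp_size : all (fun x : blk => 0 < size x.2 <= b) bs;
  bp_cnt : size bs * b <= 2 * size B + b;
  bp_ps : forall i, i <= size B -> A s aPS i = ps B i;
  bp_k : V s vk = size bs;
  bp_Tg : V s vT <= g;
  bp_Tk : V s vT <= size bs;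
  bp_BS : forall u, u < size bs -> A s aBS u = off bs u;
  bp_LEN : forall u, u < size bs -> A s aLEN (off bs u) = len bs u;
  bp_BT : forall u, u < size bs -> A s aBT u < V s vT /\
    exists u', [/\ u' < size bs, A s aREP (A s aBT u) = off bs u' &
                (nth d0 bs u').2 = (nth d0 bs u).2];
  bp_REP : forall x, x < V s vT -> exists u, u < size bs /\ A s aREP x = off bs u
}.

Definition prep_cmd : cmd := tok_cmd ;; size_cmd ;; rpn_cmd ;; bl_cmd.

Lemma prep_spec S g GR t s : let n := size (yield t) in
  3 * g < S -> 8 * n + 8 < S -> wft GR g t -> A s aGR = GR ->
  V s vst = root t -> V s vg = g -> (forall j i, 0 < j -> A s j i = 0) ->
  tri S prep_cmd s (60 * n + 40) (fun s' => exists b bs,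
    [/\ V s' vn = n, V s' vb = b, bspec g n b & blocksP (yield t) b g bs s']).
Proof.
move=> n gS nS wt Egr Est Eg A0.
have sp := size_pre t; rewrite -/n in sp.
have g0 : 0 < g by have := root_lt wt; lia.
have n0 : 0 < n by lia.
apply: (tri_seq (tok_spec gS wt Egr Est _) (T2 := 41 * n + 31)); [lia|lia|].
move=> s1 ag1 [E1 K1].
apply: (@tri_seq S (4 * n + 4) (37 * n + 27) _ _ _ _ _ _ (size_spec g0 n0 _ _ _)); [lia|by fr ag1|lia|lia|].
move=> s2 ag2 [E2 [b0 bb1 bb2]]; set b := V s2 vb in b0 bb1 bb2.
have bn := bspec_le g0 n0 (And3 b0 bb1 bb2).
have bS : b + 1 < S by lia.
apply: (tri_seq (T1 := 25 * n + 10) (T2 := 12 * n + 17) (Q1 := fun s' => lay (A s' aLEN) (A s' aSAE) (A s' aTY) 0 (blks b t)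
   /\ forall i, i <= n -> A s' aPS i = ps (yield t) i)); [|lia|].
  (* The list of nodes has length [2n - 1], and each node costs at most 12 steps. *)
  rewrite (_ : 25 * n + 10 = (n + 10 - 2 + 12).+2 + 12 * (2 * n - 1)); last by lia.
  rewrite (_ : 2 * n - 1 = size (pre t)) /rpn_cmd; last by lia.
  rewrite !addSn; asg; asg.
  apply: (@rpn_tree S g b GR gS bS b0 t wt _ [::] [::]) => //=; first by rewrite -K1 -E1; fr ag2.
  - by fr ag2; fr ag1.
  - lia.
  - by fr ag2; fr ag1; rewrite A0.
  move=> s3 ag3 C3 P3 T3 L3 U3 W3 PS3; apply: tri_while0 => //; first by lia.
  split=> // i hi; have := PS3 i hi; rewrite add0n => ->.
  by fr ag2; fr ag1; rewrite A0.
move=> s3 ag3 [L3 PS3].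
set bs := blks b t in L3.
have nb : neb bs := blks_neb t b0.
have sn : size (cont bs) = n by rewrite blks_cont.
have lg : all (fun x : blk => x.1 < g) bs by apply/allP => x /(blks_lt wt).
have kn := size_neb nb.
have I0 : BInv bs 0 (setv (setv (setv s3 vo 0) vk 0) vT 0).
  split=> //=; first by rewrite /off take0.
  exists [::]; split=> //= X.
  by fr ag3; fr ag2; fr ag1; rewrite A0.
have nS' : n + 1 < S by lia.
have gS' : g < S by lia.
have := @bl_loop_spec S g n bs _ _ _ gS' nS' nb L3 sn lg (setv (setv (setv s3 vo 0) vk 0) vT 0) _ erefl erefl I0.
rewrite /= => HH.
apply: (tri_weak (T := (11 * size bs + 1).+3) (Q := BInv bs (size bs))).
- asg; asg; asg; apply: HH; by fr ag3; fr ag2.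
- lia.
move=> s4 ag4 [_ Ek EBS [ls [uls ET EID sub [HBT HREP]]]].
exists b, bs; split=> //.
- by fr ag4; fr ag3.
- by fr ag4; fr ag3.
have TPS : A s4 aPS = A s3 aPS by fr ag4.
have TLEN : A s4 aLEN = A s3 aLEN by fr ag4.
split=> //.
- exact: blks_cont.
- exact: blks_size.
- rewrite -/n -sn; apply: adj_count; exact: blks_adj.
- by move=> i hi; rewrite TPS PS3.
- rewrite ET; have := uniq_leq_size uls (s2 := iota 0 g); rewrite size_iota; apply.
  move=> x /sub /mapP [y]; rewrite take_size => yb ->.
  by rewrite mem_iota /=; apply: (allP lg).
- by rewrite ET; have := uniq_leq_size uls sub; rewrite size_map take_size.
- by move=> u us; rewrite TLEN; have [] := lay_nth L3 us.
- move=> u us; have [h1 h2] := HBT u us; rewrite ET; split=> //.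
  have [u' [us' h3 h4]] := HREP _ h1; exists u'; split=> //.
  by rewrite (@blks_label GR g b t (nth d0 bs u') (nth d0 bs u)) ?h4 ?h2 // mem_nth.
- move=> x; rewrite ET => /HREP [u [h1 h2 _]]; by exists u.
Qed.

(** * Windows with many or few ones *)

(* [f'] arises from [f] by raising entries to values among those allowed by [P],
   to at least all of them. *)
Definition upds (P : nat -> nat -> Prop) (f f' : nat -> nat) :=
  [/\ forall i v, P i v -> v <= f' i, forall i, f i <= f' i &
      forall i, f' i = f i \/ P i (f' i)].

Lemma upds_refl P f : (forall i v, ~ P i v) -> upds P f f.
Proof. by move=> h; split=> // [i v /h|i] //; left. Qed.

Lemma upds_trans P P1 P2 f f1 f2 : upds P1 f f1 -> upds P2 f1 f2 ->
  (forall i v, P i v <-> P1 i v \/ P2 i v) -> upds P f f2.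
Proof.
move=> [a b c] [a' b' c'] H; split.
- by move=> i v /H [/a h|/a' //]; apply: leq_trans h (b' i).
- by move=> i; apply: leq_trans (b i) (b' i).
move=> i; case: (c' i) => [E|h]; last by right; apply/H; right.
case: (c i) => [E'|h]; first by left; rewrite E.
by right; apply/H; left; rewrite E.
Qed.

Definition maxst j x v := If (At j $x < $v) (Sto j $x $v) Skip.

Notation vidx := 37. Notation vv1 := 38. Notation vv0 := 39.

Definition upd2 j1 j0 (P1 P0 : nat -> nat -> Prop) s s' :=
  upds P1 (A s j1) (A s' j1) /\ upds P0 (A s j0) (A s' j0).

Lemma tri_maxst S j x v s : V s x < S -> V s v < S ->
  tri S (maxst j x v) s 2 (fun s' =>
    upds (fun k w => k = V s x /\ w = V s v) (A s j) (A s' j)).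
Proof.
move=> h1 h2; apply: tri_if => //=.
- case: ltnP => // h _; apply: tri_sto => //=; rewrite Nat.eqb_refl.
  split.
  + by move=> i w [-> ->]; rewrite Nat.eqb_refl.
  + by move=> i; case: Nat.eqb_spec => [->|_] //; apply: ltnW.
  + by move=> i; case: Nat.eqb_spec => [->|_]; [right|left].
case: ltnP => // h _; apply: tri_skip; split=> //.
- by move=> i w [-> ->].
- by left.
Qed.

Lemma tri_push2 S j1 j0 s : Nat.eqb j1 j0 = false -> V s vidx < S -> V s vv1 < S -> V s vv0 < S ->
  tri S (maxst j1 vidx vv1 ;; maxst j0 vidx vv0) s 4 (upd2 j1 j0
    (fun k w => k = V s vidx /\ w = V s vv1) (fun k w => k = V s vidx /\ w = V s vv0) s).
Proof.
move=> E h1 h2 h3.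
have E' : Nat.eqb j0 j1 = false by rewrite Nat.eqb_sym.
apply: (tri_seq (tri_maxst (S := S) j1 h1 h2) (T2 := 2)) => // s1 ag1 U1.
have h1' : V s1 vidx < S by fr ag1.
have h3' : V s1 vv0 < S by fr ag1.
have A1 : A s1 j0 = A s j0 by apply: (agA ag1); rewrite /= E'.
apply: (tri_weak (tri_maxst (S := S) j0 h1' h3')) => // s2 ag2; rewrite A1.
rewrite (agV ag1) // (agV ag1) // => U2; split=> //.
by rewrite (agA ag2) //= E.
Qed.

(** The values allowed for a loop of maximum updates are the union of those of its rounds, so nested
    loops need no invariants of their own. *)
Lemma tri_for_upd2 S x e body s0 N c j1 j0 (P1 P0 : nat -> nat -> nat -> Prop) T :
  occ x (modv body) = false ->
  (forall s, agree (For x e body) s0 s ->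
     safe (fun _ i => i < S) (V s) (A s) e /\ ev (V s) (A s) e = N) ->
  N < S -> N * (c + 2) + 2 <= T ->
  (forall i s, agree (For x e body) s0 s -> V s x = i -> i < N ->
    tri S body s c (upd2 j1 j0 (P1 i) (P0 i) s)) ->
  tri S (For x e body) s0 T (upd2 j1 j0
    (fun k w => exists i, i < N /\ P1 i k w) (fun k w => exists i, i < N /\ P0 i k w) s0).
Proof.
move=> h1 h2 h3 h4 Hb.
apply: (tri_weak (tri_for (Inv := fun m => upd2 j1 j0
    (fun k w => exists i, i < m /\ P1 i k w) (fun k w => exists i, i < m /\ P0 i k w) s0) h1 h2 h3 h4 _ _)) => //.
- by split; apply: upds_refl => k w [i []].
- move=> i s ag Vi iN [U1 U0]; apply: (tri_weak (Hb i s ag Vi iN)) => // s' _ [W1 W0].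
  split; [apply: upds_trans U1 W1 _|apply: upds_trans U0 W0 _] => k w; split.
  + move=> [m []]; rewrite ltnS leq_eqVlt => /orP [/eqP ->|h p]; [by right|by left; exists m].
  + by move=> [[m [h p]]|p]; [exists m; split=> //; apply: ltnW|exists i; split].
  + move=> [m []]; rewrite ltnS leq_eqVlt => /orP [/eqP ->|h p]; [by right|by left; exists m].
  + by move=> [[m [h p]]|p]; [exists m; split=> //; apply: ltnW|exists i; split].
by move=> s' _ [].
Qed.

(** * Tables for pairs of types, and the combination of pairs of blocks *)

Notation vx := 28. Notation vy := 29. Notation vsx := 30. Notation vlx := 31.
Notation vsy := 32. Notation vly := 33. Notation vrow := 34. Notation vpp := 35.
Notation vq := 36. Notation vu := 41. Notation vv := 42. Notation veu := 43.
Notation vmid := 44. Notation vom := 45. Notation vtot := 46. Notation vstr := 47.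
Notation aC1 := 11. Notation aC0 := 12. Notation aM1 := 13. Notation aM0 := 14.

Definition conv_in : cmd :=
  vtot ::= $vpp + $vq ;;
  vidx ::= $vrow + $vtot ;;
  vv1 ::= (At aPS ($vsx + $vlx) - At aPS ($vsx + $vlx - $vpp)) +
          (At aPS ($vsy + $vq) - At aPS $vsy) ;;
  vv0 ::= $vtot - $vv1 ;;
  maxst aC1 vidx vv1 ;; maxst aC0 vidx vv0.
Definition conv_xy : cmd :=
  vsx ::= At aREP $vx ;; vlx ::= At aLEN $vsx ;;
  vsy ::= At aREP $vy ;; vly ::= At aLEN $vsy ;;
  vrow ::= ($vx * $vT + $vy) * $vstr ;;
  For vpp ($vlx + 1) (For vq ($vly + 1) conv_in).
(** Total lengths range from 0 to [2 * b], so a row of [2 * b + 2] entries holds them all. *)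
Definition conv_cmd : cmd :=
  vstr ::= 2 * $vb + 2 ;; For vx $vT (For vy $vT conv_xy).

Definition with_in : cmd :=
  vidx ::= $vq - $vpp ;;
  vv1 ::= At aPS ($vsx + $vq) - At aPS ($vsx + $vpp) ;;
  vv0 ::= $vidx - $vv1 ;;
  maxst aM1 vidx vv1 ;; maxst aM0 vidx vv0.
Definition with_cmd : cmd :=
  For vx $vT
    (vsx ::= At aREP $vx ;; vlx ::= At aLEN $vsx ;;
     For vpp ($vlx + 1) (For vq ($vlx + 1) with_in)).

(** [vmid] and [vom] are the length of, and the number of ones in, the string between the two
    blocks. Only the tabulated extremes over all splittings of [q] are combined with it, which makes
    a pair cost O(b) instead of O(b^2). *)
Definition pair_in : cmd :=
  vidx ::= $vmid + $vq ;;
  vv1 ::= $vom + At aC1 ($vrow + $vq) ;;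
  vv0 ::= ($vmid - $vom) + At aC0 ($vrow + $vq) ;;
  maxst aM1 vidx vv1 ;; maxst aM0 vidx vv0.
Definition pair_uv : cmd :=
  vsx ::= At aBS $vu ;; vlx ::= At aLEN $vsx ;; veu ::= $vsx + $vlx ;;
  vsy ::= At aBS $vv ;; vly ::= At aLEN $vsy ;;
  vmid ::= $vsy - $veu ;;
  vom ::= At aPS $vsy - At aPS $veu ;;
  vrow ::= (At aBT $vu * $vT + At aBT $vv) * $vstr ;;
  For vq ($vlx + $vly + 1) pair_in.
Definition pair_cmd : cmd := For vv $vk (For vu $vv pair_uv).

Lemma ps_mono B i j : i <= j -> ps B i <= ps B j.
Proof.
move=> ij; rewrite /ps -(subnKC ij) takeD count_cat leq_addr //.
Qed.

Lemma ps_diff B i j : i <= j -> ps B j - ps B i <= j - i.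
Proof.
move=> ij; rewrite /ps -{1}(subnKC ij) takeD count_cat addKn.
by rewrite (leq_trans (count_size _ _)) // size_take_min geq_minl.
Qed.

(* The number of ones in the suffix of length p of one block followed by the
   prefix of length q of another. *)
Definition f1 B sx lx sy p q :=
  (ps B (sx + lx) - ps B (sx + lx - p)) + (ps B (sy + q) - ps B sy).

Lemma f1_le B sx lx sy p q : p <= lx -> f1 B sx lx sy p q <= p + q.
Proof.
move=> pl; rewrite /f1; apply: leq_add.
  by apply: leq_trans (ps_diff _ _) _; lia.
by apply: leq_trans (ps_diff _ _) _; lia.
Qed.

Section Conv.
Variables (S : nat) (B : seq bool) (b g : nat) (bs : seq blk).
Notation n := (size B).
Hypothesis nS : n * n * (2 * n + 2) + 8 * n + 16 < S.
Hypothesis bn : b <= n.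

Lemma row_lt T x y : T <= n -> x < T -> y < T ->
  (x * T + y) * (2 * b + 2) + (2 * b + 2) <= n * n * (2 * n + 2).
Proof.
move=> Tn xT yT; rewrite -mulSnr.
apply: leq_mul; last by lia.
apply: (@leq_trans (T * T)); last exact: leq_mul.
by rewrite -addnS; apply: leq_trans (leq_mul xT (leqnn T)); rewrite mulSn; lia.
Qed.

Lemma conv_xy_spec s T x y sx lx sy ly :
  (forall i, i <= n -> A s aPS i = ps B i) ->
  V s vx = x -> V s vy = y -> V s vT = T -> V s vstr = 2 * b + 2 ->
  T <= n -> x < T -> y < T ->
  A s aREP x = sx -> A s aLEN sx = lx -> sx + lx <= n -> lx <= b ->
  A s aREP y = sy -> A s aLEN sy = ly -> sy + ly <= n -> ly <= b ->
  let row := (x * T + y) * (2 * b + 2) in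
  tri S conv_xy s ((b + 1) * ((b + 1) * 10 + 4) + 7) (upd2 aC1 aC0
    (fun k w => exists p, p < lx + 1 /\ exists q, q < ly + 1 /\
       (k = row + (p + q) /\ w = f1 B sx lx sy p q))
    (fun k w => exists p, p < lx + 1 /\ exists q, q < ly + 1 /\
       (k = row + (p + q) /\ w = p + q - f1 B sx lx sy p q)) s).
Proof.
move=> HP Ex Ey ET Es Tn xT yT Rx Lx sxn lxb Ry Ly syn lyb row.
have rS := row_lt Tn xT yT; rewrite -/row in rS.
rewrite addnC !addSn add0n.
asg; rewrite ?Ex ?Rx; try lia.
asg; rewrite ?Lx; try lia.
asg; rewrite ?Ey ?Ry; try lia.
asg; rewrite ?Ly; try lia.
asg; rewrite ?Ex ?Ey ?ET ?Es -/row; try lia.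
set s1 := setv _ vrow row.
apply: (@tri_for_upd2 S _ _ _ s1 _ ((b + 1) * 10 + 2)) => //.
- move=> s2 ag /=; split=> //; fr ag => //=.
- lia.
- have h : lx + 1 <= b + 1 by rewrite leq_add2r.
  have := leq_mul h (leqnn ((b + 1) * 10 + 4)); lia.
move=> p s2 ag2 Ep pl.
apply: (@tri_for_upd2 S _ _ _ s2 _ 8) => //.
- move=> s3 ag /=; split=> //; fr ag; fr ag2 => //=.
- lia.
- rewrite leq_add2r; apply: leq_mul; lia.
move=> q s3 ag3 Eq ql.
have Ep3 : V s3 vpp = p by fr ag3.
have Er3 : V s3 vrow = row by fr ag3; fr ag2.
have Esx : V s3 vsx = sx by fr ag3; fr ag2.
have Elx : V s3 vlx = lx by fr ag3; fr ag2.
have Esy : V s3 vsy = sy by fr ag3; fr ag2.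
have EPS i : i <= n -> A s3 aPS i = ps B i by move=> /HP <-; fr ag3; fr ag2.
have fle := @f1_le B sx lx sy p q ltac:(lia).
have pq : p + q < 2 * b + 2 by lia.
asg; rewrite ?Ep3 ?Eq; try lia.
asg; rewrite ?Er3; try lia.
have E1 : (A s3 3 (sx + lx) - A s3 3 (sx + lx - p) + (A s3 3 (sy + q) - A s3 3 sy)) = f1 B sx lx sy p q.
  by rewrite !EPS //; lia.
asg; rewrite ?Esx ?Elx ?Ep3 ?Esy ?Eq ?E1; try lia.
asg; try lia.
by apply: (tri_weak (tri_push2 (S := S) _ _ _ _)) => //=; lia.
Qed.

Definition rowi T x y := (x * T + y) * (2 * b + 2).

Lemma rowi_inj T x y x' y' d d' : y < T -> y' < T -> d < 2 * b + 2 -> d' < 2 * b + 2 ->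
  rowi T x y + d = rowi T x' y' + d' -> [/\ x = x', y = y' & d = d'].
Proof.
move=> yT yT' dl dl' E.
have Ed : d = d'.
  by move: (congr1 (modn ^~ (2 * b + 2)) E); rewrite /rowi !modnMDl !modn_small.
rewrite Ed in E; move/addIn: E => /eqP; rewrite /rowi eqn_pmul2r; last by lia.
move=> /eqP E.
have Ey : y = y'.
  by move: (congr1 (modn ^~ T) E); rewrite !modnMDl !modn_small.
split=> //; rewrite Ey in E; move/addIn: E => /eqP; rewrite eqn_pmul2r; last by lia.
by move/eqP.
Qed.

(** Each entry is at least the value of every splitting and at most that of some splitting, hence
    the maximum. *)
Definition convP s := forall x y, x < V s vT -> y < V s vT ->
  let sx := A s aREP x in let lx := A s aLEN sx in
  let sy := A s aREP y in let ly := A s aLEN sy in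
  let r := rowi (V s vT) x y in
  (forall p q, p <= lx -> q <= ly ->
    f1 B sx lx sy p q <= A s aC1 (r + (p + q)) /\
    p + q - f1 B sx lx sy p q <= A s aC0 (r + (p + q))) /\
  (forall d, d <= lx + ly ->
    (exists p q, [/\ p <= lx, q <= ly, p + q = d & A s aC1 (r + d) <= f1 B sx lx sy p q]) /\
    (exists p q, [/\ p <= lx, q <= ly, p + q = d & A s aC0 (r + d) <= d - f1 B sx lx sy p q])).

Lemma blocks_pos s a : blocksP B b g bs s -> (exists u, u < size bs /\ a = off bs u) ->
  a + A s aLEN a <= n /\ A s aLEN a <= b.
Proof.
move=> H [u [us ->]]; rewrite (bp_LEN H) // -offS //; split.
  by rewrite -(bp_cont H) -off_size; apply: off_le.
by have /(allP (bp_size H))/andP[] : nth d0 bs u \in bs by apply: mem_nth.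
Qed.

Lemma size_bs s : blocksP B b g bs s -> size bs <= n.
Proof.
move=> H; rewrite -(bp_cont H); apply: size_neb.
by apply: sub_all (bp_size H) => x /andP[].
Qed.

Lemma conv_spec s0 : blocksP B b g bs s0 -> V s0 vb = b ->
  (forall i, A s0 aC1 i = 0) -> (forall i, A s0 aC0 i = 0) ->
  let T := V s0 vT in
  tri S conv_cmd s0 (T * (T * ((b + 1) * ((b + 1) * 10 + 4) + 9) + 4) + 3)
   (fun s => convP s /\ V s vstr = 2 * b + 2).
Proof.
move=> H Eb Z1 Z0 T.
have Tn : T <= n by apply: leq_trans (bp_Tk H) (size_bs H).
have TS : T < S by lia.
rewrite [X in tri _ _ _ X _]addnS; asg; rewrite ?Eb; try lia.
set s1 := setv _ _ _.
have R x : x < T -> A s0 aREP x + A s0 aLEN (A s0 aREP x) <= n /\ A s0 aLEN (A s0 aREP x) <= b.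
  by move=> /(bp_REP H); apply: (blocks_pos H).
set c := (b + 1) * ((b + 1) * 10 + 4) + 7.
pose Pw (h : nat -> nat -> nat -> nat -> nat -> nat) k w := exists x, x < T /\ exists y, y < T /\
  exists p, p < A s0 aLEN (A s0 aREP x) + 1 /\ exists q, q < A s0 aLEN (A s0 aREP y) + 1 /\
  (k = rowi T x y + (p + q) /\ w = h (A s0 aREP x) (A s0 aLEN (A s0 aREP x)) (A s0 aREP y) p q).
apply: (@tri_weak S _ s1 (T * (T * (c + 2) + 4) + 2) _ (upd2 aC1 aC0 (Pw (f1 B))
   (Pw (fun sx lx sy p q => p + q - f1 B sx lx sy p q)) s1)).
- apply: (@tri_for_upd2 S _ _ _ s1 T (T * (c + 2) + 2)) => //.
  + by move=> s2 ag /=; split=> //; fr ag.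
  + by rewrite -addnA.
  move=> x s2 ag2 Ex xT.
  apply: (@tri_for_upd2 S _ _ _ s2 T c) => //.
  + by move=> s3 ag /=; split=> //; fr ag; fr ag2.
  move=> y s3 ag3 Ey yT.
  have [h1 h2] := R x xT; have [h3 h4] := R y yT.
  apply: conv_xy_spec => //; try (by fr ag3; fr ag2).
  by move=> i /(bp_ps H) <-; fr ag3; fr ag2.
- by rewrite /c -addnA.
move=> s ag [U1 U0]; split; last by fr ag.
have ET : V s vT = T by fr ag.
have ER : A s aREP = A s0 aREP by fr ag.
have EL : A s aLEN = A s0 aLEN by fr ag.
move=> x y; rewrite ET ER EL => xT yT /=.
have [h1 h2] := R x xT; have [h3 h4] := R y yT.
split.
  move=> p q px qy; split.
    case: U1 => h _ _; apply: h; exists x; split=> //; exists y; split=> //.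
    exists p; split; first by rewrite addn1.
    by exists q; split; first by rewrite addn1.
  case: U0 => h _ _; apply: h; exists x; split=> //; exists y; split=> //.
  exists p; split; first by rewrite addn1.
  by exists q; split; first by rewrite addn1.
move=> d dl; set lx := A s0 aLEN (A s0 aREP x) in h1 h2 dl *.
set ly := A s0 aLEN (A s0 aREP y) in h3 h4 dl *.
(* A splitting to fall back on: if an entry was never raised it is 0, and any splitting of [d]
   bounds it. *)
have D0 : [/\ minn d lx <= lx, d - minn d lx <= ly & minn d lx + (d - minn d lx) = d] by split; lia.
have Gen h f : upds (Pw h) (fun=> 0) f -> exists p q, [/\ p <= lx, q <= ly, p + q = d &
    f (rowi T x y + d) <= h (A s0 aREP x) lx (A s0 aREP y) p q].
  case=> _ _ /(_ (rowi T x y + d)) [E|].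
    case: D0 => e1 e2 e3; exists (minn d lx), (d - minn d lx); split=> //; by rewrite E.
  move=> [x' [xT' [y' [yT' [p [pl [q [ql [Ek Ew]]]]]]]]].
  have [h1' h2'] := R x' xT'; have [h3' h4'] := R y' yT'.
  have dS : d < 2 * b + 2 by lia.
  have pS : p + q < 2 * b + 2 by lia.
  (* Rows do not overlap, so the value in this entry comes from the same pair of types and the same
     total length. *)
  have [? ? Ed] := rowi_inj yT yT' dS pS Ek; subst x' y'.
  exists p, q; split; try lia. by rewrite Ew.
split; last first.
  have [|p [q [p1 p2 p3 p4]]] := Gen (fun sx lx sy p q => p + q - f1 B sx lx sy p q) (A s aC0).
    case: U0 => a1 a2 a3; split=> // i; case: (a3 i) => h; [left; rewrite h; exact: Z0|by right].
  by rewrite p3 in p4; exists p, q.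
apply: Gen; case: U1 => a1 a2 a3; split=> // i; case: (a3 i) => h; [left; rewrite h; exact: Z1|by right].
Qed.

Definition win i m := ps B (i + m) - ps B i.

Lemma win_le i m : win i m <= m.
Proof. by rewrite /win (leq_trans (ps_diff _ (leq_addr _ _))) // addKn. Qed.

(** Zeros are counted in [aM0] so that both tables are maxima and may start from 0. *)
Definition winP s := forall m, m <= n ->
  (forall i, i + m <= n -> win i m <= A s aM1 m /\ m - win i m <= A s aM0 m) /\
  (exists i, i + m <= n /\ A s aM1 m <= win i m) /\
  (exists i, i + m <= n /\ A s aM0 m <= m - win i m).

Lemma block_at s i : blocksP B b g bs s -> i < n ->
  exists u, [/\ u < size bs, off bs u <= i & i < off bs u + len bs u].
Proof.
move=> H iN; have : i < off bs (size bs) by rewrite off_size (bp_cont H).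
have := leqnn (size bs); elim: {1 3}(size bs) => [|k IH] kb ik.
  by move: ik; rewrite /off take0.
case: (leqP (off bs k) i) => h; last by apply: IH => //; apply: ltnW.
by exists k; split=> //; rewrite -offS.
Qed.

Lemma ps_block s u j : blocksP B b g bs s -> u < size bs -> j <= len bs u ->
  ps B (off bs u + j) = ps B (off bs u) + ps (nth d0 bs u).2 j.
Proof. by move=> H us jl; rewrite -(bp_cont H) ps_off. Qed.

(** A window lies in a single block and is then treated in the representative of its type by
    [with_cmd], or it consists of a suffix of a block, the string up to a later block and a prefix
    of that one, which is the case of [pair_cmd]. *)
Lemma win_spec s0 : blocksP B b g bs s0 -> convP s0 -> V s0 vstr = 2 * b + 2 ->
  (forall i, A s0 aM1 i = 0) -> (forall i, A s0 aM0 i = 0) ->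
  let T := V s0 vT in let k := size bs in
  tri S (with_cmd ;; pair_cmd) s0
   (T * ((b + 1) * ((b + 1) * 9 + 4) + 6) + k * (k * (20 * b + 21) + 4) + 4) winP.
Proof.
move=> H HC Es Z1 Z0 T k.
have kn := size_bs H.
have Tn : T <= n by apply: leq_trans (bp_Tk H) kn.
have R x : x < T -> A s0 aREP x + A s0 aLEN (A s0 aREP x) <= n /\ A s0 aLEN (A s0 aREP x) <= b.
  by move=> /(bp_REP H); apply: (blocks_pos H).
pose W1 kk w := exists x, x < T /\ exists p, p < A s0 aLEN (A s0 aREP x) + 1 /\
  exists q, q < A s0 aLEN (A s0 aREP x) + 1 /\
  (kk = q - p /\ w = ps B (A s0 aREP x + q) - ps B (A s0 aREP x + p)).
pose W0 kk w := exists x, x < T /\ exists p, p < A s0 aLEN (A s0 aREP x) + 1 /\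
  exists q, q < A s0 aLEN (A s0 aREP x) + 1 /\
  (kk = q - p /\ w = (q - p) - (ps B (A s0 aREP x + q) - ps B (A s0 aREP x + p))).
apply: (@tri_seq S (T * ((b + 1) * ((b + 1) * 9 + 4) + 6) + 2) (k * (k * (20 * b + 21) + 4) + 2) _ _ _ _
   (upd2 aM1 aM0 W1 W0 s0)); [|lia|].
  apply: (@tri_for_upd2 S _ _ _ s0 T ((b + 1) * ((b + 1) * 9 + 4) + 4)) => //.
  + by move=> s2 ag /=; split=> //; fr ag.
  + lia.
  + by rewrite -addnA.
  move=> x s2 ag2 Ex xT.
  have [h1 h2] := R x xT.
  rewrite addnC !addSn add0n.
  have Rx : A s2 aREP x = A s0 aREP x by fr ag2.
  have Lx : A s2 aLEN (A s0 aREP x) = A s0 aLEN (A s0 aREP x) by fr ag2.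
  set lx := A s0 aLEN (A s0 aREP x) in h1 h2 Lx *.
  asg; rewrite ?Ex ?Rx; try lia.
  asg; rewrite ?Lx; try lia.
  set s3 := setv _ _ lx.
  have hb : lx + 1 <= b + 1 by rewrite leq_add2r.
  apply: (@tri_for_upd2 S _ _ _ s3 _ ((b + 1) * 9 + 2)) => //.
  + by move=> s4 ag /=; split=> //; fr ag => /=.
  + lia.
  + have := leq_mul hb (leqnn ((b + 1) * 9 + 4)); lia.
  move=> p s4 ag4 Ep pl.
  apply: (@tri_for_upd2 S _ _ _ s4 _ 7) => //.
  + by move=> s5 ag /=; split=> //; fr ag; fr ag4 => /=.
  + lia.
  + have := leq_mul hb (leqnn 9); lia.
  move=> q s5 ag5 Eq ql.
  have Ep5 : V s5 vpp = p by fr ag5.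
  have Esx : V s5 vsx = A s0 aREP x by fr ag5; fr ag4.
  have EPS i : i <= n -> A s5 aPS i = ps B i by move=> /(bp_ps H) <-; fr ag5; fr ag4; rewrite /s3 /=; fr ag2.
  have E1 : A s5 3 (A s0 9 x + q) - A s5 3 (A s0 9 x + p) = ps B (A s0 9 x + q) - ps B (A s0 9 x + p).
    by rewrite !EPS //; lia.
  have pn := ps_le B (A s0 aREP x + q).
  asg; rewrite ?Ep5 ?Eq; try lia.
  asg; rewrite ?Ep5 ?Eq ?Esx ?E1; try lia.
  asg; try lia.
  by apply: (tri_weak (tri_push2 (S := S) _ _ _ _)) => //=; lia.
move=> s1 ag1 U.
have EL1 : A s1 aLEN = A s0 aLEN by fr ag1.
have EB1 : A s1 aBT = A s0 aBT by fr ag1.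
have EBS1 : A s1 aBS = A s0 aBS by fr ag1.
have ER1 : A s1 aREP = A s0 aREP by fr ag1.
have EC1 : A s1 aC1 = A s0 aC1 by fr ag1.
have EC0 : A s1 aC0 = A s0 aC0 by fr ag1.
have ET1 : V s1 vT = T by fr ag1.
have bt u : u < k -> A s0 aBT u < T by move=> /(bp_BT H) [].
(* A block and the representative of its type have equal contents at possibly different positions,
   so counts are compared relative to the start of the block. *)
have RP u : u < k -> let r := A s0 aREP (A s0 aBT u) in
   A s0 aLEN r = len bs u /\ forall j, j <= len bs u ->
     ps B (r + j) = ps B r + ps (nth d0 bs u).2 j.
  move=> us r; have [_ [u' [us' Er Ec]]] := bp_BT H us.
  have El : len bs u' = len bs u by rewrite /len Ec.
  rewrite /r Er (bp_LEN H) // El; split=> // j jl.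
  by rewrite (ps_block H) // ?El // Ec.
have lb u : u < k -> off bs u + len bs u <= n /\ len bs u <= b.
  by move=> us; have := @blocks_pos s0 (off bs u) H; rewrite (bp_LEN H) //; apply; exists u.
have Ef u v p q : u < k -> v < k -> p <= len bs u -> q <= len bs v ->
   f1 B (A s0 aREP (A s0 aBT u)) (len bs u) (A s0 aREP (A s0 aBT v)) p q =
   f1 B (off bs u) (len bs u) (off bs v) p q.
  move=> uk vk pl ql; have [e1 e2] := RP u uk; have [e3 e4] := RP v vk.
  rewrite /f1 -!addnBA // !e2 ?e4 ?leq_subr // !(ps_block H) ?leq_subr //.
  by rewrite !subnDl !addKn.
pose om u v := ps B (off bs v) - ps B (off bs u + len bs u).
pose mid u v := off bs v - (off bs u + len bs u).
pose row u v := rowi T (A s0 aBT u) (A s0 aBT v).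
pose X1 kk w := exists v, v < k /\ exists u, u < v /\ exists d, d < len bs u + len bs v + 1 /\
  (kk = mid u v + d /\ w = om u v + A s0 aC1 (row u v + d)).
pose X0 kk w := exists v, v < k /\ exists u, u < v /\ exists d, d < len bs u + len bs v + 1 /\
  (kk = mid u v + d /\ w = (mid u v - om u v) + A s0 aC0 (row u v + d)).
have uvl u v : u < v -> v < k -> off bs u + len bs u <= off bs v.
  by move=> uv vk; rewrite -offS; [apply: off_le|apply: ltn_trans vk].
have omm u v : u < v -> v < k -> om u v <= mid u v.
  by move=> uv vk; apply: ps_diff; apply: uvl.
have CP u v d : u < k -> v < k -> d <= len bs u + len bs v ->
  (exists p q, [/\ p <= len bs u, q <= len bs v, p + q = d &
     A s0 aC1 (row u v + d) <= f1 B (off bs u) (len bs u) (off bs v) p q]) /\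
  (exists p q, [/\ p <= len bs u, q <= len bs v, p + q = d &
     A s0 aC0 (row u v + d) <= d - f1 B (off bs u) (len bs u) (off bs v) p q]).
  move=> uk vk dl; have [_] := HC _ _ (bt u uk) (bt v vk).
  have [e1 e2] := RP u uk; have [e3 e4] := RP v vk.
  rewrite e1 e3 => /(_ d dl).
  by move=> [[p [q [a1 a2 a3 a4]]] [p' [q' [b1 b2 b3 b4]]]]; split;
    [exists p, q|exists p', q']; split=> //; rewrite -Ef.
apply: (@tri_weak S _ s1 (k * (k * (20 * b + 21) + 4) + 2) _ (upd2 aM1 aM0 X1 X0 s1)) => //.
  apply: (@tri_for_upd2 S _ _ _ s1 k (k * (20 * b + 21) + 2)) => //.
  + by move=> s2 ag /=; split=> //; fr ag; fr ag1; rewrite (bp_k H).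
  + lia.
  + by rewrite -addnA.
  move=> v s2 ag2 Ev vk.
  apply: (@tri_for_upd2 S _ _ _ s2 v (20 * b + 19)) => //.
  + by move=> s3 ag /=; split=> //; fr ag.
  + lia.
  + by rewrite leq_add2r -addnA leq_mul2r ltnW ?orbT.
  move=> u s3 ag3 Eu uv.
  have uk : u < k by apply: ltn_trans vk.
  have [lu1 lu2] := lb u uk; have [lv1 lv2] := lb v vk.
  have ouv := uvl u v uv vk.
  have EPS i : i <= n -> A s3 aPS i = ps B i by move=> /(bp_ps H) <-; fr ag3; fr ag2; fr ag1.
  have EBS i : i < k -> A s3 aBS i = off bs i by move=> /(bp_BS H) <-; fr ag3; fr ag2; fr ag1.
  have EL i : i < k -> A s3 aLEN (off bs i) = len bs i by move=> /(bp_LEN H) <-; fr ag3; fr ag2; fr ag1.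
  have EBT : A s3 aBT = A s0 aBT by fr ag3; fr ag2; fr ag1.
  have ET3 : V s3 vT = T by fr ag3; fr ag2; fr ag1.
  have Es3 : V s3 vstr = 2 * b + 2 by fr ag3; fr ag2; fr ag1.
  have Ev3 : V s3 vv = v by fr ag3.
  have rS := row_lt Tn (bt u uk) (bt v vk).
  have rE : (A s0 10 u * T + A s0 10 v) * (2 * b + 2) = row u v by [].
  rewrite rE in rS.
  have btu := bt u uk; have btv := bt v vk.
  have pln := ps_le B (off bs v).
  rewrite addnC !addSn add0n.
  asg; rewrite ?Eu ?EBS; try lia.
  asg; rewrite ?EL; try lia.
  asg; try lia.
  asg; rewrite ?Ev3 ?EBS; try lia.
  asg; rewrite ?EL; try lia.
  asg; try lia.
  asg; rewrite ?EPS; try lia.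
  asg; rewrite ?Eu ?Ev3 ?EBT ?ET3 ?Es3 ?rE; try lia.
  set s4 := setv _ _ (row u v).
  apply: (@tri_for_upd2 S _ _ _ s4 _ 7) => //.
  + by move=> s5 ag /=; split=> //; fr ag => /=.
  + lia.
  + lia.
  move=> d s5 ag5 Ed dl.
  have Em : V s5 vmid = mid u v by fr ag5.
  have Eo : V s5 vom = om u v by fr ag5.
  have Er : V s5 vrow = row u v by fr ag5.
  have EC1' : A s5 aC1 = A s0 aC1 by fr ag5; rewrite /s4 /=; fr ag3; fr ag2; fr ag1.
  have EC0' : A s5 aC0 = A s0 aC0 by fr ag5; rewrite /s4 /=; fr ag3; fr ag2; fr ag1.
  have dl' : d <= len bs u + len bs v by lia.
  have [[p [q [p1 q1 pq1 c1]]] [p' [q' [p2 q2 pq2 c2]]]] := CP u v d uk vk dl'.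
  have fle := @f1_le B (off bs u) (len bs u) (off bs v) p q p1.
  have oml := omm u v uv vk.
  have midn : mid u v <= n by rewrite /mid; lia.
  asg; rewrite ?Ed ?Em; try lia.
  asg; rewrite ?Ed ?Em ?Eo ?Er ?EC1'; try lia.
  asg; rewrite ?Ed ?Em ?Eo ?Er ?EC0'; try lia.
  by apply: (tri_weak (tri_push2 (S := S) _ _ _ _)) => //=; lia.
move=> s2 ag2 U2 m mn.
(* The value formed for a splitting is the number of ones of an actual window of the string. *)
have wf1 u v p q : u < v -> v < k -> p <= len bs u -> q <= len bs v ->
   om u v + f1 B (off bs u) (len bs u) (off bs v) p q =
   win (off bs u + len bs u - p) (mid u v + (p + q)).
  move=> uv vk pl ql; rewrite /om /f1 /win /mid.
  have ouv := uvl u v uv vk.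
  have [lv1 _] := lb v vk.
  have m1 := @ps_mono B (off bs u + len bs u - p) (off bs u + len bs u) ltac:(lia).
  have m2 := ps_mono B ouv.
  have m3 := @ps_mono B (off bs v) (off bs v + q) ltac:(lia).
  have -> : off bs u + len bs u - p + (off bs v - (off bs u + len bs u) + (p + q)) = off bs v + q by lia.
  lia.
case: U U2 => [[u1 u2 u3] [z1 z2 z3]] [[x1 x2 x3] [y1 y2 y3]].
split.
  (* An empty window meets no block. For [m > 0] the blocks [u] and [v] of its first and last
     positions exist. *)
  move=> i im; case: (posnP m) => [->|m0].
    by rewrite /win addn0 subnn sub0n.
  have iN : i < n by lia.
  have jN : (i + m).-1 < n by lia.
  have [u [uk ui iu]] := block_at H iN.
  have [v [vk vj jv]] := block_at H jN.
  have uv : u <= v.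
    rewrite leqNgt; apply/negP => vu; have := uvl v u vu uk; lia.
  move: uv; rewrite leq_eqVlt => /orP [/eqP E|uv].
    rewrite -E in vj jv.
    have [ru re] := RP u uk; set r := A s0 aREP _ in ru re.
    have Pw : win i m = ps B (r + (i - off bs u + m)) - ps B (r + (i - off bs u)).
      rewrite !re; try lia.
      rewrite subnDl -(subnDl (ps B (off bs u))) -!(ps_block H) //; try lia.
      rewrite /win; congr (ps B _ - ps B _); lia.
    have Em : m = (i - off bs u + m) - (i - off bs u) by lia.
    split.
      apply: leq_trans (x2 m); apply: u1; exists (A s0 aBT u); split; first exact: bt.
      exists (i - off bs u); split; first by rewrite -/r ru; lia.
      by exists (i - off bs u + m); split; first by rewrite -/r ru; lia.
    apply: leq_trans (y2 m); apply: z1; exists (A s0 aBT u); split; first exact: bt.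
    exists (i - off bs u); split; first by rewrite -/r ru; lia.
    exists (i - off bs u + m); split; first by rewrite -/r ru; lia.
    by split=> //; rewrite -Em -Pw.
  have ouv := uvl u v uv vk.
  set p := off bs u + len bs u - i; set q := i + m - off bs v.
  have pl : p <= len bs u by rewrite /p; lia.
  have ql : q <= len bs v by rewrite /q; lia.
  have [e1 e2] := RP u uk; have [e3 e4] := RP v vk.
  have [+ _] := HC _ _ (bt u uk) (bt v vk).
  rewrite e1 e3 => /(_ p q pl ql); rewrite Ef // => -[c1 c2].
  have Ew := wf1 u v p q uv vk pl ql.
  have Em : mid u v + (p + q) = m by rewrite /mid /p /q; lia.
  have Ei : off bs u + len bs u - p = i by rewrite /p; lia.
  rewrite Em Ei in Ew.
  have oml := omm u v uv vk.
  split.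
    apply: (@leq_trans (om u v + A s0 aC1 (row u v + (p + q)))); first by rewrite -Ew leq_add2l.
    apply: x1; exists v; split=> //; exists u; split=> //; exists (p + q); split=> //; lia.
  apply: (@leq_trans (mid u v - om u v + A s0 aC0 (row u v + (p + q)))).
    have fle := @f1_le B (off bs u) (len bs u) (off bs v) p q pl.
    by rewrite -Ew -Em; move: c2; rewrite -/(row u v); lia.
  apply: y1; exists v; split=> //; exists u; split=> //; exists (p + q); split=> //; lia.
split.
  case: (x3 m) => [E|].
    rewrite E; case: (u3 m) => [E'|]; first by rewrite E' Z1; exists 0.
    move=> [x [xT [p [pl [q [ql [Em Ew]]]]]]]; have [h1 h2] := R x xT.
    (* The loops of [with_cmd] also run through [q < p]; truncated subtraction then gives length 0
       and count 0, which is still the value of a window. *)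
    case: (leqP p q) => pq.
      exists (A s0 aREP x + p); split; first by lia.
      rewrite Ew /win; set r := A s0 aREP x.
      by have -> : r + p + m = r + q by lia.
    exists 0; rewrite Ew; split; first by lia.
    have := @ps_mono B (A s0 aREP x + q) (A s0 aREP x + p) ltac:(lia); rewrite -subn_eq0 => /eqP ->.
    by [].
  move=> [v [vk [u [uv [d [dl [Em Ew]]]]]]].
  have uk := ltn_trans uv vk.
  have dl' : d <= len bs u + len bs v by lia.
  have [[p [q [p1 q1 pq1 c1]]] _] := CP u v d uk vk dl'.
  have [lv1 _] := lb v vk; have ouv := uvl u v uv vk.
  exists (off bs u + len bs u - p); rewrite Ew Em -pq1 -wf1 // leq_add2l pq1; split=> //.
  by rewrite /mid; lia.
case: (y3 m) => [E|].
  rewrite E; case: (z3 m) => [E'|]; first by rewrite E' Z0; exists 0.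
  move=> [x [xT [p [pl [q [ql [Em Ew]]]]]]]; have [h1 h2] := R x xT.
  case: (leqP p q) => pq.
    exists (A s0 aREP x + p); split; first by lia.
    rewrite Ew /win; set r := A s0 aREP x.
    have -> : r + p + m = r + q by lia.
    by rewrite Em.
  exists 0; rewrite Ew; split; first by lia.
  have -> : q - p = 0 by lia.
  by [].
move=> [v [vk [u [uv [d [dl [Em Ew]]]]]]].
have uk := ltn_trans uv vk.
have dl' : d <= len bs u + len bs v by lia.
have [_ [p [q [p1 q1 pq1 c1]]]] := CP u v d uk vk dl'.
have [lv1 _] := lb v vk; have ouv := uvl u v uv vk.
have fle := @f1_le B (off bs u) (len bs u) (off bs v) p q p1.
have oml := omm u v uv vk.
exists (off bs u + len bs u - p); rewrite Ew; split; first by rewrite Em /mid; lia.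
have Ewf := wf1 u v p q uv vk p1 q1; rewrite pq1 -Em in Ewf.
rewrite -Ewf; lia.
Qed.
End Conv.

(** * Constructing and writing the rank structure *)

Notation vbb := 7. Notation vP := 8. Notation vL := 9. Notation vll := 10.
Notation vnb := 11. Notation vnsb := 12. Notation vSB := 13. Notation vBLK := 14.
Notation vTAB := 15. Notation vCODE := 16.
Notation vpw := 50. Notation vt2 := 51. Notation vxx := 52. Notation vkk := 53.
Notation vW := 54. Notation vrk := 55. Notation vpt := 56. Notation vj := 57.
Notation vfv := 58. Notation vfi := 59. Notation vh := 60.
Notation aD := 15. Notation aPOP := 16. Notation aCNT := 17. Notation aOFX := 18.
Notation aXOF := 19. Notation aWD := 20. Notation aRK := 21. Notation aPT := 22.
Notation aKK := 23. Notation aWW := 24. Notation aOF := 25.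

Definition D_cmd : cmd := For vi $vn
  (Sto aD $vi (At aM1 ($vi + 1) - At aM1 $vi) ;;
   Sto aD ($vn + $vi) (1 - (At aM0 ($vi + 1) - At aM0 $vi))).

(** [vpw] runs through the powers of 16 until it exceeds [n], with [2 ^ bb] computed alongside.
    [vll] is doubled because its fields must hold numbers up to [bb * bb]. *)
Definition par_cmd : cmd :=
  vbb ::= 1 ;; vpw ::= 16 ;; vP ::= 2 ;;
  For vi $vn (If ($vpw < $vn + 1)
    (vbb ::= $vbb + 1 ;; vpw ::= $vpw * 16 ;; vP ::= $vP * 2) Skip) ;;
  vll ::= 1 ;; vt2 ::= 2 ;;
  For vi $vbb (If ($vt2 < $vbb + 1) (vll ::= $vll + 1 ;; vt2 ::= $vt2 * 2) Skip) ;;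
  vll ::= 2 * $vll ;;
  vL ::= 8 * $vbb + 8 ;;
  vnb ::= (2 * $vn) %/ $vbb + 1 ;;
  vnsb ::= ($vnb - 1) %/ $vbb + 1 ;;
  vSB ::= 10 * $vL + 1 ;;
  vBLK ::= $vSB + $vnsb * (2 * $vL) ;;
  vTAB ::= $vBLK + $vnb * (4 * $vll) ;;
  vCODE ::= $vTAB + ($vbb + 1) * $vP * (($vbb + 1) * $vll).

(** The code of [x] is the number of smaller numbers with equally many ones. When [x] is reached,
    [aCNT] contains exactly this number; [aXOF] is the inverse map. *)
Definition tab_cmd : cmd := For vxx $vP
  (vkk ::= At aPOP ($vxx %/ 2) + $vxx %% 2 ;;
   Sto aPOP $vxx $vkk ;;
   Sto aOFX $vxx (At aCNT $vkk) ;;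
   Sto aXOF ($vkk * $vP + At aCNT $vkk) $vxx ;;
   Sto aCNT $vkk (At aCNT $vkk + 1)).

Definition w_cmd : cmd := For vkk ($vbb + 1)
  (vW ::= 0 ;; vpw ::= 1 ;;
   For vj $vbb (If ($vpw < At aCNT $vkk) (vpw ::= $vpw * 2 ;; vW ::= $vW + 1) Skip) ;;
   Sto aWD $vkk $vW).

Definition bp_cmd : cmd := vrk ::= 0 ;; vpt ::= 0 ;; For vi $vnb
  (vxx ::= 0 ;; vpw ::= 1 ;;
   For vj $vbb (vxx ::= $vxx + At aD ($vi * $vbb + $vj) * $vpw ;; vpw ::= $vpw * 2) ;;
   Sto aRK $vi $vrk ;; Sto aPT $vi $vpt ;;
   Sto aKK $vi (At aPOP $vxx) ;; Sto aOF $vi (At aOFX $vxx) ;;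
   Sto aWW $vi (At aWD (At aPOP $vxx)) ;;
   vrk ::= $vrk + At aKK $vi ;; vpt ::= $vpt + At aWW $vi).

Definition bbspec n bb := 0 < bb /\ 16 ^ (bb - 1) <= n < 16 ^ bb.
Definition lgspec bb lg := 0 < lg /\ 2 ^ (lg - 1) <= bb < 2 ^ lg.

Definition parP n s := exists bb lg, [/\ bbspec n bb, lgspec bb lg,
  V s vbb = bb & V s vll = 2 * lg] /\ V s vP = 2 ^ bb /\
  let r := RRR n bb (2 * lg) id id id id id id in
  [/\ V s vL = r_L r, V s vnb = r_nb r, V s vnsb = r_nsb r & [/\ V s vSB = r_SB r,
      V s vBLK = r_BLK r, V s vTAB = r_TAB r & V s vCODE = r_CODE r]].

Lemma le_exp_pred c b : 1 < c -> 0 < b -> b <= c ^ (b - 1).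
Proof. by case: b => // b c1 _; rewrite subn1; apply: ltn_expl. Qed.

Lemma bb_le n bb : bbspec n bb -> bb <= n.
Proof.
by case=> b0 /andP[h _]; apply: leq_trans h; apply: le_exp_pred.
Qed.

Lemma lg_le bb lg : lgspec bb lg -> lg <= bb.
Proof.
by case=> b0 /andP[h _]; apply: leq_trans h; apply: le_exp_pred.
Qed.

(** [bb] is minimal, so [16 ^ bb] is at most [16 * n]. This leaves room for tables of size [2 ^ bb]
    times powers of [bb]. *)
Lemma P4_le n bb : bbspec n bb -> (2 ^ bb) ^ 4 <= 16 * n.
Proof.
case=> b0 /andP[h _]; rewrite -expnM mulnC expnM -[2 ^ 4]/16.
by rewrite -(subnK b0) addn1 expnS leq_mul2l h orbT.
Qed.

(** A crude linear bound, enough to show that positions fit into their fields. The decoding table is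
    bounded through [bb + 1 <= P] by [2 * P ^ 4]. *)
Lemma CODE_le n bb lg : 0 < n -> bbspec n bb -> lgspec bb lg ->
  r_CODE (RRR n bb (2 * lg) id id id id id id) <= 800 * n.
Proof.
move=> n0 hb hl; have bn := bb_le hb; have lb := lg_le hl.
have P4 := P4_le hb; have b0 : 0 < bb by case: hb.
rewrite /r_CODE /r_TAB /r_BLK /r_SB /r_nsb /r_nb /r_L /r_P /=.
rewrite addnK; set q := (2 * n) %/ bb; set P := 2 ^ bb in P4 *.
have bP : bb < P by apply: ltn_expl.
have qb : q * bb <= 2 * n by rewrite leq_trunc_div.
have qq : q %/ bb <= q by apply: leq_div.
have T1 : (q %/ bb + 1) * (2 * (8 * bb + 8)) <= 64 * n + 32 * n.
  apply: (@leq_trans ((q + 1) * (32 * bb))); first by apply: leq_mul; lia.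
  nia.
have T2 : (q + 1) * (4 * (2 * lg)) <= 24 * n.
  apply: (@leq_trans ((q + 1) * (8 * bb))); first by apply: leq_mul; lia.
  nia.
have T3 : (bb + 1) * P * ((bb + 1) * (2 * lg)) <= 32 * n.
  apply: (@leq_trans (P * P * (P * (2 * P)))).
    by apply: leq_mul; [apply: leq_mul; lia|apply: leq_mul; lia].
  by move: P4; rewrite !expnS expn0; lia.
lia.
Qed.

Lemma par_spec S n s : 0 < n -> 1000 * n + 100 < S -> V s vn = n ->
  tri S par_cmd s (12 * n + 30) (fun s' => parP n s').
Proof.
move=> n0 nS En.
rewrite (_ : 12 * n + 30 = (12 * n + 27).+3); last by lia.
asg; asg; asg. set s1 := setv _ _ _.
have X16 : 16 ^ n.+1 > n by apply: ltn_trans (leqnn _) (ltn_expl _ _).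
have X2 k : k < 2 ^ k.+1 by apply: ltn_trans (leqnn _) (ltn_expl _ _).
apply: (@tri_seq S (6 * n + 2) (6 * n + 25) _ _ _ _ (fun s => V s 27 = n /\ [/\ V s vpw = 16 ^ V s vbb, V s vP = 2 ^ V s vbb,
    bbspec n (V s vbb) & True])); [|lia|].
  apply: (tri_weak (tri_for (N := n) (c := 4) (Inv := fun i s => [/\ V s vpw = 16 ^ V s vbb, V s vP = 2 ^ V s vbb,
    0 < V s vbb /\ 16 ^ (V s vbb - 1) <= n & V s vpw <= n -> V s vbb = i.+1]) _ _ _ (leqnn _) _ _)) => //.
  - by move=> s2 ag /=; split=> //; fr ag.
  - lia.
  - move=> i s2 ag Vi iN [h1 h2 [h3 h4] h5] /=.
    have E2 : V s2 vn = n by fr ag.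
    have bn : V s2 vbb <= n.
      by apply: leq_trans h4; apply: le_exp_pred.
    ifc; rewrite E2 addn1 ltnS; case: leqP => // h _; last first.
      by apply: tri_skip => /=; split=> // h'; rewrite leqNgt h in h'.
    have P4 : V s2 vP <= n.
      by apply: leq_trans h; rewrite h1 h2 leq_exp2r.
    asg; asg. apply: tri_asg => //=; first by lia.
    split=> //=.
    + by rewrite h1 addn1 expnSr.
    + by rewrite h2 addn1 expnSr.
    + by rewrite addnK -h1; split; first by rewrite addn1.
    by move=> _; rewrite h5 // addn1.
  - lia.
  move=> s2 ag [Vi [h1 h2 [h3 h4] h5]]; split=> //; split=> //; split=> //; rewrite h4 -h1 ltnNge.
  apply/negP => h; have := h5 h => E; move: X16; rewrite -E -h1; lia.
move=> s2 ag2 [_ [_ hP hb _]].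
have bn := bb_le hb; have P4 := P4_le hb.
have E2 : V s2 vn = n by fr ag2.
set bb := V s2 vbb in hP hb bn P4.
have b0 : 0 < bb by case: hb.
have bS : bb < S by lia.
rewrite (_ : 6 * n + 25 = (6 * n + 23).+2); last by lia.
asg; asg. set s3 := setv _ _ _.
apply: (@tri_seq S (5 * n + 2) 20 _ _ _ _ (fun s => lgspec bb (V s vll))); [|lia|].
  apply: (tri_weak (tri_for (N := bb) (c := 2 + 1) (Inv := fun i s => [/\ V s vt2 = 2 ^ V s vll,
    0 < V s vll /\ 2 ^ (V s vll - 1) <= bb & V s vt2 <= bb -> V s vll = i.+1]) _ _ _ (leqnn _) _ _)) => //.
  - by move=> s4 ag /=; split=> //; fr ag.
  - move=> i s4 ag Vi iN [h1 [h3 h4] h5] /=.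
    have E4 : V s4 vbb = bb by fr ag.
    have ln : V s4 vll <= bb.
      by apply: leq_trans h4; apply: le_exp_pred.
    ifc; rewrite E4 addn1 ltnS; case: leqP => // h _; last first.
      by apply: tri_skip => /=; split=> // h'; rewrite leqNgt h in h'.
    asg. apply: tri_asg => //=; first by lia.
    split=> //=.
    + by rewrite h1 addn1 expnSr.
    + by rewrite addnK -h1; split; first by rewrite addn1.
    by move=> _; rewrite h5 // addn1.
  - lia.
  move=> s4 ag [Vi [h1 [h3 h4] h5]]; split=> //; rewrite h4 -h1 ltnNge.
  apply/negP => h; have := h5 h => E; move: (X2 bb); rewrite -E -h1; lia.
move=> s4 ag4 hl; set lg := V s4 vll in hl.
have Eb4 : V s4 vbb = bb by fr ag4.
have En4 : V s4 vn = n by fr ag4.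
have EP4 : V s4 vP = 2 ^ bb by fr ag4.
have CS := CODE_le n0 hb hl.
have lb := lg_le hl.
set r := RRR n bb (2 * lg) id id id id id id in CS.
have EL : 8 * bb + 8 = r_L r by [].
have Enb : 2 * n %/ bb + 1 = r_nb r by [].
have Ensb : (r_nb r - 1) %/ bb + 1 = r_nsb r by [].
have ESB : 10 * r_L r + 1 = r_SB r by [].
have EBLK : r_SB r + r_nsb r * (2 * r_L r) = r_BLK r by [].
have ETAB : r_BLK r + r_nb r * (4 * (2 * lg)) = r_TAB r by [].
have ECODE : r_TAB r + (bb + 1) * 2 ^ bb * ((bb + 1) * (2 * lg)) = r_CODE r by [].
have q1 : (2 * n) %/ bb <= 2 * n by exact: leq_div.
have q2 : (r_nb r - 1) %/ bb <= 2 * n by rewrite /r_nb addnK; apply: leq_trans (leq_div _ _) q1.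
asg; try lia. asg; rewrite ?Eb4; try lia. rewrite EL.
asg; rewrite ?Eb4 ?En4; try lia. rewrite Enb.
asg; rewrite ?Eb4; try lia. rewrite Ensb.
asg; try lia. rewrite ESB.
asg; try lia. rewrite EBLK.
asg; try lia. rewrite -/lg ETAB.
apply: tri_asg; rewrite /= ?Eb4 ?EP4 -/lg ?ECODE; try by side.
by exists bb, lg.
Qed.

Lemma D_spec S n s (f1 f0 : nat -> nat) : 1 < S -> 2 * n + 2 < S -> V s vn = n ->
  (forall i, A s aD i = 0) ->
  (forall i, i < n -> A s aM1 (i + 1) - A s aM1 i = f1 i /\ f1 i <= 1) ->
  (forall i, i < n -> 1 - (A s aM0 (i + 1) - A s aM0 i) = f0 i) ->
  tri S D_cmd s (4 * n + 2) (fun s' => forall i, A s' aD i =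
    if i < n then f1 i else if i < 2 * n then f0 (i - n) else 0).
Proof.
move=> S1 nS En Z H1 H0.
apply: (tri_weak (tri_for (N := n) (c := 2) (Inv := fun m s' => forall i, A s' aD i =
    if i < m then f1 i else if (n <= i) && (i < n + m) then f0 (i - n) else 0) _ _ _ (leqnn _) _ _)) => //.
- by move=> s2 ag /=; split=> //; fr ag.
- lia.
- by move=> i /=; rewrite Z; case: (leqP n i) => //= h; case: ifP => //; lia.
- move=> i s2 ag Vi iN I.
  have E2 : V s2 vn = n by fr ag.
  have EM1 : A s2 aM1 = A s aM1 by fr ag.
  have EM0 : A s2 aM0 = A s aM0 by fr ag.
  have [h1 h1'] := H1 i iN; have h0 := H0 i iN.
  sto; rewrite ?EM1 ?Vi ?h1; try lia.
  apply: tri_sto; [by side|by rewrite /= ?Vi; side|by rewrite /=; lia|by rewrite /= EM0 Vi h0; lia| |by []].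
  rewrite /= EM0 Vi E2 h0 => j.
  case: Nat.eqb_spec => [->|n1].
    rewrite (_ : n + i < i.+1 = false); last by lia.
    by rewrite leq_addr ltn_add2l ltnSn addKn.
  case: Nat.eqb_spec => [->|n2]; first by rewrite ltnSn.
  rewrite I (_ : j < i.+1 = (j < i)); last by lia.
  by rewrite (_ : j < n + i.+1 = (j < n + i)); last by lia.
- lia.
move=> s2 ag [_ I] i; rewrite I; case: ltnP => //= h.
by rewrite mul2n addnn.
Qed.

(** For [m = 2 ^ bb] this is the binomial coefficient of [bb] over [k]; for [m = x] and the
    population count of [x] it is the code of [x]. *)
Definition cntk bb m k := count (fun y => pref y bb == k) (iota 0 m).

Lemma cntkS bb m k : cntk bb m.+1 k = cntk bb m k + (pref m bb == k).
Proof. by rewrite /cntk -addn1 iotaD count_cat /= addn0 add0n. Qed.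

Lemma cntk_le bb m k : cntk bb m k <= m.
Proof. by rewrite /cntk (leq_trans (count_size _ _)) // size_iota. Qed.

Lemma cntk_mono bb m m' k : m <= m' -> cntk bb m k <= cntk bb m' k.
Proof. by move=> h; rewrite /cntk -(subnKC h) iotaD count_cat leq_addr. Qed.

Lemma cntk_lt bb m x : x < m -> cntk bb x (pref x bb) < cntk bb m (pref x bb).
Proof.
by move=> h; apply: leq_trans (cntk_mono _ _ h); rewrite cntkS eqxx addn1.
Qed.

Lemma tab_spec S bb s : (bb + 1) * 2 ^ bb + 2 < S -> V s vP = 2 ^ bb ->
  (forall i, A s aPOP i = 0) -> (forall i, A s aCNT i = 0) ->
  (forall i, A s aXOF i = 0) -> tri S tab_cmd s (7 * 2 ^ bb + 2) (fun s' =>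
    (forall x, x < 2 ^ bb -> [/\ A s' aPOP x = pref x bb,
       A s' aOFX x = cntk bb x (pref x bb) &
       A s' aXOF (pref x bb * 2 ^ bb + cntk bb x (pref x bb)) = x]) /\
    (forall k, A s' aCNT k = cntk bb (2 ^ bb) k) /\
    (forall e, A s' aXOF e < 2 ^ bb)).
Proof.
move=> SS EP Z1 Z2 Z3; set P := 2 ^ bb in SS EP *.
have P0 : 0 < P by rewrite expn_gt0.
apply: (tri_weak (tri_for (N := P) (c := 5) (Inv := fun m s' =>
   (forall x, x < m -> [/\ A s' aPOP x = pref x bb,
       A s' aOFX x = cntk bb x (pref x bb) &
       A s' aXOF (pref x bb * P + cntk bb x (pref x bb)) = x]) /\
    (m = 0 -> A s' aPOP 0 = 0) /\
    (forall k, A s' aCNT k = cntk bb m k) /\ (forall e, A s' aXOF e < P)) _ _ _ (leqnn _) _ _)) => //.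
- by move=> s2 ag /=; split=> //; fr ag.
- by nia.
- by split=> //; split=> //=; split=> k; rewrite ?Z2 ?Z3.
- move=> x s2 ag Vx xP [I [I0 [IC IX]]].
  have E2 : V s2 vP = P by fr ag.
  have pl := pref_le x bb.
  have cl := cntk_le bb x (pref x bb).
  have EP2 : A s2 aPOP (x %/ 2) + x %% 2 = pref x bb.
    rewrite -(pref_half xP); congr (_ + _).
    (* For [x = 0] the entry that is read is the one about to be written, and it still has its
       initial value 0. *)
    case: (posnP x) => [x0|x0]; last by have [] := I (x %/ 2) (ltn_Pdiv _ x0).
    by rewrite x0 div0n I0 // /pref big1 // => i _; rewrite div0n mod0n.
  have iS : pref x bb * P + cntk bb x (pref x bb) < S.
    have : pref x bb * P <= bb * P by rewrite leq_mul2r pl orbT.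
    lia.
  have pS : pref x bb < S by nia.
  have xd := leq_div x 2.
  asg; rewrite ?Vx ?EP2; try lia.
  sto; try lia.
  sto; rewrite ?IC; try lia.
  sto; rewrite ?IC ?E2; try lia.
  apply: tri_sto; rewrite /= ?IC; [by side|by side|by side|by side| |by []].
  split; last first.
    split=> //; split=> k; last by case: Nat.eqb_spec; rewrite ?Vx.
    rewrite cntkS eq_sym; case: Nat.eqb_spec => [->|h]; first by rewrite eqxx.
    by rewrite IC; case: eqP => // _; rewrite addn0.
  move=> y; rewrite Vx ltnS leq_eqVlt => /orP [/eqP ->|h]; first by rewrite !Nat.eqb_refl.
  have [h1 h2 h3] := I y h.
  case: Nat.eqb_spec => [E|_]; first by rewrite E ltnn in h.
  (* Writing the row of [x] destroys no earlier row: a collision would put [x] and [y] into the same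
     class with the same code, but codes increase strictly within a class. *)
  split=> //; case: Nat.eqb_spec => [E|_] //; exfalso.
  have yP : y < P by apply: ltn_trans xP.
  have := cntk_le bb y (pref y bb) => cl'.
  have E1 : pref y bb = pref x bb.
    by move: (congr1 (divn ^~ P) E); rewrite !divnMDl // !divn_small ?addn0 //; lia.
  rewrite E1 in E; move/addnI: E => E.
  by have := @cntk_lt bb x y h; rewrite E1 E ltnn.
- by nia.
by move=> s2 ag [_ [I [_ [IC IX]]]].
Qed.

(* [W] is the least number of bits in which the codes below [N] fit. *)
Definition wspec N W := N <= 2 ^ W /\ (W = 0 \/ 2 ^ (W - 1) < N).

Lemma w_spec S bb s : 2 * 2 ^ bb + 2 < S -> V s vbb = bb ->
  (forall k, A s aCNT k = cntk bb (2 ^ bb) k) ->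
  tri S w_cmd s ((bb + 1) * (5 * bb + 7) + 2) (fun s' =>
    forall k, k <= bb -> wspec (cntk bb (2 ^ bb) k) (A s' aWD k)).
Proof.
move=> SS Eb EC.
have bP : bb < 2 ^ bb by apply: ltn_expl.
apply: (tri_weak (tri_for (N := bb + 1) (c := 5 * bb + 5) (Inv := fun m s' => forall k, k < m ->
   wspec (cntk bb (2 ^ bb) k) (A s' aWD k)) _ _ _ (leqnn _) _ _)) => //.
- by move=> s2 ag /=; split=> //; fr ag; rewrite Eb.
- lia.
- move=> k s2 ag Vk kb I.
  have E2 : V s2 vbb = bb by fr ag.
  rewrite (_ : 5 * bb + 5 = (5 * bb + 3).+2); last by lia.
  asg; asg. set s3 := setv _ _ _.
  set N := cntk bb (2 ^ bb) k in I *.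
  have NP : N <= 2 ^ bb by apply: cntk_le.
  apply: (@tri_seq S (5 * bb + 2) 1 _ _ _ _ (fun s => wspec N (V s vW) /\ V s vW <= bb)); [|lia|].
    apply: (tri_weak (tri_for (N := bb) (c := 3) (Inv := fun i s => [/\ V s vpw = 2 ^ V s vW,
      V s vW <= i, V s vW = 0 \/ 2 ^ (V s vW - 1) < N & V s vpw < N -> V s vW = i]) _ _ _ (leqnn _) _ _)) => //.
    + by move=> s4 ag4 /=; split=> //; fr ag4.
    + lia.
    + by rewrite /= expn0; split=> //; left.
    + move=> i s4 ag4 Vi iN [h1 h2 h3 h4] /=.
      have EC4 : A s4 aCNT k = N by fr ag4; rewrite /s3 /=; fr ag; exact: EC.
      have Ek4 : V s4 vkk = k by fr ag4.
      ifc; rewrite Ek4 EC4; case: ltnP => // h _; last first.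
        apply: tri_skip => /=; split=> //; first by lia.
        by move=> h'; rewrite leqNgt h' in h.
      asg. apply: tri_asg => //=; first by lia.
      rewrite addn1 subn1 /= ; split=> //.
      * by rewrite h1 expnSr.
      * by right; rewrite -h1.
      by move=> _; rewrite h4.
    + lia.
    move=> s4 ag4 [_ [h1 h2 h3 h4]]; split=> //; split=> //; rewrite -h1 leqNgt.
    by apply/negP => h; move: h1 h (h4 h) => -> + E; rewrite E ltnNge NP.
  move=> s4 ag4 [h1 h2].
  have Ek4 : V s4 vkk = k by fr ag4.
  apply: tri_sto => //=; [lia|lia|].
  move=> k'; rewrite Ek4 ltnS leq_eqVlt => /orP [/eqP ->|h]; first by rewrite Nat.eqb_refl.
  case: Nat.eqb_spec => [E|_]; first by rewrite E ltnn in h.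
  rewrite (agA ag4 (x := aWD)) //; exact: I.
- lia.
by move=> s2 ag [_ I] k kb; apply: I; rewrite addn1.
Qed.

Notation vacc := 61. Notation vfy := 62.

Definition blkX (Df : nat -> nat) bb i := \sum_(j < bb) Df (i * bb + j) * 2 ^ j.

Lemma sum_lt2 (f : nat -> nat) m : (forall j, f j <= 1) -> \sum_(j < m) f j * 2 ^ j < 2 ^ m.
Proof.
move=> H; elim: m => [|m IH]; first by rewrite big_ord0.
rewrite big_ord_recr /= expnS mul2n -addnn -addSn; apply: leq_add => //.
by rewrite -[X in _ <= X]mul1n leq_mul.
Qed.

Lemma bp_spec S n bb nb (Df W POP OFX : nat -> nat) s :
  bb <= n -> 0 < bb -> nb = (2 * n) %/ bb + 1 -> 20 * n + 2 ^ bb + 10 < S ->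
  V s vbb = bb -> V s vnb = nb -> A s aD = Df -> (forall i, Df i <= 1) ->
  A s aPOP = POP -> A s aOFX = OFX -> A s aWD = W ->
  (forall x, x < 2 ^ bb -> POP x = pref x bb /\ OFX x <= 2 ^ bb) ->
  (forall k, k <= bb -> W k <= bb) ->
  tri S bp_cmd s (nb * (4 * bb + 13) + 4) (fun s' => forall i, i < nb ->
    let X := blkX Df bb in
    [/\ A s' aKK i = pref (X i) bb, A s' aOF i = OFX (X i),
        A s' aWW i = W (pref (X i) bb),
        A s' aRK i = \sum_(i' < i) pref (X i') bb &
        A s' aPT i = \sum_(i' < i) W (pref (X i') bb)]).
Proof.
move=> bn b0 Enb nS Ebb Evnb ED D1 EPOP EOFX EW HT HW.
have q1 : (2 * n) %/ bb * bb <= 2 * n by apply: leq_trunc_div.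
have q2 : (2 * n) %/ bb <= 2 * n by apply: leq_div.
rewrite (_ : _ + 4 = (nb * (4 * bb + 13) + 2).+2); last by lia.
asg; asg. set s1 := setv _ _ _.
pose X := blkX Df bb.
have XP i : X i < 2 ^ bb by apply: (@sum_lt2 (fun j => Df (i * bb + j))).
have SW (h : nat -> nat) m : (forall i, h i <= bb) -> \sum_(i < m) h i <= m * bb.
  move=> H; elim: m => [|m IH]; first by rewrite big_ord0.
  by rewrite big_ord_recr /= mulSnr; apply: leq_add.
have HWi i : W (pref (X i) bb) <= bb by apply: HW; apply: pref_le.
have HPi i : pref (X i) bb <= bb by apply: pref_le.
apply: (tri_weak (tri_for (N := nb) (c := 4 * bb + 11) (Inv := fun m s' =>
  [/\ V s' vrk = \sum_(i' < m) pref (X i') bb, V s' vpt = \sum_(i' < m) W (pref (X i') bb) &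
  forall i, i < m ->
    [/\ A s' aKK i = pref (X i) bb, A s' aOF i = OFX (X i),
        A s' aWW i = W (pref (X i) bb),
        A s' aRK i = \sum_(i' < i) pref (X i') bb &
        A s' aPT i = \sum_(i' < i) W (pref (X i') bb)]]) _ _ _ (leqnn _) _ _)) => //.
- by move=> s2 ag /=; split=> //; fr ag.
- lia.
- by rewrite /= !big_ord0.
- move=> i s2 ag Vi inb [Erk Ept I].
  have Ebb2 : V s2 vbb = bb by fr ag.
  have ED2 : A s2 aD = Df by fr ag.
  rewrite (_ : 4 * bb + 11 = (4 * bb + 9).+2); last by lia.
  have ibb : i * bb <= 2 * n.
    by apply: leq_trans q1; rewrite leq_mul2r; apply/orP; right; lia.
  asg; asg. set s3 := setv _ _ _.
  apply: (@tri_seq S (4 * bb + 2) 7 _ _ _ _ (fun s => V s vxx = X i)); [|lia|].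
    apply: (tri_weak (tri_for (N := bb) (c := 2) (Inv := fun j s =>
      V s vxx = \sum_(j' < j) Df (i * bb + j') * 2 ^ j' /\ V s vpw = 2 ^ j) _ _ _ (leqnn _) _ _)) => //.
    + by move=> s4 ag4 /=; split=> //; fr ag4.
    + lia.
    + by rewrite /= big_ord0 expn0.
    + move=> j s4 ag4 Vj jb [Ex Ep].
      have Evi : V s4 vi = i by fr ag4.
      have Eb4 : V s4 vbb = bb by fr ag4.
      have ED4 : A s4 aD = Df by fr ag4; rewrite /s3 /=; fr ag.
      have Ej : \sum_(j' < j.+1) Df (i * bb + j') * 2 ^ j' < 2 ^ bb.
        have := @sum_lt2 (fun j' => Df (i * bb + j')) j.+1 (fun _ => D1 _).
        by move=> h; apply: leq_trans h _; rewrite leq_exp2l.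
      rewrite big_ord_recr /= in Ej.
      have pj : 2 ^ j.+1 <= 2 ^ bb by rewrite leq_exp2l.
      rewrite expnS in pj.
      asg; rewrite ?Evi ?Eb4 ?Vj ?ED4 ?Ex ?Ep; first by apply: leq_trans Ej _; lia.
      apply: tri_asg; rewrite /= ?Ep; [by side|by side| |by []].
      by rewrite big_ord_recr expnSr.
    + lia.
    by move=> s4 ag4 [_ [-> _]].
  move=> s4 ag4 Ex.
  have Evi : V s4 vi = i by fr ag4.
  have Erk4 : V s4 vrk = \sum_(i' < i) pref (X i') bb by fr ag4.
  have Ept4 : V s4 vpt = \sum_(i' < i) W (pref (X i') bb) by fr ag4.
  have EP4 : A s4 aPOP = POP by fr ag4; rewrite /s3 /=; fr ag.
  have EO4 : A s4 aOFX = OFX by fr ag4; rewrite /s3 /=; fr ag.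
  have EW4 : A s4 aWD = W by fr ag4; rewrite /s3 /=; fr ag.
  have AK j : [/\ A s4 aKK j = A s2 aKK j, A s4 aOF j = A s2 aOF j, A s4 aWW j = A s2 aWW j,
     A s4 aRK j = A s2 aRK j & A s4 aPT j = A s2 aPT j] by split; fr ag4.
  have [Ep Eo] := HT _ (XP i).
  have b1 : \sum_(i' < i) pref (X i') bb <= i * bb := SW _ i HPi.
  have b2 : \sum_(i' < i) W (pref (X i') bb) <= i * bb := SW _ i HWi.
  have p1 := HPi i; have p2 := HWi i.
  have inb' : i <= 2 * n by lia.
  have XPi := XP i.
  sto; rewrite ?Evi; try lia.
  sto; rewrite ?Evi; try lia.
  sto; rewrite ?Evi ?Ex ?EP4 ?Ep; try lia.
  sto; rewrite ?Evi ?Ex ?EO4; try lia.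
  sto; rewrite ?Evi ?Ex ?EP4 ?Ep ?EW4; try lia.
  asg; rewrite ?Evi ?Nat.eqb_refl ?Erk4; try lia.
  apply: tri_asg; rewrite /= ?Evi ?Nat.eqb_refl ?Ept4; [by side|by apply: leq_ltn_trans (leq_add b2 p2) _; lia| |by []].
  rewrite !big_ord_recr /=; split=> // j.
  rewrite ltnS leq_eqVlt => /orP [/eqP ->|h]; first by rewrite Nat.eqb_refl.
  case: Nat.eqb_spec => [E|_]; first by rewrite E ltnn in h.
  by have [-> -> -> -> ->] := AK j; apply: I.
- lia.
by move=> s2 ag [_ [_ _ I]].
Qed.

(** * Writing the index bit by bit *)

Definition emf v w : cmd := vfv ::= v ;; For vfi w (Emit ($vfv %% 2) ;; vfv ::= $vfv %/ 2).

Lemma tri_emf S v w s a k T : 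
  safe (fun _ i => i < S) (V s) (A s) v -> ev (V s) (A s) v = a -> a < S ->
  (forall s', agree (emf v w) s s' -> safe (fun _ i => i < S) (V s') (A s') w /\ ev (V s') (A s') w = k) ->
  size (O s) + k + 1 < S -> 4 * k + 3 <= T ->
  tri S (emf v w) s T (fun s' => O s' = O s ++ bits k a).
Proof.
move=> sv ea aS Hw OS TT; case: T TT => [|T TT]; first by lia.
apply: tri_asgs; rewrite ?ea //.
set s1 := setv _ _ _.
apply: (tri_weak (tri_for (N := k) (c := 2) (Inv := fun i s' => O s' = O s ++ bits i a /\ V s' vfv = a %/ 2 ^ i) _ _ _ (leqnn _) _ _)) => //.
- move=> s2 ag; apply: Hw.
  have : agree (emf v w) s s1 by agr.
  move=> h; apply: agree_trans h _; move: ag; apply: agree_sub => //=.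
  by move=> x /norP[_ /negbTE].
- lia.
- by rewrite /= cats0 expn0 divn1.
- move=> i s2 ag Vi ik [EO EV].
  have d2 := leq_div a (2 ^ i).
  have d3 := leq_div (a %/ 2 ^ i) 2.
  apply: (@tri_seq S 1 1 _ _ _ _ (fun s' => s' = emit s2 (V s2 vfv %% 2 != 0))) => //.
    apply: tri_emit => //=; rewrite EO size_cat size_bits; lia.
  move=> s3 _ ->; apply: tri_asg => //=; first by rewrite EV; lia.
  rewrite EO EV -divnMA -expnSr; split=> //.
  by rewrite /bits mkseqS -!cats1 catA modn2 eqb0 negbK.
- lia.
by move=> s2 ag [_ []].
Qed.

Lemma tri_for_emit S x e body s0 N c f T :
  occ x (modv body) = false ->
  (forall s, agree (For x e body) s0 s ->
     safe (fun _ i => i < S) (V s) (A s) e /\ ev (V s) (A s) e = N) ->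
  N < S -> N * (c + 2) + 2 <= T -> size (O s0) + size (flat f N) + 1 < S ->
  (forall i s, agree (For x e body) s0 s -> V s x = i -> i < N ->
    size (O s) + size (f i) + 1 < S ->
    tri S body s c (fun s' => O s' = O s ++ f i)) ->
  tri S (For x e body) s0 T (fun s => O s = O s0 ++ flat f N).
Proof.
move=> h1 h2 h3 h4 hO Hb.
apply: (tri_weak (tri_for (Inv := fun m s => O s = O s0 ++ flat f m) h1 h2 h3 h4 _ _)) => //.
- by rewrite /= cats0.
- move=> i s ag Vi iN EO.
  have [r Er] := flat_split f iN.
  apply: (tri_weak (Hb i s ag Vi iN _)) => //.
    by move: hO; rewrite EO Er !size_cat; lia.
  by move=> s' _ /= ->; rewrite EO flatS catA.
by move=> s' _ [].
Qed.

Lemma tri_seq_emit S T1 T2 c1 c2 s T a c : 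
  tri S c1 s T1 (fun s' => O s' = O s ++ a) -> T1 + T2 <= T ->
  (forall s', agree c1 s s' -> O s' = O s ++ a -> tri S c2 s' T2 (fun s2 => O s2 = O s' ++ c)) ->
  tri S (c1 ;; c2) s T (fun s' => O s' = O s ++ a ++ c).
Proof.
move=> h1 le h2; apply: (tri_seq h1 le) => s' ag E; apply: (tri_weak (h2 s' ag E)) => // s2 _ ->.
by rewrite E catA.
Qed.

Lemma emf_modv v w x : occ x [:: vfv; vfi] = false -> occ x (modv (emf v w)) = false.
Proof. by rewrite /=; case: (Nat.eqb x vfv); case: (Nat.eqb x vfi). Qed.

Fixpoint emfs (es : seq nexp) w : cmd :=
  if es is e :: es' then emf e $w ;; emfs es' w else Skip.

Definition same s s' := (forall x, occ x [:: vfv; vfi] = false -> V s' x = V s x) /\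
  (forall j, A s' j = A s j).

Lemma tri_emfs S es w k s T (vals : seq nat) : occ w [:: vfv; vfi] = false ->
  V s w = k -> size vals = size es ->
  (forall s' i, same s s' -> i < size es -> let e := nth (Cst 0) es i in
    [/\ safe (fun _ i => i < S) (V s') (A s') e, ev (V s') (A s') e = nth 0 vals i &
        nth 0 vals i < S]) ->
  size (O s) + size es * k + 1 < S -> size es * (4 * k + 3) <= T ->
  tri S (emfs es w) s T (fun s' => O s' = O s ++ flatten [seq bits k a | a <- vals]).
Proof.
move=> nw; elim: es s T vals => [|e es IH] s T [|a vals] //= Ew.
  by move=> *; apply: tri_skip; rewrite cats0.
move=> [sz] HS hO hT.
apply: (tri_seq_emit (T1 := 4 * k + 3) (T2 := size es * (4 * k + 3))); [|lia|].
  have [h1 h2 h3] := HS s 0 (conj (fun _ _ => erefl) (fun _ => erefl)) isT.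
  apply: tri_emf h2 _ _ _ _ => //; last by lia.
  by move=> s' ag; split=> //=; rewrite (agV ag (emf_modv _ _ nw)).
move=> s1 ag E1.
have EV x : occ x [:: vfv; vfi] = false -> V s1 x = V s x.
  by move=> h; rewrite (agV ag (emf_modv _ _ h)).
apply: IH => //; first by rewrite EV.
- move=> s' i [sa sb] hi; apply: (HS s' i.+1) => //; split.
    by move=> x hx; rewrite sa // EV.
  by move=> j; rewrite sb (agA ag).
- by rewrite E1 size_cat size_bits; lia.
Qed.

Arguments emfs : simpl never.

Definition hdr_vars := [:: $vL; $vn; $vbb; $vP; $vll; $vSB; $vBLK; $vTAB; $vCODE]%nexp.
Definition hdr_cmd : cmd := For vi $vL (Emit 0) ;; Emit 1 ;; emfs hdr_vars vL.
Definition sb_cmd : cmd := For vh $vnsb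
  (emfs [:: At aRK ($vh * $vbb); At aPT ($vh * $vbb)]%nexp vL).
Definition blk_cmd : cmd := For vi $vnb
  (vh ::= $vi %/ $vbb * $vbb ;;
   emfs [:: At aRK $vi - At aRK $vh; At aPT $vi - At aPT $vh; At aKK $vi; At aWW $vi]%nexp vll).
(** The running count is written before the next digit is added, so field [j] of a row counts the
    digits below [j]. *)
Definition etab_cmd : cmd := For vxx (($vbb + 1) * $vP)
  (vfy ::= At aXOF $vxx ;; vacc ::= 0 ;;
   For vj ($vbb + 1)
     (emf $vacc $vll ;; vacc ::= $vacc + $vfy %% 2 ;; vfy ::= $vfy %/ 2)).
Definition code_cmd : cmd := For vi $vnb (emf (At aOF $vi) (At aWW $vi)).
Definition emit_cmd : cmd := hdr_cmd ;; sb_cmd ;; blk_cmd ;; etab_cmd ;; code_cmd.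

Definition emit_cost r := (40 * r_L r + 40) + (r_nsb r * (8 * r_L r + 10) + 2) +
  (r_nb r * (16 * r_l r + 20) + 2) +
  ((r_bb r + 1) * r_P r * ((r_bb r + 1) * (4 * r_l r + 8) + 8) + 2) +
  (r_nb r * (4 * r_bb r + 6) + 2).

Lemma emit_spec S r s :
  [/\ V s vL = r_L r, V s vn = r_n r, V s vbb = r_bb r & V s vP = r_P r] ->
  [/\ V s vll = r_l r, V s vnb = r_nb r & V s vnsb = r_nsb r] ->
  [/\ V s vSB = r_SB r, V s vBLK = r_BLK r, V s vTAB = r_TAB r & V s vCODE = r_CODE r] ->
  [/\ A s aRK = r_RK r, A s aPT = r_PT r & A s aKK = r_KK r] ->
  [/\ A s aWW = r_WW r, A s aOF = r_OF r & A s aXOF = r_XOF r] ->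
  0 < r_bb r -> 
  (forall i, i < r_nb r -> [/\ r_RK r i < S, r_PT r i < S, r_KK r i < S & r_OF r i < S /\ r_WW r i <= r_bb r]) ->
  (forall e, e < (r_bb r + 1) * r_P r -> r_XOF r e < S) ->
  O s = [::] -> size (rrr_bits r) + r_n r + 1 < S ->
  r_CODE r < S -> (r_bb r + 1) * r_P r < S -> r_nb r + 2 < S ->
  tri S emit_cmd s (emit_cost r) (fun s' => O s' = rrr_bits r).
Proof.
move=> [EL En Ebb EP] [El Enb Ensb] [ESB EBLK ETAB ECODE] [ERK EPT EKK] [EWW EOF EXOF] b0 HS HX EO IS CS TS NS.
have CS1 : r_CODE r + 1 < S by have := size_index r; move: (\sum_(i < _) _) => q; lia.
have sbS : r_SB r <= r_CODE r by apply: leq_trans (leq_trans (leq_addr _ _) (leq_addr _ _)) (leq_addr _ _).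
have LE : r_L r = 8 * r_bb r + 8 by [].
have SBE : r_SB r = 10 * r_L r + 1 by [].
have l1 : r_L r + 10 < S by lia.
have blkS : r_BLK r <= r_CODE r by apply: leq_trans (leq_addr _ _) (leq_addr _ _).
have tabS : r_TAB r <= r_CODE r by rewrite /r_CODE leq_addr.
have PS : r_P r < S by nia.
have bS : r_bb r + 1 < S.
  by have : r_L r = 8 * r_bb r + 8 by []; lia.
have lS : r_l r < S.
  have : r_nb r * (4 * r_l r) <= r_TAB r by rewrite /r_TAB leq_addl.
  have : 0 < r_nb r by rewrite /r_nb addn1.
  nia.
have nsbS : r_nsb r < S.
  have h1 := leq_div (r_nb r - 1) (r_bb r); have h2 : 0 < r_nb r by rewrite /r_nb addn1.
  by rewrite /r_nsb; move: h1 h2; move: (_ %/ r_bb r) => q; lia.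
have P0 : 0 < r_P r by rewrite expn_gt0.
rewrite /emit_cost -!addnA; set T1 := 40 * r_L r + 40.
rewrite (addnA _ 40) -/T1.
apply: (@tri_weak S _ s (T1 + ((r_nsb r * (8 * r_L r + 10) + 2) +
  ((r_nb r * (16 * r_l r + 20) + 2) +
  (((r_bb r + 1) * r_P r * ((r_bb r + 1) * (4 * r_l r + 8) + 8) + 2) +
  (r_nb r * (4 * r_bb r + 6) + 2))))) _ (fun s' => O s' = O s ++ rrr_bits r)); last 2 first.
- rewrite /T1; lia.
- by move=> s' _; rewrite EO.
apply: tri_seq_emit; [|exact: leqnn|].
  have -> : T1 = (3 * r_L r + 2) + (37 * r_L r + 38) by rewrite /T1; lia.
  apply: tri_seq_emit; [|exact: leqnn|].
    apply: (@tri_for_emit S _ _ _ _ (r_L r) 1 (fun=> [:: false])) => //.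
    - by move=> s2 ag /=; split=> //; fr ag; rewrite EL.
    - lia.
    - lia.
    - by rewrite EO /= (size_flat (c := 1)) //; lia.
    - move=> i s2 ag Vi iL lt; apply: tri_emit => //; first by move: lt => /=; lia.
      by rewrite /= cats1.
  move=> s2 ag2 O2.
  have SO2 : size (O s2) = r_L r by rewrite O2 EO /= (size_flat (c := 1)) // muln1.
  rewrite (_ : 37 * r_L r + 38 = 1 + (37 * r_L r + 37)); last by lia.
  apply: tri_seq_emit; [|exact: leqnn|].
    by apply: tri_emit => //=; [lia|rewrite cats1].
  move=> s3 ag3 O3.
  have SO3 : size (O s3) = r_L r + 1 by rewrite O3 size_cat SO2.
  have VS x : occ x [:: vi] = false -> V s3 x = V s x.
    by move=> h; rewrite (agV ag3) // (agV ag2) //=; move: h => /=; case: Nat.eqb.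
  apply: (tri_weak (T := 37 * r_L r + 37) (tri_emfs (k := r_L r) (vals := [:: r_L r; r_n r; r_bb r; r_P r;
     r_l r; r_SB r; r_BLK r; r_TAB r; r_CODE r]) _ _ _ _ _ _)) => //.
  - by rewrite VS.
  - move=> s' i [sa _].
    have VS' x : occ x [:: vfv; vfi; vi] = false -> V s' x = V s x.
      move=> h; rewrite sa ?VS //; move: h => /=; case: (Nat.eqb x vfv) => //; case: (Nat.eqb x vfi) => //.
    do 9 (case: i => [|i] /=; first by move=> _; rewrite VS' // ?EL ?En ?Ebb ?EP ?El ?ESB ?EBLK ?ETAB; split=> //; lia).
    by rewrite !ltnS ltn0.
  - rewrite SO3 /=; lia.
  - rewrite /=; lia.
  - by move=> s4 _ ->; rewrite /= cats0.
move=> s1 ag1 EO1.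
have SO1 : size (O s1) = r_SB r by rewrite EO1 EO /= size_hdr.
have nbb i : i < r_nb r -> i %/ r_bb r * r_bb r < r_nb r.
  by move=> h; apply: leq_ltn_trans (leq_trunc_div _ _) h.
have sbl h : h < r_nsb r -> h * r_bb r < r_nb r.
  rewrite /r_nsb addn1 ltnS => hh.
  apply: leq_ltn_trans (leq_mul hh (leqnn _)) _.
  by apply: leq_ltn_trans (leq_trunc_div _ _) _; rewrite /r_nb addnK addn1.
apply: tri_seq_emit; [|exact: leqnn|].
  apply: (@tri_for_emit S _ _ _ _ (r_nsb r) (8 * r_L r + 8) (sbs r)) => //.
  - by move=> s2 ag /=; split=> //; fr ag; fr ag1.
  - lia.
  - by rewrite SO1 (size_flat (c := 2 * r_L r)); [move: blkS; rewrite {1}/r_BLK; lia|move=> *; apply: size_sbs].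
  move=> h s2 ag2 Vh hn lt; rewrite /sbs size_cat !size_bits in lt *.
  have EL2 : V s2 vL = r_L r by fr ag2; fr ag1.
  have Eb2 : V s2 vbb = r_bb r by fr ag2; fr ag1.
  have ER2 : A s2 aRK = r_RK r by fr ag2; fr ag1.
  have EP2 : A s2 aPT = r_PT r by fr ag2; fr ag1.
  have [HS1 HS2 HS3 _] := HS _ (sbl h hn).
  have hS := sbl h hn.
  have SLt : 2 * r_L r = 1 + 1 + (2 * r_L r - 2) by lia.
  apply: (tri_weak (T := 8 * r_L r + 8) (tri_emfs (k := r_L r) (vals := [:: r_RK r (h * r_bb r); r_PT r (h * r_bb r)]) _ _ _ _ _ _)) => //.
  - move=> s' i [sa sb].
    do 2 (case: i => [|i] /=; first by move=> _; rewrite sb !sa // Vh Eb2 ?ER2 ?EP2; side).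
    by rewrite !ltnS ltn0.
  - rewrite /=; lia.
  - rewrite /=; lia.
  - by move=> s4 _ ->; rewrite /= cats0.
move=> s2 ag2 EO2.
have SO2 : size (O s2) = r_BLK r.
  by rewrite EO2 size_cat SO1 (size_flat (c := 2 * r_L r)) // => *; apply: size_sbs.
apply: tri_seq_emit; [|exact: leqnn|].
  apply: (@tri_for_emit S _ _ _ _ (r_nb r) (16 * r_l r + 18) (blkr r)) => //.
  - by move=> s3 ag /=; split=> //; fr ag; fr ag2; fr ag1.
  - lia.
  - lia.
  - by rewrite SO2 (size_flat (c := 4 * r_l r)); [move: tabS; rewrite {1}/r_TAB; lia|move=> *; apply: size_blkr].
  move=> i s3 ag3 Vi inb lt.
  have El3 : V s3 vll = r_l r by fr ag3; fr ag2; fr ag1.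
  have Eb3 : V s3 vbb = r_bb r by fr ag3; fr ag2; fr ag1.
  have ER3 : A s3 aRK = r_RK r by fr ag3; fr ag2; fr ag1.
  have EP3 : A s3 aPT = r_PT r by fr ag3; fr ag2; fr ag1.
  have EK3 : A s3 aKK = r_KK r by fr ag3; fr ag2; fr ag1.
  have EW3 : A s3 aWW = r_WW r by fr ag3; fr ag2; fr ag1.
  have [HS1 HS2 HS3 [HS4 HS5]] := HS _ inb.
  have hS := nbb _ inb.
  rewrite size_blkr in lt.
  rewrite addnS; asg; rewrite ?Vi ?Eb3; try lia.
  set h := _ %/ _ * _ in hS *.
  set s4 := setv _ _ _.
  apply: (tri_weak (T := 16 * r_l r + 17) (tri_emfs (k := r_l r) (vals := [:: r_RK r i - r_RK r h;
     r_PT r i - r_PT r h; r_KK r i; r_WW r i]) _ _ _ _ _ _)) => //.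
  - have [HS1' HS2' _ _] := HS _ hS.
    move=> s' j [sa sb].
    do 4 (case: j => [|j] /=; first by move=> _; rewrite !sb !sa //= Vi ?ER3 ?EP3 ?EK3 ?EW3; side).
    by rewrite !ltnS ltn0.
  - rewrite /=; lia.
  - by move=> s5 _ ->; rewrite /= cats0 -/h.
move=> s3 ag3 EO3.
have SO3 : size (O s3) = r_TAB r.
  by rewrite EO3 size_cat SO2 (size_flat (c := 4 * r_l r)) // => *; apply: size_blkr.
apply: tri_seq_emit; [|exact: leqnn|].
  apply: (@tri_for_emit S _ _ _ _ ((r_bb r + 1) * r_P r) ((r_bb r + 1) * (4 * r_l r + 8) + 6) (tabr r)) => //.
  - by move=> s4 ag /=; split=> //; fr ag; fr ag3; fr ag2; fr ag1; rewrite Ebb EP.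
  - by rewrite -addnA.
  - rewrite SO3 (size_flat (c := (r_bb r + 1) * r_l r)); first by move: CS1; rewrite {1}/r_CODE; lia.
    by move=> *; apply: size_tabr.
  move=> e s4 ag4 Ve eT lt.
  have El4 : V s4 vll = r_l r by fr ag4; fr ag3; fr ag2; fr ag1.
  have Eb4 : V s4 vbb = r_bb r by fr ag4; fr ag3; fr ag2; fr ag1.
  have EX4 : A s4 aXOF = r_XOF r by fr ag4; fr ag3; fr ag2; fr ag1.
  have XS := HX _ eT.
  rewrite (_ : _ + 6 = ((r_bb r + 1) * (4 * r_l r + 8) + 4).+2); last by lia.
  asg; rewrite ?Ve ?EX4; try lia. asg.
  set s5 := setv _ _ _.
  rewrite size_tabr in lt.
  apply: (tri_weak (tri_for (N := r_bb r + 1) (c := 4 * r_l r + 6) (Inv := fun j s' =>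
    [/\ V s' vacc = pref (r_XOF r e) j, V s' vfy = r_XOF r e %/ 2 ^ j &
     O s' = O s4 ++ flat (fun j => bits (r_l r) (pref (r_XOF r e) j)) j]) _ _ _ (leqnn _) _ _)) => //.
  - by move=> s6 ag /=; split=> //; fr ag; rewrite /s5 /= Eb4.
  - by rewrite /= pref0 expn0 divn1 cats0.
  - move=> j s6 ag6 Vj jb [Ea Ef EO6].
    have El6 : V s6 vll = r_l r by fr ag6.
    have pl := pref_le (r_XOF r e) j.
    have dl := leq_div (r_XOF r e) (2 ^ j).
    have sz : size (O s6) + r_l r + 1 < S.
      rewrite EO6 size_cat (size_flat (c := r_l r)); last by move=> *; rewrite size_bits.
      have : j.+1 * r_l r <= (r_bb r + 1) * r_l r by rewrite leq_mul2r jb orbT.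
      rewrite mulSn; lia.
    apply: (tri_seq (T1 := 4 * r_l r + 3) (T2 := 3) (Q1 := fun s' => O s' = O s6 ++ bits (r_l r) (pref (r_XOF r e) j))); [|lia|].
      apply: tri_emf => //=; rewrite ?Ea //; try lia.
      by move=> s' ag; split=> //; fr ag.
    move=> s7 ag7 EO7.
    have Ea7 : V s7 vacc = pref (r_XOF r e) j by fr ag7.
    have Ef7 : V s7 vfy = r_XOF r e %/ 2 ^ j by fr ag7.
    have m2 : (r_XOF r e %/ 2 ^ j) %% 2 <= 1 by rewrite -ltnS ltn_mod.
    have d3 := leq_div (r_XOF r e %/ 2 ^ j) 2.
    asg; rewrite ?Ea7 ?Ef7; try lia.
    apply: tri_asg; rewrite /= ?Ef7 //; first by lia.
    by rewrite EO7 EO6 prefS flatS catA -divnMA -expnSr.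
  - have : (r_bb r + 1) * (4 * r_l r + 6 + 2) = (r_bb r + 1) * (4 * r_l r + 8) by congr (_ * _); lia.
    lia.
  - by move=> s6 _ [_ [_ _]].
move=> s4 ag4 EO4.
have SO4 : size (O s4) = r_CODE r.
  by rewrite EO4 size_cat SO3 (size_flat (c := (r_bb r + 1) * r_l r)) // => *; apply: size_tabr.
apply: (@tri_for_emit S _ _ _ _ (r_nb r) (4 * r_bb r + 4) (coder r)) => //.
- by move=> s5 ag /=; split=> //; fr ag; fr ag4; fr ag3; fr ag2; fr ag1.
- lia.
- by rewrite -addnA.
- rewrite SO4 size_flat_sum; under eq_bigr => i _ do rewrite /coder size_bits.
  by rewrite -size_index; lia.
move=> i s5 ag5 Vi inb; rewrite size_bits => lt.
have EO5 : A s5 aOF = r_OF r by fr ag5; fr ag4; fr ag3; fr ag2; fr ag1.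
have EW5 : A s5 aWW = r_WW r by fr ag5; fr ag4; fr ag3; fr ag2; fr ag1.
have [_ _ _ [HS4 HS5]] := HS _ inb.
apply: tri_emf; rewrite /= ?Vi ?EO5 //; try lia; try side.
by move=> s' ag; fr ag; rewrite Vi EW5; split=> //; side.
Qed.

(** * From the extremal counts to the bit string D *)

Definition winPf B (M1 M0 : nat -> nat) := forall m, m <= size B ->
  (forall i, i + m <= size B -> win B i m <= M1 m /\ m - win B i m <= M0 m) /\
  (exists i, i + m <= size B /\ M1 m <= win B i m) /\
  (exists i, i + m <= size B /\ M0 m <= m - win B i m).

Lemma win_ext B i m : i + m.+1 <= size B -> win B i m <= win B i m.+1 <= (win B i m).+1.
Proof.
move=> h; rewrite /win addnS.
have h1 := @ps_mono B (i + m) (i + m).+1 (leqnSn _).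
have h2 := @ps_diff B (i + m) (i + m).+1 (leqnSn _).
have h3 := @ps_mono B i (i + m) (leq_addr _ _).
lia.
Qed.

Lemma win_extl B i m : win B i.+1 m <= win B i m.+1 <= (win B i.+1 m).+1.
Proof.
rewrite /win addSnnS.
have h1 := @ps_mono B i i.+1 (leqnSn _).
have h2 := @ps_diff B i i.+1 (leqnSn _).
have h3 := @ps_mono B i.+1 (i + m.+1) ltac:(lia).
lia.
Qed.

(** Lower bounds: an optimal window of length [m] is extended by one position. Upper bounds: an
    optimal window of length [m + 1] loses its last position, which costs at most 1. *)
Lemma winPf_step B M1 M0 m : winPf B M1 M0 -> m < size B ->
  M1 m <= M1 m.+1 <= (M1 m).+1 /\ M0 m <= M0 m.+1 <= (M0 m).+1.
Proof.
move=> H h; have [a1 [[i1 [a2 a3]] [i0 [a4 a5]]]] := H m (ltnW h).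
have [b1 [[j1 [b2 b3]] [j0 [b4 b5]]]] := H m.+1 h.
have [c1 _] := a1 j1 ltac:(lia).
have [_ c2] := a1 j0 ltac:(lia).
have d1 := win_ext b2; have d2 := win_ext b4.
have e1 := win_le B i1 m; have e0 := win_le B i0 m.
have f1 := win_le B j1 m; have f0 := win_le B j0 m.
split.
  apply/andP; split; last by lia.
  (* A window that ends at the right end of [B] is extended to the left, which is possible because
     [m < size B]. *)
  case: (ltnP (i1 + m) (size B)) => hi.
    have [g1 _] := b1 i1 ltac:(lia).
    have := @win_ext B i1 m ltac:(lia); lia.
  case: i1 a2 a3 e1 hi => [|i1] a2 a3 e1 hi; first by lia.
  have [g1 _] := b1 i1 ltac:(lia).
  have := win_extl B i1 m; lia.
apply/andP; split; last by lia.
case: (ltnP (i0 + m) (size B)) => hi.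
  have [_ g1] := b1 i0 ltac:(lia).
  have := @win_ext B i0 m ltac:(lia); lia.
case: i0 a4 a5 e0 hi => [|i0] a4 a5 e0 hi; first by lia.
have [_ g1] := b1 i0 ltac:(lia).
have := win_extl B i0 m; lia.
Qed.

(* [M0 m] is the largest number of zeros in a window of length m, so the second
   half lists the increments of the minimum of ones, m - M0 m. *)
Definition Dfun n (M1 M0 : nat -> nat) i :=
  if i < n then M1 (i + 1) - M1 i
  else if i < 2 * n then 1 - (M0 (i - n + 1) - M0 (i - n)) else 0.

(** The decoding table is fixed at the pairs that occur in the string, and a query reads only the
    rows of such pairs. *)
Record rrrP n (Df : nat -> nat) (r : rrr) : Prop := RrrP {
  rp_n : r_n r = n;
  rp_bb : bbspec n (r_bb r);
  rp_l : exists2 lg, lgspec (r_bb r) lg & r_l r = 2 * lg;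
  rp_KK : forall i, i < r_nb r -> r_KK r i = pref (blkX Df (r_bb r) i) (r_bb r);
  rp_WW : forall i, i < r_nb r -> wspec (cntk (r_bb r) (r_P r) (r_KK r i)) (r_WW r i) /\ r_WW r i <= r_bb r;
  rp_RK : forall i, i < r_nb r -> r_RK r i = \sum_(i' < i) r_KK r i';
  rp_PT : forall i, i < r_nb r -> r_PT r i = \sum_(i' < i) r_WW r i';
  rp_OF : forall i, i < r_nb r -> r_OF r i < cntk (r_bb r) (r_P r) (r_KK r i);
  rp_XOF : forall i, i < r_nb r -> r_XOF r (r_KK r i * r_P r + r_OF r i) = blkX Df (r_bb r) i
}.

Definition build_cmd : cmd := prep_cmd ;; conv_cmd ;; (with_cmd ;; pair_cmd) ;; D_cmd ;;
  par_cmd ;; tab_cmd ;; w_cmd ;; bp_cmd ;; emit_cmd.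

Lemma emit_cost_le n r : 0 < n -> bbspec n (r_bb r) -> r_n r = n ->
  (exists2 lg, lgspec (r_bb r) lg & r_l r = 2 * lg) -> emit_cost r <= 4000 * n.
Proof.
move=> n0 hb En [lg hl El]; have bn := bb_le hb; have lb := lg_le hl.
have P4 := P4_le hb; have b0 : 0 < r_bb r by case: hb.
rewrite /emit_cost /r_nsb /r_nb /r_L /r_P El En addnK.
set bb := r_bb r in hb hl bn lb P4 b0 *; set q := (2 * n) %/ bb; set P := 2 ^ bb in P4 *.
have bP : bb < P by apply: ltn_expl.
have qb : q * bb <= 2 * n by rewrite leq_trunc_div.
have qq : q %/ bb <= q by apply: leq_div.
have T1 : (q %/ bb + 1) * (8 * (8 * bb + 8) + 10) <= 500 * n.
  apply: (@leq_trans ((q + 1) * (150 * bb))); first by apply: leq_mul; lia.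
  lia.
have T2 : (q + 1) * (16 * (2 * lg) + 20) <= 200 * n.
  apply: (@leq_trans ((q + 1) * (52 * bb))); first by apply: leq_mul; lia.
  lia.
have T4 : (q + 1) * (4 * bb + 6) <= 40 * n.
  apply: (@leq_trans ((q + 1) * (10 * bb))); first by apply: leq_mul; lia.
  lia.
have T3 : (bb + 1) * P * ((bb + 1) * (4 * (2 * lg) + 8) + 8) <= 400 * n.
  apply: (@leq_trans (P * P * (P * (24 * P)))); last by move: P4; rewrite !expnS expn0; lia.
  apply: leq_mul; first by apply: leq_mul; lia.
  apply: (@leq_trans (P * (8 * P + 8) + 8 * P * 1)); last by nia.
  apply: leq_add; last by lia.
  by apply: leq_mul; lia.
move: T1 T2 T3 T4.
set x1 := _ * (8 * (8 * bb + 8) + 10); set x2 := _ * (16 * (2 * lg) + 20).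
set x3 := (bb + 1) * P * _; set x4 := _ * (4 * bb + 6).
move: x1 x2 x3 x4 => x1 x2 x3 x4 *; lia.
Qed.

(** The terms are the linear passes, the tables for all pairs of types, and the treatment of all
    pairs of blocks. *)
Definition build_cost n b k T := 4900 * n + 100 + 300 * (T * T * ((b + 1) * (b + 1))) + 100 * (k * k * b).

Lemma build_cost_bound n b k T : T <= k -> k <= n -> 0 < n -> 0 < b ->
  (60 * n + 40) + (T * (T * ((b + 1) * ((b + 1) * 10 + 4) + 9) + 4) + 3) +
  (T * ((b + 1) * ((b + 1) * 9 + 4) + 6) + k * (k * (20 * b + 21) + 4) + 4) +
  4800 * n <= build_cost n b k T.
Proof.
move=> Tk kn n0 b0; rewrite /build_cost.
have h1 : T * (T * ((b + 1) * ((b + 1) * 10 + 4) + 9) + 4) <= 100 * (T * T * ((b + 1) * (b + 1))) + 4 * n.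
  have hb : (b + 1) * ((b + 1) * 10 + 4) + 9 <= 100 * ((b + 1) * (b + 1)) by nia.
  have := leq_mul (leqnn (T * T)) hb; have : T <= n by apply: leq_trans kn.
  lia.
have h2 : T * ((b + 1) * ((b + 1) * 9 + 4) + 6) <= 100 * (T * T * ((b + 1) * (b + 1))).
  have hb : (b + 1) * ((b + 1) * 9 + 4) + 6 <= 100 * ((b + 1) * (b + 1)) by nia.
  apply: leq_trans (leq_mul (leqnn T) hb) _.
  have hT : T <= T * T by case: (T) => // T'; rewrite leq_pmulr.
  have := leq_mul hT (leqnn (100 * ((b + 1) * (b + 1)))); lia.
have h3 : k * (k * (20 * b + 21) + 4) <= 100 * (k * k * b) + 4 * n.
  have hb : 20 * b + 21 <= 100 * b by lia.
  have := leq_mul (leqnn (k * k)) hb; lia.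
lia.
Qed.

Lemma build_spec S g GR t s : let B := yield t in let n := size B in
  3 * g < S -> 2000 * ((n + 1) * (n + 1) * (n + 1)) + 2000 < S -> wft GR g t ->
  A s aGR = GR -> V s vst = root t -> V s vg = g ->
  (forall j i, 0 < j -> A s j i = 0) -> O s = [::] ->
  exists tm s' b k T M1 M0 r, [/\ exec S build_cmd s tm s' /\ tm <= build_cost n b k T,
    bspec g n b /\ 0 < n, [/\ k * b <= 2 * n + b, k <= n, T <= g & T <= k],
    winPf B M1 M0 & rrrP n (Dfun n M1 M0) r /\ O s' = rrr_bits r].
Proof.
move=> B n gS nS wt Egr Est Eg A0 EO.
have n3 : (n + 1) * (n + 1) * (n + 1) >= n + 1.
  by rewrite -mulnA leq_pmulr // muln_gt0 addn1.
have nS8 : 8 * n + 8 < S by lia.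
have [t1 [s1 [X1 le1 [b [bs [En Eb Hb HB]]]]]] := prep_spec gS nS8 wt Egr Est Eg A0.
have ag1 := exec_agree X1.
have n0 : 0 < n.
  by have := size_pre t; rewrite -/B -/n; lia.
have g0 : 0 < g by have := root_lt wt; lia.
have bn := bspec_le g0 n0 Hb.
have kn := size_bs HB.
have nS5 : n * n * (2 * n + 2) + 8 * n + 16 < S by lia.
set T := V s1 vT; set k := size bs.
have Z j i : 0 < j -> occ j (moda prep_cmd) = false -> A s1 j i = 0.
  by move=> j0 h; rewrite (agA ag1) // A0.
have [t2 [s2 [X2 le2 [HC Es2]]]] := conv_spec nS5 bn HB Eb (fun i => Z aC1 i isT erefl) (fun i => Z aC0 i isT erefl).
have ag2 := exec_agree X2.
have HB2 : blocksP B b g bs s2.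
  case: HB => *; split=> //; fr ag2; assumption.
have ZM1 i : A s2 aM1 i = 0 by fr ag2; rewrite Z.
have ZM0 i : A s2 aM0 i = 0 by fr ag2; rewrite Z.
have [t3 [s3 [X3 le3 HW]]] := win_spec nS5 bn HB2 HC Es2 ZM1 ZM0.
have ag3 := exec_agree X3.
have ET2 : V s2 vT = T by fr ag2.
rewrite ET2 -/k in le3.
have En3 : V s3 vn = n by fr ag3; fr ag2.
set M1 := A s3 aM1 in HW; set M0 := A s3 aM0 in HW.
have HWf : winPf B M1 M0 by [].
have S1 : 1 < S by lia.
have S2 : 2 * n + 2 < S by lia.
have ZD i : A s3 aD i = 0 by fr ag3; fr ag2; rewrite Z.
have H1 i : i < n -> A s3 aM1 (i + 1) - A s3 aM1 i = M1 (i + 1) - M1 i /\ M1 (i + 1) - M1 i <= 1.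
  by move=> h; have [h1 _] := winPf_step HWf h; split=> //; rewrite addn1; lia.
have [t4 [s4 [X4 le4 HD]]] := D_spec (f0 := fun i => 1 - (M0 (i + 1) - M0 i)) S1 S2 En3 ZD H1 (fun _ _ => erefl).
have ag4 := exec_agree X4.
have D1 i : A s4 aD i <= 1.
  by rewrite HD; case: ifP => h; [have [] := H1 i h|case: ifP => // _; lia].
have En4 : V s4 vn = n by fr ag4.
have S3 : 1000 * n + 100 < S by lia.
have [t5 [s5 [X5 le5 HP]]] := par_spec n0 S3 En4.
have ag5 := exec_agree X5.
case: HP => bb [lg [[hb hl Ebb Ell] [EP [EL Enb Ensb [ESB EBLK ETAB ECODE]]]]].
have bbn := bb_le hb; have P4 := P4_le hb; have b0 : 0 < bb by case: hb.
have bP : bb < 2 ^ bb by apply: ltn_expl.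
have P2 : 2 ^ bb * 2 ^ bb <= 16 * n.
  by apply: leq_trans P4; rewrite mulnn leq_pexp2l // expn_gt0.
have P1 : 2 ^ bb <= 16 * n by apply: leq_trans P2; rewrite leq_pmulr // expn_gt0.
have bP2 : (bb + 1) * 2 ^ bb <= 16 * n.
  by apply: leq_trans P2; apply: leq_mul => //; rewrite addn1.
have S4 : (bb + 1) * 2 ^ bb + 2 < S by lia.
(* The counting tables must start from 0; the syntactic frames show that no earlier phase has
   written to their arrays. *)
have Z5 j i : 0 < j -> occ j (moda prep_cmd) = false -> occ j (moda conv_cmd) = false ->
   occ j (moda (with_cmd ;; pair_cmd)) = false -> occ j (moda D_cmd) = false ->
   occ j (moda par_cmd) = false -> A s5 j i = 0.
  move=> j0 h1 h2 h3 h4 h5.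
  by rewrite (agA ag5) // (agA ag4) // (agA ag3) // (agA ag2) // (agA ag1) // A0.
have ZP i : A s5 aPOP i = 0 by rewrite Z5.
have ZC i : A s5 aCNT i = 0 by rewrite Z5.
have ZX i : A s5 aXOF i = 0 by rewrite Z5.
have [t6 [s6 [X6 le6 [HT [HCN HXO]]]]] := tab_spec S4 EP ZP ZC ZX.
have ag6 := exec_agree X6.
have S5 : 2 * 2 ^ bb + 2 < S by lia.
have Ebb6 : V s6 vbb = bb by fr ag6.
have [t7 [s7 [X7 le7 HWD]]] := w_spec S5 Ebb6 HCN.
have ag7 := exec_agree X7.
(* A class has at most [2 ^ bb] members, so a minimal width does not exceed [bb]. *)
have HWb k0 : k0 <= bb -> A s7 aWD k0 <= bb.
  move=> h; case: (HWD _ h) => _ [->//|h'].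
  have := leq_trans h' (cntk_le _ _ _); rewrite ltn_exp2l //; lia.
set r0 := RRR n bb (2 * lg) id id id id id id in EL Enb Ensb ESB EBLK ETAB ECODE.
set nb := r_nb r0.
have Enb' : nb = 2 * n %/ bb + 1 by [].
have S6 : 20 * n + 2 ^ bb + 10 < S by lia.
have Ebb7 : V s7 vbb = bb by fr ag7; fr ag6.
have Enb7 : V s7 vnb = nb by fr ag7; fr ag6.
have D17 i : A s7 aD i <= 1 by fr ag7; fr ag6; fr ag5; apply: D1.
have HT7 x : x < 2 ^ bb -> A s7 aPOP x = pref x bb /\ A s7 aOFX x <= 2 ^ bb.
  move=> xP; have [h1 h2 _] := HT x xP; fr ag7; rewrite h1 h2; split=> //.
  by apply: leq_trans (cntk_le _ _ _) (ltnW xP).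
have [t8 [s8 [X8 le8 HBP]]] := bp_spec bbn b0 Enb' S6 Ebb7 Enb7 erefl D17 erefl erefl erefl HT7 HWb.
have ag8 := exec_agree X8.
set Df := A s7 aD in HBP D17.
have EDf i : Df i = Dfun n M1 M0 i.
  by rewrite /Df; fr ag7; fr ag6; fr ag5; rewrite HD.
have EX i : blkX Df bb i = blkX (Dfun n M1 M0) bb i.
  by rewrite /blkX; apply: eq_bigr => j _; rewrite EDf.
have XP i : blkX Df bb i < 2 ^ bb by apply: (@sum_lt2 (fun j => Df (i * bb + j))).
set r := RRR n bb (2 * lg) (A s8 aRK) (A s8 aPT) (A s8 aKK) (A s8 aWW) (A s8 aOF) (A s8 aXOF).
have qb : 2 * n %/ bb * bb <= 2 * n by rewrite leq_trunc_div.
have SW (h : nat -> nat) m : (forall i, h i <= bb) -> \sum_(i < m) h i <= m * bb.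
  move=> Hh; elim: m => [|m IH]; first by rewrite big_ord0.
  by rewrite big_ord_recr /= mulSnr; apply: leq_add.
have pb i : pref (blkX Df bb i) bb <= bb by apply: pref_le.
have nbb i : i < nb -> i * bb <= 2 * n.
  by move=> h; apply: leq_trans qb; rewrite leq_mul2r; apply/orP; right; lia.
have HR : rrrP n (Dfun n M1 M0) r.
  split=> //.
  - by exists lg.
  - by move=> i ib; have [h _ _ _ _] := HBP i ib; rewrite [LHS]h -EX.
  - move=> i ib /=; have [-> _ -> _ _] := HBP i ib; split; [exact: HWD|exact: HWb].
  - move=> i ib /=; have [_ _ _ -> _] := HBP i ib; apply: eq_bigr => j _.
    by have [|-> _ _ _ _] := HBP j _; first by apply: ltn_trans ib.
  - move=> i ib /=; have [_ _ _ _ ->] := HBP i ib; apply: eq_bigr => j _.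
    by have [|_ _ -> _ _] := HBP j _; first by apply: ltn_trans ib.
  - move=> i ib /=; have [-> -> _ _ _] := HBP i ib.
    fr ag7; have [_ -> _] := HT _ (XP i); apply: cntk_lt; exact: XP.
  - move=> i ib /=; have [-> -> _ _ _] := HBP i ib; rewrite -EX /r_P /=.
    by fr ag8; fr ag7; have [_ -> ->] := HT _ (XP i).
have CS : r_CODE r <= 800 * n by apply: CODE_le n0 hb hl.
have SZ : size (rrr_bits r) <= 803 * n.
  rewrite size_index; have : \sum_(i < r_nb r) r_WW r i <= nb * bb.
    suff Hs m : m <= r_nb r -> \sum_(i < m) r_WW r i <= m * bb by apply: Hs.
    elim: m => [|m IH] hm; first by rewrite big_ord0.
    rewrite big_ord_recr /= mulSnr; apply: leq_add; first by apply: IH; apply: ltnW.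
    by have [_ _ -> _ _] := HBP m hm; apply: HWb.
  have : nb * bb <= 3 * n by rewrite Enb' mulnDl; lia.
  by move: (\sum_(i < _) _) (nb * bb) => x y; lia.
have VV x : occ x (modv tab_cmd) = false -> occ x (modv w_cmd) = false -> occ x (modv bp_cmd) = false -> V s8 x = V s5 x.
  by move=> *; rewrite (agV ag8) // (agV ag7) // (agV ag6).
have [|||||||||||||t9 [s9 [X9 le9 E9]]] := @emit_spec S r s8.
- by rewrite !VV //; split=> //; fr ag5.
- by rewrite !VV.
- by rewrite !VV.
- by [].
- by [].
- by [].
- move=> i ib; have [h1 h2 h3 h4 h5] := HBP i ib; rewrite /= h1 h2 h3 h4 h5.
  have s1' := SW _ i pb; have s2' := SW (fun i => A s7 aWD (pref (blkX Df bb i) bb)) i (fun i => HWb _ (pb i)).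
  have nbi := nbb i ib; have [_ ob] := HT7 _ (XP i).
  split; [|by apply: leq_ltn_trans s2' _; lia| |split; [lia|exact: HWb]].
    by apply: leq_ltn_trans s1' _; lia.
  by apply: leq_ltn_trans (pb i) _; lia.
- move=> e _; rewrite /r /=; fr ag8; fr ag7; apply: leq_trans (HXO e) _; lia.
- by fr ag8; fr ag7; fr ag6; fr ag5; fr ag4; fr ag3; fr ag2; fr ag1.
- by rewrite /=; lia.
- lia.
- by rewrite /r_P /=; lia.
- by rewrite -[r_nb r]/nb Enb'; move: (leq_div (2 * n) bb) nS n3; clear; move: (_ %/ _) => q; lia.
exists (t1 + (t2 + (t3 + (t4 + (t5 + (t6 + (t7 + (t8 + t9)))))))), s9, b, k, T, M1, M0, r.
split=> //.
  split; first exact: (XSeq X1 (XSeq X2 (XSeq X3 (XSeq X4 (XSeq X5 (XSeq X6 (XSeq X7 (XSeq X8 X9)))))))).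
  apply: leq_trans (build_cost_bound (bp_Tk HB) kn n0 _); last by case: Hb.
  have EC := @emit_cost_le n r n0 hb (erefl : r_n r = n) (ex_intro2 _ _ lg hl (erefl : r_l r = 2 * lg)).
  have c7 : (bb + 1) * (5 * bb + 7) <= 400 * n.
    apply: (@leq_trans (2 ^ bb * (12 * 2 ^ bb))); last by lia.
    by apply: leq_mul; lia.
  have c8 : nb * (4 * bb + 13) <= 51 * n.
    apply: (@leq_trans (nb * (17 * bb))); first by rewrite leq_mul2l; apply/orP; right; lia.
    rewrite Enb'; lia.
  rewrite -/T -/k in le2 le3 *.
  move: le1 le2 le3 le4 le5 le6 le7 le8 le9 EC.
  set e1 := T * (T * _ + 4); set e2 := T * (_ + 6); set e3 := k * (k * _ + 4).
  rewrite -/n; move: e1 e2 e3 (emit_cost r) => *; lia.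
split=> //; first by apply: (bp_cnt HB).
exact: (bp_Tg HB). exact: (bp_Tk HB).
Qed.

(** * Queries *)

Lemma fld_add I p a b : fld I p (a + b) = fld I p a + 2 ^ a * fld I (p + a) b.
Proof.
rewrite /fld big_split_ord /=; congr (_ + _); rewrite big_distrr /=.
by apply: eq_bigr => i _; rewrite addnA expnD; lia.
Qed.

Lemma fld_lt I p m : fld I p m < 2 ^ m.
Proof.
rewrite /fld; elim: m => [|m IH]; first by rewrite big_ord0.
rewrite big_ord_recr /= expnS mul2n -addnn -addSn; apply: leq_add => //.
by case: nth; rewrite ?mul1n ?mul0n.
Qed.

Lemma fld_mod I p a b : fld I p (a + b) %% 2 ^ a = fld I p a.
Proof. by rewrite fld_add mulnC addnC modnMDl modn_small // fld_lt. Qed.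

Lemma fld_div I p a b : fld I p (a + b) %/ 2 ^ a = fld I (p + a) b.
Proof. by rewrite fld_add mulnC addnC divnMDl ?expn_gt0 // divn_small ?addn0 // fld_lt. Qed.

Lemma fld_flat f m i pre1 post w p a v b : i < m ->
  f i = a ++ bits w v ++ b -> v < 2 ^ w -> p = size pre1 + size (flat f i) + size a ->
  fld (pre1 ++ flat f m ++ post) p w = v.
Proof.
move=> im Ef vw Ep; have [r ->] := flat_split f im; rewrite Ef.
have -> : pre1 ++ (flat f i ++ (a ++ bits w v ++ b) ++ r) ++ post =
  (pre1 ++ flat f i ++ a) ++ bits w v ++ (b ++ r ++ post) by rewrite !catA.
by apply: fld_bits => //; rewrite !size_cat addnA.
Qed.

Lemma digit b j (d : nat -> nat) : (forall i, d i <= 1) -> j < b ->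
  (\sum_(i < b) d i * 2 ^ i) %/ 2 ^ j %% 2 = d j.
Proof.
elim: j b d => [|j IH] [//|b] d d1 jb.
all: rewrite big_ord_recl expn0 muln1.
all: have -> : \sum_(i < b) d (lift ord0 i) * 2 ^ (lift ord0 i) = 2 * \sum_(i < b) d i.+1 * 2 ^ i by
  rewrite big_distrr /=; apply: eq_bigr => i _; rewrite /bump /= add1n expnS; lia.
  by rewrite divn1 mulnC addnC modnMDl modn_small // ltnS.
set sm := \sum_(i < b) _.
have E : (d 0 + 2 * sm) %/ 2 = sm.
  by have := d1 0; move: (d 0) sm => x y; lia.
rewrite /= expnS divnMA E /sm.
by rewrite (IH b (fun i => d i.+1)).
Qed.

Lemma pref_blk Df bb i j : (forall i, Df i <= 1) -> j <= bb ->
  pref (blkX Df bb i) j = \sum_(j' < j) Df (i * bb + j').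
Proof.
move=> D1 jb; rewrite /pref; apply: eq_bigr => j' _.
by rewrite (@digit bb j' (fun j => Df (i * bb + j))) //; apply: leq_trans jb.
Qed.

Lemma sum_blocks (Df : nat -> nat) bb i j :
  \sum_(i' < i) \sum_(j' < bb) Df (i' * bb + j') + \sum_(j' < j) Df (i * bb + j') =
  \sum_(x < i * bb + j) Df x.
Proof.
rewrite big_split_ord /=; congr (_ + _).
elim: i => [|i IH]; first by rewrite !big_ord0.
by rewrite big_ord_recr /= IH mulSnr big_split_ord.
Qed.

Lemma sum_mono (h : nat -> nat) i j : j <= i -> \sum_(x < j) h x <= \sum_(x < i) h x.
Proof.
move=> ji; have [m ->] : exists m, i = j + m by exists (i - j); rewrite subnKC.
by rewrite big_split_ord leq_addr.
Qed.

(** * Reading the rank structure *)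

Section Rank.
Variables (n : nat) (Df : nat -> nat) (r : rrr).
Hypothesis H : rrrP n Df r.
Hypothesis n0 : 0 < n.
Hypothesis D1 : forall i, Df i <= 1.
Notation bb := (r_bb r).
Notation nb := (r_nb r).
Notation L := (r_L r).
Notation l := (r_l r).
Notation P := (r_P r).
Notation I := (rrr_bits r).
Notation KK := (r_KK r).
Notation WW := (r_WW r).

Lemma q_bb0 : 0 < bb. Proof. by case: (rp_bb H). Qed.

Lemma q_n16 : n < 16 ^ bb. Proof. by case: (rp_bb H) => _ /andP[]. Qed.

Lemma q_CODE : r_CODE r <= 800 * n.
Proof.
have [lg hl El] := rp_l H; have := CODE_le n0 (rp_bb H) hl.
by rewrite /r_CODE /r_TAB /r_BLK /r_SB /r_nsb /r_nb /r_L /r_P /= El (rp_n H).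
Qed.

Lemma q_2L : 800 * n < 2 ^ L.
Proof.
have h := q_n16; have b0 := q_bb0.
apply: (@leq_trans (2 ^ 10 * 16 ^ bb)); first by rewrite -[2 ^ 10]/1024; lia.
rewrite -[16]/(2 ^ 4) -expnM -expnD leq_exp2l // /r_L; lia.
Qed.

Lemma q_KK i : i < nb -> KK i <= bb.
Proof. by move=> /(rp_KK H) ->; apply: pref_le. Qed.

Lemma q_l : bb * bb < 2 ^ l.
Proof.
have [lg hl ->] := rp_l H; case: hl => _ /andP[_ h].
by rewrite mul2n -addnn expnD; apply: ltn_mul.
Qed.

Lemma q_l1 : bb < 2 ^ l.
Proof. by apply: leq_ltn_trans q_l; rewrite leq_pmulr // q_bb0. Qed.

Lemma q_sum (h : nat -> nat) i j : j <= i -> (forall x, x < i -> h x <= bb) ->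
  \sum_(x < i) h x - \sum_(x < j) h x <= (i - j) * bb.
Proof.
move=> ji; have [m ->] : exists m, i = j + m by exists (i - j); rewrite subnKC.
rewrite addKn big_split_ord /= addKn => hb.
have : forall x, x < m -> h (j + x) <= bb by move=> x xl; apply: hb; rewrite ltn_add2l.
elim: m {hb} => [|m IH] hx; first by rewrite big_ord0.
rewrite big_ord_recr /= mulSnr; apply: leq_add; last exact: hx.
by apply: IH => x xm; apply: hx; apply: ltnW.
Qed.

Lemma q_nb i : i < nb -> i * bb <= 2 * n.
Proof.
rewrite /r_nb addn1 ltnS (rp_n H) => h; apply: leq_trans (leq_trunc_div _ bb).
by rewrite leq_mul2r h orbT.
Qed.

Lemma q_RK i : i < nb -> r_RK r i <= 2 * n.
Proof.
move=> ib; rewrite (rp_RK H) //; apply: leq_trans (q_nb ib).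
have := @q_sum KK i 0 isT; rewrite big_ord0 !subn0; apply => x xi; apply: q_KK.
exact: ltn_trans ib.
Qed.

Lemma q_PT i : i < nb -> r_PT r i <= 2 * n.
Proof.
move=> ib; rewrite (rp_PT H) //; apply: leq_trans (q_nb ib).
have := @q_sum WW i 0 isT; rewrite big_ord0 !subn0; apply => x xi.
by have [_] := rp_WW H (ltn_trans xi ib).
Qed.

Lemma q_sbl h : h < r_nsb r -> h * bb < nb.
Proof.
rewrite /r_nsb addn1 ltnS => hh.
apply: leq_ltn_trans (leq_mul hh (leqnn _)) _.
by apply: leq_ltn_trans (leq_trunc_div _ _) _; rewrite /r_nb addnK addn1.
Qed.

Lemma fld_sb h : h < r_nsb r ->
  fld I (r_SB r + h * (2 * L)) L = r_RK r (h * bb) /\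
  fld I (r_SB r + h * (2 * L) + L) L = r_PT r (h * bb).
Proof.
move=> hn; have hb := q_sbl hn; have h1 := q_RK hb; have h2 := q_PT hb; have hL := q_2L.
have Es : size (flat (sbs r) h) = h * (2 * L) by apply: size_flat => *; apply: size_sbs.
rewrite /rrr_bits; split; apply: (fld_flat _ hn).
- by rewrite -[sbs r h]cat0s /sbs.
- lia.
- by rewrite size_hdr Es addn0.
- by rewrite /sbs -[X in _ ++ X]cats0.
- lia.
- by rewrite size_hdr Es size_bits.
Qed.

Lemma fld_blk i : i < nb -> let q := r_BLK r + i * (4 * l) in let h := i %/ bb * bb in
  [/\ fld I q l = r_RK r i - r_RK r h, fld I (q + l) l = r_PT r i - r_PT r h,
      fld I (q + 2 * l) l = KK i & fld I (q + 3 * l) l = WW i].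
Proof.
move=> ib q h; have l1 := q_l1; have l2 := q_l; have b0 := q_bb0.
have hi : h <= i by apply: leq_trunc_div.
have hib : h < nb by apply: leq_ltn_trans ib.
have ih : (i - h) * bb <= bb * bb.
  rewrite leq_mul2r; apply/orP; right.
  by rewrite {1}(divn_eq i bb) addKn; apply: ltnW; apply: ltn_pmod.
have Es : size (flat (blkr r) i) = i * (4 * l) by apply: size_flat => *; apply: size_blkr.
have E0 : I = (hdr r ++ flat (sbs r) (r_nsb r)) ++ flat (blkr r) nb ++
   (flat (tabr r) ((bb + 1) * P) ++ flat (coder r) nb) by rewrite /rrr_bits !catA.
have Ep : size (hdr r ++ flat (sbs r) (r_nsb r)) = r_BLK r.
  by rewrite size_cat size_hdr (size_flat (c := 2 * L)) // => *; apply: size_sbs.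
have WWb x : x <= i -> WW x <= bb.
  by move=> xi; have [_] := rp_WW H (leq_ltn_trans xi ib).
have KKb x : x <= i -> KK x <= bb by move=> xi; apply: q_KK; apply: leq_ltn_trans ib.
set a1 := bits l (r_RK r i - r_RK r h); set a2 := bits l (r_PT r i - r_PT r h).
rewrite E0; split; [apply: (fld_flat (a := [::]) _ ib)|apply: (fld_flat (a := a1) _ ib)|
  apply: (fld_flat (a := a1 ++ a2) (b := bits l (WW i)) _ ib)|
  apply: (fld_flat (a := (a1 ++ a2) ++ bits l (KK i)) (b := [::]) _ ib)].
- by rewrite /blkr.
- rewrite !(rp_RK H) //; apply: leq_ltn_trans (q_sum hi _) _; [by move=> x /ltnW; apply: KKb|lia].
- by rewrite Ep Es addn0.
- by rewrite /blkr.
- rewrite !(rp_PT H) //; apply: leq_ltn_trans (q_sum hi _) _; [by move=> x /ltnW; apply: WWb|lia].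
- by rewrite Ep Es size_bits.
- by rewrite /blkr -/h -catA.
- by apply: leq_ltn_trans (KKb i _) l1.
- by rewrite Ep Es size_cat !size_bits mul2n addnn.
- by rewrite /blkr -/h cats0 -!catA.
- by apply: leq_ltn_trans (WWb i _) l1.
- by rewrite Ep Es !size_cat !size_bits /q; lia.
Qed.

Lemma fld_tab e j : e < (bb + 1) * P -> j <= bb ->
  fld I (r_TAB r + (e * (bb + 1) + j) * l) l = pref (r_XOF r e) j.
Proof.
move=> eP jb; have l1 := q_l1.
have E0 : I = (hdr r ++ flat (sbs r) (r_nsb r) ++ flat (blkr r) nb) ++
   flat (tabr r) ((bb + 1) * P) ++ flat (coder r) nb by rewrite /rrr_bits !catA.
have Ep : size (hdr r ++ flat (sbs r) (r_nsb r) ++ flat (blkr r) nb) = r_TAB r.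
  rewrite size_cat size_hdr size_cat (size_flat (c := 2 * L)); last by move=> *; apply: size_sbs.
  by rewrite (size_flat (c := 4 * l)) ?addnA // => *; apply: size_blkr.
have Es : size (flat (tabr r) e) = e * ((bb + 1) * l) by apply: size_flat => *; apply: size_tabr.
have jb1 : j < bb + 1 by rewrite addn1.
have [q Eq] := flat_split (fun j => bits l (pref (r_XOF r e) j)) jb1.
rewrite E0; apply: (fld_flat _ eP Eq).
  by apply: leq_ltn_trans (pref_le _ _) _; apply: leq_ltn_trans jb l1.
rewrite Ep Es (size_flat (c := l)); last by move=> *; rewrite size_bits.
by rewrite mulnDl mulnA addnA.
Qed.

(** Codes differ in length; [r_PT] sums the widths before block [i] and thus locates its code, which
    fits since it is below the size of its class. *)
Lemma fld_code i : i < nb -> fld I (r_CODE r + r_PT r i) (WW i) = r_OF r i.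
Proof.
move=> ib.
have Ep : size (hdr r ++ flat (sbs r) (r_nsb r) ++ flat (blkr r) nb ++ flat (tabr r) ((bb + 1) * P)) = r_CODE r.
  rewrite size_cat size_hdr size_cat (size_flat (c := 2 * L)); last by move=> *; apply: size_sbs.
  rewrite size_cat (size_flat (c := 4 * l)); last by move=> *; apply: size_blkr.
  by rewrite (size_flat (c := (bb + 1) * l)) ?addnA // => *; apply: size_tabr.
have -> : I = (hdr r ++ flat (sbs r) (r_nsb r) ++ flat (blkr r) nb ++ flat (tabr r) ((bb + 1) * P)) ++
   flat (coder r) nb ++ [::] by rewrite /rrr_bits cats0 -!catA.
apply: (@fld_flat (coder r) nb i _ [::] (WW i) _ [::] _ [::]) => //.
- by rewrite cats0.
- have [[h _] _] := rp_WW H ib; exact: leq_trans (rp_OF H ib) h.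
- rewrite Ep addn0 size_flat_sum (rp_PT H) //; congr (_ + _).
  by apply: eq_bigr => j _; rewrite size_bits.
Qed.

Lemma q_idx i : i < nb -> KK i * P + r_OF r i < (bb + 1) * P.
Proof.
move=> ib; have h := q_KK ib.
have o : r_OF r i < P by apply: leq_trans (rp_OF H ib) (cntk_le _ _ _).
by rewrite mulnDl mul1n -addnS; apply: leq_add => //; rewrite leq_mul2r h orbT.
Qed.

(** The count before [p] is that before the superblock, plus the rest up to the block, plus the
    decoded part within the block. Truncated subtraction is exact here because [r_RK] increases. *)
Lemma rank_ok p : p <= 2 * n -> let i := p %/ bb in let j := p %% bb in
  [/\ i < nb, i %/ bb < r_nsb r &
  r_RK r (i %/ bb * bb) + (r_RK r i - r_RK r (i %/ bb * bb)) +
    pref (r_XOF r (KK i * P + r_OF r i)) j = \sum_(x < p) Df x].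
Proof.
move=> pn i j; have b0 := q_bb0.
have ib : i < nb by rewrite /r_nb addn1 ltnS (rp_n H) leq_div2r.
have hi : i %/ bb * bb <= i by apply: leq_trunc_div.
have hib : i %/ bb * bb < nb by apply: leq_ltn_trans ib.
have jb : j <= bb by apply: ltnW; apply: ltn_pmod.
split=> //.
  by rewrite /r_nsb addn1 ltnS; apply: leq_div2r; rewrite subn1 -ltnS prednK //; apply: leq_ltn_trans ib.
rewrite subnKC; last first.
  by rewrite !(rp_RK H) // sum_mono.
rewrite (rp_XOF H) // pref_blk // (rp_RK H) //.
have -> : \sum_(x < p) Df x = \sum_(x < i * bb + j) Df x by rewrite /i /j -divn_eq.
rewrite -sum_blocks; congr (_ + _).
apply: eq_bigr => x _; rewrite (rp_KK H); last by apply: ltn_trans ib.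
by rewrite pref_blk.
Qed.
End Rank.

(** * Which numbers of ones occur in windows of a given length *)

Lemma winE B i m : win B i m = count_mem true (take m (drop i B)).
Proof. by rewrite /win /ps takeD count_cat addKn. Qed.

Lemma jumbled_win B m c : jumbled_occurs B m c <-> exists i, i + m <= size B /\ win B i m = c.
Proof.
split=> [[s [/infixP [u [v E]] <- <-]]|[i [h <-]]].
  exists (size u); split; first by rewrite E !size_cat addnA leq_addr.
  by rewrite winE E drop_size_cat // take_size_cat.
exists (take m (drop i B)); split; last by rewrite winE.
  apply/infixP; exists (take i B), (drop m (drop i B)).
  by rewrite !cat_take_drop.
by rewrite size_takel // size_drop; lia.
Qed.

(** A discrete intermediate value theorem. The last step changes [f] by at most 1, so [c] is either
    the final value or already enclosed one step earlier. *)
Lemma ivt (f : nat -> nat) i d c : (forall x, x < i + d -> f x <= (f x.+1).+1 /\ f x.+1 <= (f x).+1) ->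
  f i <= c <= f (i + d) \/ f (i + d) <= c <= f i -> exists j, i <= j <= i + d /\ f j = c.
Proof.
elim: d => [|d IH] H; rewrite ?addn0 ?addnS => h.
  exists i; rewrite leqnn; split=> //; lia.
have [h1 h2] := H (i + d) ltac:(lia).
have IH' := IH (fun x xl => H x ltac:(lia)).
case: (eqVneq (f (i + d).+1) c) => [E|ne]; first by exists (i + d).+1; split=> //; lia.
have [|j [jl Ej]] := IH'; last by exists j; split=> //; lia.
lia.
Qed.

(** Sliding a window by one position changes its number of ones by at most 1, so between a poorest
    and a richest window all values occur, whichever of the two comes first. *)
Lemma jumbled_range B M1 M0 m c : winPf B M1 M0 ->
  jumbled_occurs B m c <-> [&& m <= size B, m - M0 m <= c & c <= M1 m].
Proof.
move=> H; rewrite jumbled_win; split.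
  move=> [i [h <-]]; have mn : m <= size B by lia.
  have [/(_ i h) [h1 h2] _] := H m mn; have := win_le B i m; lia.
case/and3P => mn c0 c1; have [_ [[i [h1 h2]] [j [h3 h4]]]] := H m mn.
(* Sliding is an extension to the right followed by the loss of the first position; both neighbours
   are compared with the window of length [m + 1]. *)
have step x : x < size B - m -> win B x m <= (win B x.+1 m).+1 /\ win B x.+1 m <= (win B x m).+1.
  move=> xl; have := @win_ext B x m ltac:(lia); have := win_extl B x m; lia.
have wj := win_le B j m; have wi := win_le B i m.
case: (leqP i j) => ij.
  have [|k [kl Ek]] := @ivt (fun x => win B x m) i (j - i) c (fun x xl => step x ltac:(lia)).
    rewrite subnKC //; right; lia.
  by exists k; split=> //; lia.
have [|k [kl Ek]] := @ivt (fun x => win B x m) j (i - j) c (fun x xl => step x ltac:(lia)).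
  rewrite subnKC; [left; lia|lia].
by exists k; split=> //; lia.
Qed.

Section DSum.
Variables (B : seq bool) (M1 M0 : nat -> nat).
Hypothesis H : winPf B M1 M0.
Notation n := (size B).

Lemma win_M00 : M1 0 = 0 /\ M0 0 = 0.
Proof.
have [_ [[i [_ h1]] [j [_ h2]]]] := H (leq0n n).
have := win_le B i 0; split; lia.
Qed.

Lemma Dfun_le1 i : Dfun n M1 M0 i <= 1.
Proof.
rewrite /Dfun; case: ifP => h; last by case: ifP => // _; lia.
by have [h1 _] := winPf_step H h; rewrite addn1; lia.
Qed.

Lemma Dfun_sum1 m : m <= n -> \sum_(x < m) Dfun n M1 M0 x = M1 m.
Proof.
have [E0 _] := win_M00.
elim: m => [|m IH] h; first by rewrite big_ord0 E0.
rewrite big_ord_recr /= IH ?(ltnW h) // /Dfun h addn1.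
by have [h1 _] := winPf_step H h; lia.
Qed.

(** The increments telescope. Subtracting the rank at [n] leaves [m - M0 m], the least number of
    ones. *)
Lemma Dfun_sum2 m : m <= n -> \sum_(x < n + m) Dfun n M1 M0 x = M1 n + (m - M0 m).
Proof.
have [_ E0] := win_M00.
elim: m => [|m IH] h; first by rewrite addn0 Dfun_sum1 // E0 subnn addn0.
rewrite addnS big_ord_recr /= IH ?(ltnW h) // /Dfun.
rewrite ltnNge leq_addr /= mul2n -addnn ltn_add2l h addKn addn1.
have [_ h1] := winPf_step H h.
(* This gives [M0 m <= m], without which the truncated differences would not telescope. *)
have [_ [_ [j [_ h2]]]] := H (ltnW h).
have := win_le B j m; lia.
Qed.
End DSum.

(** * Word tricks, and access to fields of the index *)

Lemma xor_odd a b : Nat.lxor (2 * a) (2 * b + 1) = 2 * Nat.lxor a b + 1.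
Proof.
apply: Nat.bits_inj => -[|k].
  rewrite Nat.lxor_spec !Nat.testbit_odd_0 -[2 * a]/(Nat.mul 2 a) Nat.testbit_even_0 //.
by rewrite Nat.lxor_spec !Nat.testbit_odd_succ ?Nat.testbit_even_succ ?Nat.lxor_spec //; apply: Nat.le_0_l.
Qed.

(* x xor (x - 1) isolates the lowest 1 bit of x. *)
Lemma xor_low L y : Nat.lxor (2 ^ L * (2 * y + 1)) (2 ^ L * (2 * y + 1) - 1) + 1 = 2 ^ L.+1.
Proof.
elim: L => [|L IH].
  rewrite expn0 !mul1n addnK.
  by rewrite Nat.lxor_comm xor_odd Nat.lxor_nilpotent.
have -> : 2 ^ L.+1 * (2 * y + 1) - 1 = 2 * (2 ^ L * (2 * y + 1) - 1) + 1.
  have : 0 < 2 ^ L * (2 * y + 1) by rewrite muln_gt0 expn_gt0 addn1.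
  by rewrite expnS; move: (2 ^ L) => q; lia.
have -> : 2 ^ L.+1 * (2 * y + 1) = 2 * (2 ^ L * (2 * y + 1)) by rewrite expnS mulnA.
by rewrite xor_odd -addnA -[1 + 1]/(2 * 1) -mulnDr IH -expnS.
Qed.

(* A field of at most w bits spans at most two words. *)
Definition read_bits p m := MBin OpMod
  (MBin OpAdd (MBin OpShr (MRaw (MBin OpDiv p MWs)) (MBin OpMod p MWs))
     (MBin OpShl (MRaw (MBin OpAdd (MBin OpDiv p MWs) (MCst 1))) (MBin OpSub MWs (MBin OpMod p MWs))))
  (MBin OpShl (MCst 1) m).

(** The shifted first word supplies [w - s] bits and the second one the next [s], the rest of it
    vanishing modulo [2 ^ w]; the two do not overlap. For [s = 0] the second word vanishes
    altogether. *)
Lemma read_bits_val w I a s m : s < w -> m <= w ->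
  ((fld I (a * w) w %/ 2 ^ s + (fld I ((a + 1) * w) w * 2 ^ (w - s)) %% 2 ^ w) %% 2 ^ w) %% 2 ^ m =
  fld I (a * w + s) m.
Proof.
move=> sw mw.
have E1 : fld I (a * w) w %/ 2 ^ s = fld I (a * w + s) (w - s).
  by rewrite -{2}(subnKC (ltnW sw)) fld_div.
have E2 : (fld I ((a + 1) * w) w * 2 ^ (w - s)) %% 2 ^ w = 2 ^ (w - s) * fld I ((a + 1) * w) s.
  have Ew : 2 ^ w = 2 ^ (w - s) * 2 ^ s by rewrite -expnD subnK // ltnW.
  have -> : fld I ((a + 1) * w) w = fld I ((a + 1) * w) s + 2 ^ s * fld I ((a + 1) * w + s) (w - s).
    by rewrite -fld_add subnKC // ltnW.
  rewrite Ew; move: (fld_lt I ((a + 1) * w) s); move: (fld I ((a + 1) * w) s) (fld I _ (w - s)) => A X A_lt.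
  rewrite (_ : (A + 2 ^ s * X) * 2 ^ (w - s) = X * (2 ^ (w - s) * 2 ^ s) + 2 ^ (w - s) * A); last by lia.
  by rewrite modnMDl modn_small // ltn_pmul2l ?expn_gt0.
have E3 : (a + 1) * w = a * w + s + (w - s) by rewrite mulnDl mul1n -addnA subnKC // ltnW.
rewrite E1 E2 E3 -fld_add subnK; last exact: ltnW.
rewrite (modn_small (fld_lt _ _ _)).
have -> : fld I (a * w + s) w = fld I (a * w + s) (m + (w - m)) by rewrite subnKC.
exact: fld_mod.
Qed.

Section Query.
Variables (w S : nat) (I : seq bool).
Hypothesis S0 : 2000 < S.
Hypothesis Sw : S ^ 31 <= 2 ^ w.
Hypothesis w0 : 0 < w.
Notation M := (word_of_bits w I).

Let w1 : 1 < 2 ^ w. Proof. by rewrite -{1}(expn0 2) ltn_exp2l. Qed.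
Let ww : w < 2 ^ w. Proof. exact: ltn_expl. Qed.
Let SSw : S < 2 ^ w.
Proof.
apply: leq_trans Sw; rewrite -{1}(expn1 S) ltn_exp2l //; lia.
Qed.

Definition qok p m := p < S /\ 2 ^ m <= S.

Lemma read_bits_ok f a b p m : mev w f M a = p -> mev w f M b = m -> qok p m ->
  mev w f M (read_bits a b) = fld I p m /\ fld I p m < S.
Proof.
move=> Ea Eb [pS mS]; split; last by apply: leq_trans (fld_lt _ _ _) mS.
have mw : m < w by rewrite -(ltn_exp2l m w (isT : 1 < 2)); apply: leq_ltn_trans mS SSw.
have sw := ltn_pmod p w0.
have pd : p %/ w + 1 < 2 ^ w.
  by rewrite addn1; apply: leq_ltn_trans SSw; apply: leq_ltn_trans pS; apply: leq_div.
rewrite /read_bits; cbn [mev]; rewrite /eval_binop Ea Eb.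
rewrite (modn_small w1) (modn_small pd) mul1n (modn_small (m := 2 ^ m)); last by rewrite ltn_exp2l.
have -> : (w + 2 ^ w - p %% w) %% 2 ^ w = w - p %% w.
  rewrite addnC -addnBA; last exact: ltnW.
  by rewrite modnDl modn_small //; apply: leq_ltn_trans ww; apply: leq_subr.
by rewrite (read_bits_val I (p %/ w) sw (ltnW mw)) -divn_eq.
Qed.

Notation trq := (tr read_bits).
Notation wfq := (wfe (fun _ _ => true)).

(* Weakest precondition of straight-line code over the bits of the index. *)
Fixpoint Qp (l : seq (nat * nexp)) (F : nat -> nat) (Post : (nat -> nat) -> Prop) := match l with
  | [::] => Post F
  | (x, e) :: l' => [/\ safe qok F (fld I) e, ev F (fld I) e < S & Qp l' (upd F x (ev F (fld I) e)) Post]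
  end.

Definition mrun (l : seq (nat * mexp)) (f : nat -> nat) :=
  foldl (fun f xe => [eta f with xe.1 |-> mev w f M xe.2]) f l.

Definition mseq (l : seq (nat * mexp)) := foldr (fun xe c => MSeq (MAsg xe.1 xe.2) c) MSkip l.

Lemma mseq_ok l f : mexec w (mseq l) f M (size l) (mrun l f) M.
Proof.
elim: l f => [|[x e] l IH] f; first by constructor.
by rewrite -[size _]/(1 + size l); apply: MXSeq; [constructor|apply: IH].
Qed.

Lemma mrun_cat l1 l2 f : mrun (l1 ++ l2) f = mrun l2 (mrun l1 f).
Proof. exact: foldl_cat. Qed.

Definition env (f F : nat -> nat) := forall x, x < rS -> f x = F x /\ F x < S.

Definition trl (l : seq (nat * nexp)) := [seq (xe.1, trq xe.2) | xe <- l].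

Lemma Qp_ok l F f Post : all (fun xe : nat * nexp => (xe.1 < rS) && wfq xe.2) l -> env f F -> Qp l F Post ->
  exists F', [/\ env (mrun (trl l) f) F', Post F' & mrun (trl l) f rO = f rO].
Proof.
elim: l F f => [|[x e] l IH] F f /=; first by exists F.
move=> /andP[/andP[xr we] wl] E [se eS HQ].
have [Em _] := @tr_ok read_bits (fun _ _ => true) w S f M F (fld I) qok S0 Sw E
  (fun a b _ h h1 h2 => read_bits_ok h1 h2 h) e we se.
have E' : env [eta f with x |-> mev w f M (trq e)] (upd F x (ev F (fld I) e)).
  move=> y yr; rewrite Em /=; case: eqP => [->|ne]; first by rewrite Nat.eqb_refl.
  by case: Nat.eqb_spec => // _; apply: E.
have [F' [h1 h2 h3]] := IH _ _ wl E' HQ.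
exists F'; split=> //; rewrite [LHS]h3 /=; case: eqP => // Ex.
by rewrite -Ex in xr.
Qed.

Lemma Qp_cat l1 l2 F Post : Qp (l1 ++ l2) F Post <-> Qp l1 F (fun F' => Qp l2 F' Post).
Proof. by elim: l1 F => //= -[x e] l1 IH F; split=> -[h1 h2 /IH h3]. Qed.
End Query.

(** Registers 10 to 18 hold the nine header fields in their order. Registers 30, 31 and 32 are the
    block, the position in it and the superblock; 33 to 38 are the directory entries and 39 is the
    code. *)
Definition rank_code p dst : seq (nat * nexp) := [::
  (30, $p %/ $12); (31, $p %% $12); (32, $30 %/ $12);
  (33, Ld ($15 + $32 * (2 * $10)) $10);
  (34, Ld ($15 + $32 * (2 * $10) + $10) $10);
  (35, Ld ($16 + $30 * (4 * $14)) $14);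
  (36, Ld ($16 + $30 * (4 * $14) + $14) $14);
  (37, Ld ($16 + $30 * (4 * $14) + 2 * $14) $14);
  (38, Ld ($16 + $30 * (4 * $14) + 3 * $14) $14);
  (39, Ld ($18 + ($34 + $36)) $38);
  (dst, $33 + $35 + Ld ($17 + (($37 * $13 + $39) * ($12 + 1) + $31) * $14) $14)]%nexp.

(** Ranks at [m], [n] and [n + m]: the first is the largest count, and the difference of the last
    two is the smallest. *)
Definition qmain : seq (nat * nexp) :=
  rank_code 20 40 ++ (rank_code 11 41 ++ ((21, $11 + $20)%nexp :: rank_code 21 42)).

(** The whole header lies in the first word. Register 100 contains [2 ^ L] and register 101 what is
    left of the word, so division and remainder peel off one field after the other. *)
Definition qhdr : seq (nat * mexp) :=
  flatten [seq [:: (x, MBin OpMod (MVar 101) (MVar 100)); (101, MBin OpDiv (MVar 101) (MVar 100))]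
          | x <- iota 10 9].

(** The field width is unknown to the query. The first word is an odd multiple of [2 ^ L]; its
    exclusive or with its predecessor, plus 1, is [2 ^ (L + 1)]. *)
Definition qpre : seq (nat * mexp) := [::
  (100, MBin OpAdd (MBin OpXor (MRaw (MCst 0)) (MBin OpSub (MRaw (MCst 0)) (MCst 1))) (MCst 1));
  (101, MBin OpDiv (MRaw (MCst 0)) (MVar 100));
  (100, MBin OpDiv (MVar 100) (MCst 2))].

(** A length beyond [n] is replaced by 0, with the comparison kept in register 22. Since [m] and [c]
    may exceed [S], registers 0 and 1 are cleared and [c] moves to 101, outside the registers that
    must stay below [S]. *)
Definition qarg : seq (nat * mexp) := [::
  (22, MBin OpEqn (MBin OpLtn (MVar 11) (MVar 0)) (MCst 0));
  (20, MBin OpMul (MVar 0) (MVar 22));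
  (101, MVar 1); (0, MCst 0); (1, MCst 0)].

Definition qpost : seq (nat * mexp) := [::
  (50, MBin OpSub (MVar 42) (MVar 41));
  (0, MBin OpMul (MVar 22) (MBin OpMul
    (MBin OpEqn (MBin OpLtn (MVar 101) (MVar 50)) (MCst 0))
    (MBin OpEqn (MBin OpLtn (MVar 40) (MVar 101)) (MCst 0))))].

Definition qall := qpre ++ (qhdr ++ (qarg ++ (trl qmain ++ qpost))).

Section QueryOk.
Variables (w S n : nat) (Df : nat -> nat) (r : rrr).
Hypothesis S0 : 2000 < S.
Hypothesis Sw : S ^ 31 <= 2 ^ w.
Hypothesis w0 : 0 < w.
Hypothesis H : rrrP n Df r.
Hypothesis n0 : 0 < n.
Hypothesis D1 : forall i, Df i <= 1.
Hypothesis LS : 2 ^ r_L r <= S.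
Hypothesis Lw : 10 * r_L r + 1 <= w.
Hypothesis nS : 2000 * n < S.
Notation I := (rrr_bits r).
Notation M := (word_of_bits w I).
Notation bb := (r_bb r).
Notation L := (r_L r).
Notation l := (r_l r).

Definition qenv F := [/\ F 10 = L, F 11 = n, F 12 = bb & F 13 = r_P r] /\
  [/\ F 14 = l, F 15 = r_SB r, F 16 = r_BLK r, F 17 = r_TAB r & F 18 = r_CODE r].

Lemma lS : 2 ^ l <= S.
Proof.
apply: leq_trans LS; rewrite leq_exp2l //.
have [lg hl El] := rp_l H; have := lg_le hl; rewrite El /r_L; lia.
Qed.

Lemma rank_code_ok p dst F pv Post : qenv F -> p < 30 -> F p = pv -> pv <= 2 * n -> dst < 100 ->
  (forall F', F' dst = \sum_(x < pv) Df x ->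
     (forall x, (x < 30) || (39 < x) -> x <> dst -> F' x = F x) -> Post F') ->
  Qp S I (rank_code p dst) F Post.
Proof.
move=> [[F10 F11 F12 F13] [F14 F15 F16 F17 F18]] p3 Fp pn dd HP.
set i := pv %/ bb; set j := pv %% bb; set h := i %/ bb.
have b0 := q_bb0 H; have [ib hn Erk] := rank_ok H D1 pn; rewrite -/i -/j -/h in ib hn Erk.
have hb := q_sbl hn.
have [f1 f2] := fld_sb H n0 hn.
have [f3 f4 f5 f6] := fld_blk H n0 ib; rewrite -/h in f3 f4 f5 f6.
have f7 := fld_code H ib.
have CS := q_CODE H n0.
have kb := q_KK H ib.
have [_ wb] := rp_WW H ib.
have jb : j <= bb by apply: ltnW; apply: ltn_pmod.
have eP := q_idx H ib.
have f8 := fld_tab H eP jb.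
have RKn := q_RK H ib; have PTn := q_PT H ib.
have RKh := q_RK H hb; have PTh := q_PT H hb.
have lS' := lS.
have sbB : r_SB r + h * (2 * L) + 2 * L <= r_BLK r.
  by rewrite /r_BLK -addnA leq_add2l -mulSnr leq_mul2r hn orbT.
have blB : r_BLK r + i * (4 * l) + 4 * l <= r_TAB r.
  by rewrite /r_TAB -addnA leq_add2l -mulSnr leq_mul2r ib orbT.
have tbB : r_TAB r + ((r_KK r i * r_P r + r_OF r i) * (bb + 1) + j) * l <= r_CODE r.
  rewrite /r_CODE leq_add2l mulnA leq_mul2r; apply/orP; right.
  apply: (@leq_trans ((r_KK r i * r_P r + r_OF r i).+1 * (bb + 1))); first by rewrite mulSn; lia.
  by rewrite leq_mul2r eP orbT.
have tC : r_TAB r <= r_CODE r by apply: leq_addr.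
have bT : r_BLK r <= r_TAB r by apply: leq_addr.
have PTs : r_PT r (h * bb) + (r_PT r i - r_PT r (h * bb)) = r_PT r i.
  rewrite subnKC // !(rp_PT H) //; apply: sum_mono; exact: leq_trunc_div.
have iS : i <= 2 * n by apply: leq_trans (leq_div _ _) pn.
have hS : h <= 2 * n by apply: leq_trans (leq_div _ _) iS.
have jS : j <= 2 * n by apply: leq_trans (leq_mod _ _) pn.
have bn := bb_le (rp_bb H).
have WWS : 2 ^ r_WW r i <= S.
  by apply: leq_trans LS; rewrite leq_exp2l // /r_L; lia.
have OFn : r_OF r i < S.
  apply: leq_trans (rp_OF H ib) _; apply: leq_trans (cntk_le _ _ _) _.
  by apply: leq_trans LS; rewrite /r_P leq_exp2l // /r_L; lia.
have pf := pref_le (r_XOF r (r_KK r i * r_P r + r_OF r i)) j.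
have KKS : r_KK r i < S by lia.
have WS : r_WW r i < S by lia.
have X : \sum_(x < pv) Df x < S.
  by rewrite -Erk; lia.
have p30 : Nat.eqb p 30 = false by apply/Nat.eqb_neq; lia.
have ph x : (x < 30) || (39 < x) -> forall y, (29 < y) && (y < 40) -> Nat.eqb x y = false.
  by move=> hx y hy; apply/Nat.eqb_neq; lia.
pose V33 := r_RK r (h * bb); pose V34 := r_PT r (h * bb).
have step x e lst F' v : safe (qok S) F' (fld I) e -> ev F' (fld I) e = v -> v < S ->
    Qp S I lst (upd F' x v) Post -> Qp S I ((x, e) :: lst) F' Post.
  by move=> h1 h2 h3 h4; split=> //; rewrite h2.
pose FE := (F10, F11, F12, F13, F14, F15, F16, F17, F18).
have lw m : m <= L -> 2 ^ m <= S by move=> mL; apply: leq_trans LS; rewrite leq_exp2l.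
rewrite /rank_code.
apply: (step _ _ _ _ i); [done|by rewrite /= Fp FE|lia|].
apply: (step _ _ _ _ j); [done|by rewrite /= p30 Fp FE|lia|].
apply: (step _ _ _ _ h); [done|by rewrite /= FE|lia|].
apply: (step _ _ _ _ (r_RK r (h * bb))); [|by rewrite /= !FE|lia|].
  by rewrite /= !FE; do !split=> //; lia.
apply: (step _ _ _ _ (r_PT r (h * bb))); [|by rewrite /= !FE|lia|].
  by rewrite /= !FE; do !split=> //; lia.
apply: (step _ _ _ _ (r_RK r i - r_RK r (h * bb))); [|by rewrite /= !FE|lia|].
  by rewrite /= !FE; do !split=> //; lia.
apply: (step _ _ _ _ (r_PT r i - r_PT r (h * bb))); [|by rewrite /= !FE|lia|].
  by rewrite /= !FE; do !split=> //; lia.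
apply: (step _ _ _ _ (r_KK r i)); [|by rewrite /= !FE|lia|].
  by rewrite /= !FE; do !split=> //; lia.
apply: (step _ _ _ _ (r_WW r i)); [|by rewrite /= !FE|lia|].
  by rewrite /= !FE; do !split=> //; lia.
apply: (step _ _ _ _ (r_OF r i)); [|by rewrite /= !FE PTs|lia|].
  by rewrite /= !FE PTs; do !split=> //; lia.
apply: (step _ _ _ _ (\sum_(x < pv) Df x)); [|by rewrite /= !FE f8 Erk|done|].
  by rewrite /= !FE; do !split=> //; lia.
apply: HP => /=; first by rewrite Nat.eqb_refl.
move=> x hx nx; have -> : Nat.eqb x dst = false by apply/Nat.eqb_neq.
by rewrite !(ph x hx).
Qed.
End QueryOk.

Lemma qarg_ok w I f m c n : 1 < 2 ^ w -> m < 2 ^ w -> f 0 = m -> f 1 = c -> f 11 = n ->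
  let f3 := mrun w I qarg f in
  [/\ f3 22 = (m <= n), f3 20 = m * (m <= n), f3 101 = c, f3 0 = 0 & f3 1 = 0] /\
  (forall x, x \notin [:: 22; 20; 101; 0; 1] -> f3 x = f x).
Proof.
move=> W1 mw f0 f1 f11.
have E (b : bool) : (b == 0 %% 2 ^ w :> nat) = ~~ b by rewrite mod0n; case: b.
rewrite /mrun /qarg; cbn [foldl fst snd mev eval_binop].
set g1 := [eta f with 22 |-> _].
have [g1a g1b] : g1 22 = (m <= n) /\ forall x, x != 22 -> g1 x = f x.
  split=> [|x]; first by rewrite /g1 /= f11 f0 E -leqNgt.
  by rewrite /g1 /= => /negbTE ->.
clearbody g1.
set g2 := [eta g1 with 20 |-> _].
have [g2a g2b] : g2 20 = m * (m <= n) /\ forall x, x != 20 -> g2 x = g1 x.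
  split=> [|x]; last by rewrite /g2 /= => /negbTE ->.
  by rewrite /g2 /= g1a g1b // f0; case: (m <= n); rewrite ?muln1 ?muln0 ?mod0n ?modn_small.
clearbody g2.
rewrite /=; split.
  by split; rewrite ?mod0n // ?g2b // ?g1b.
move=> x; rewrite !inE !negb_or => /and5P[x1 x2 x3 x4 x5].
by rewrite (negbTE x3) (negbTE x4) (negbTE x5) g2b // g1b.
Qed.

Lemma qpost_ok w I f m c s1 s2 s3 : 1 < 2 ^ w -> f 22 = m -> m <= 1 -> f 40 = s1 -> f 41 = s2 -> f 42 = s3 ->
  s2 <= s3 -> s3 < 2 ^ w -> f 101 = c ->
  mrun w I qpost f 0 <> 0 <-> [&& m == 1, s3 - s2 <= c & c <= s1].
Proof.
move=> W1 f22 m1 f40 f41 f42 s23 s3w f101.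
have E (b : bool) : (b == 0 %% 2 ^ w :> nat) = ~~ b by rewrite mod0n; case: b.
rewrite /mrun /qpost; cbn [foldl fst snd mev eval_binop].
set g1 := [eta f with 50 |-> _].
have [g1a g1b] : g1 50 = s3 - s2 /\ forall x, x != 50 -> g1 x = f x.
  split=> [|x]; last by rewrite /g1 /= => /negbTE ->.
  rewrite /g1 /= f41 f42 -addnBAC // modnDr modn_small //.
  by apply: leq_ltn_trans s3w; apply: leq_subr.
clearbody g1.
rewrite /= g1a !g1b // f22 f40 f101 !E -!leqNgt.
case: m m1 {f22} => [|[|//]] _; first by rewrite mul0n mod0n; split.
by rewrite mul1n; do 2 case: (_ <= _); rewrite /= ?mod0n ?(modn_small W1); split.
Qed.

(* Folded, so that arithmetic tactics do not expand the power. *)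
Definition sbig S w : Prop := S ^ 31 <= 2 ^ w.

Section QueryAll.
Variables (w S n : nat) (Df : nat -> nat) (r : rrr).
Hypothesis S0 : 2000 < S.
Hypothesis Sw : sbig S w.
Hypothesis w0 : 0 < w.
Hypothesis H : rrrP n Df r.
Hypothesis n0 : 0 < n.
Hypothesis D1 : forall i, Df i <= 1.
Hypothesis LS : 2 ^ r_L r <= S.
Hypothesis Lw : 10 * r_L r + 1 <= w.
Hypothesis nS : 2000 * n < S.
Notation I := (rrr_bits r).
Notation M := (word_of_bits w I).
Notation bb := (r_bb r).
Notation L := (r_L r).
Notation l := (r_l r).

Lemma qmain_ok m F Post : qenv n r F -> F 20 = m -> m <= n ->
  (forall F', F' 40 = \sum_(x < m) Df x -> F' 41 = \sum_(x < n) Df x ->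
    F' 42 = \sum_(x < n + m) Df x -> F' 22 = F 22 -> Post F') ->
  Qp S I qmain F Post.
Proof.
move=> E Fm mn HP; rewrite /qmain; apply/Qp_cat.
have qe2 F1 F2 : qenv n r F1 -> (forall x, (x < 30) || (39 < x) -> x <> 41 -> F2 x = F1 x) -> qenv n r F2.
  by move=> [[a1 a2 a3 a4] [a5 a6 a7 a8 a9]] h; do !split; rewrite h //; lia.
have qe F' d : 30 < d -> (forall x, (x < 30) || (39 < x) -> x <> d -> F' x = F x) -> qenv n r F'.
  by move=> hd h; case: E => [[a1 a2 a3 a4] [a5 a6 a7 a8 a9]]; do !split; rewrite h //; lia.
apply: (@rank_code_ok w S n Df r S0 Sw w0 H n0 D1 LS Lw nS 20 40 F m _ E isT Fm _ isT); first lia.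
move=> F1 h1 k1; apply/Qp_cat; have E1 := qe F1 40 isT k1.
have F11 : F1 11 = n by case: E1 => -[].
apply: (@rank_code_ok w S n Df r S0 Sw w0 H n0 D1 LS Lw nS 11 41 F1 n _ E1 isT F11 _ isT); first lia.
move=> F2 h2 k2; have E2 := qe2 F1 F2 E1 k2.
have F211 : F2 11 = n by case: E2 => -[].
have F220 : F2 20 = m by rewrite k2 // k1.
split; [by []|rewrite /= F211 F220; lia|].
have E3 : qenv n r (upd F2 21 (ev F2 (fld I) ($11 + $20)%nexp)).
  by case: E2 => [[a1 a2 a3 a4] [a5 a6 a7 a8 a9]].
have F321 : upd F2 21 (ev F2 (fld I) ($11 + $20)%nexp) 21 = n + m by rewrite /= F211 F220.
apply: (@rank_code_ok w S n Df r S0 Sw w0 H n0 D1 LS Lw nS 21 42 _ (n + m) _ E3 isT F321 _ isT); first lia.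
move=> F3 h3 k3; apply: HP; [|
 |exact: h3|].
- by rewrite k3 // -[LHS]/(F2 40) k2 // h1.
- by rewrite k3 // -[LHS]/(F2 41) h2.
- by rewrite k3 // -[LHS]/(F2 22) k2 // k1.
Qed.

Definition header_val := nth 0 [:: L; n; bb; r_P r; l; r_SB r; r_BLK r; r_TAB r; r_CODE r].

Lemma flat_bits0 m : flat (fun=> [:: false]) m = bits m 0.
Proof. by elim: m => // m IH; rewrite flatS IH /bits mkseqS -cats1 div0n. Qed.

Lemma index_hdr : exists q, I = bits L 0 ++ bits 1 1 ++ flat (fun k => bits L (header_val k)) 9 ++ q.
Proof.
exists (flat (sbs r) (r_nsb r) ++ flat (blkr r) (r_nb r) ++
  flat (tabr r) ((bb + 1) * r_P r) ++ flat (coder r) (r_nb r)).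
rewrite /rrr_bits /hdr flat_bits0 -!catA; congr (_ ++ (_ ++ _)).
by rewrite (rp_n H).
Qed.

Lemma n_2L : 800 * n < 2 ^ L. Proof. exact: (q_2L H n0). Qed.

Lemma header_val_lt k : header_val k < 2 ^ L.
Proof.
have h := n_2L; have hC := q_CODE H n0; have b0 := q_bb0 H.
have tC : r_TAB r <= r_CODE r by apply: leq_addr.
have bT : r_BLK r <= r_TAB r by apply: leq_addr.
have sB : r_SB r <= r_BLK r by apply: leq_addr.
have LL : L < 2 ^ L by apply: ltn_expl.
have bL : bb < 2 ^ L by apply: leq_ltn_trans LL; rewrite /r_L; lia.
have PL : r_P r < 2 ^ L by rewrite ltn_exp2l // /r_L; lia.
have lL : l < 2 ^ L.
  apply: leq_ltn_trans LL; have [lg hl ->] := rp_l H; have := lg_le hl; rewrite /r_L; lia.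
rewrite /header_val; do 9 (case: k => [|k] /=; first by lia).
by rewrite nth_nil; lia.
Qed.

Lemma fld_header_val k : k < 9 -> fld I (L + 1 + k * L) L = header_val k.
Proof.
move=> k9; have [q ->] := index_hdr.
have -> : bits L 0 ++ bits 1 1 ++ flat (fun k => bits L (header_val k)) 9 ++ q =
  (bits L 0 ++ bits 1 1) ++ flat (fun k => bits L (header_val k)) 9 ++ q by rewrite catA.
apply: (fld_flat (a := [::]) (b := [::]) _ k9); rewrite ?cats0 ?header_val_lt //.
by rewrite size_cat !size_bits addn0 (size_flat (c := L)) // => *; rewrite size_bits.
Qed.

(** The lowest bits of the header are [L] zeros followed by a one. *)
Lemma fld_word0 : fld I 0 w = 2 ^ L * (2 * fld I (L + 1) (w - (L + 1)) + 1).
Proof.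
have {1}-> : w = L + (1 + (w - (L + 1))) by lia.
rewrite (fld_add I 0 L) (fld_add I (0 + L) 1) !add0n; have [q Eq] := index_hdr.
have -> : fld I 0 L = 0 by rewrite Eq; apply: (@fld_bits [::]); rewrite ?expn_gt0.
have -> : fld I L 1 = 1 by rewrite Eq; apply: fld_bits; rewrite ?size_bits.
by rewrite add0n expn1 addnC.
Qed.

Lemma qhdr_ok xs f p e : uniq xs -> all (fun x => x < 100) xs ->
  f 100 = 2 ^ L -> f 101 = fld I p (size xs * L + e) ->
  let f' := mrun w I (flatten [seq [:: (x, MBin OpMod (MVar 101) (MVar 100));
      (101, MBin OpDiv (MVar 101) (MVar 100))] | x <- xs]) f in
  (forall k, k < size xs -> f' (nth 0 xs k) = fld I (p + k * L) L) /\
  (forall y, y < 100 -> y \notin xs -> f' y = f y).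
Proof.
elim: xs f p => [|x xs IH] f p //= /andP[nx ux] /andP[xl al] f100 f101.
set f2 := [eta _ with 101 |-> _].
have E1 : f2 100 = 2 ^ L by rewrite /f2 /=; case: eqP => // ?; lia.
have E2 : f2 101 = fld I (p + L) (size xs * L + e).
  rewrite /f2 /=; case: eqP => [|_]; first lia.
  case: eqP => [|_]; first lia.
  by rewrite f100 f101 mulSn -addnA fld_div.
have E3 : f2 x = fld I p L.
  rewrite /f2 /=; case: eqP => [|_]; first lia.
  by rewrite eqxx f100 f101 mulSn -addnA fld_mod.
have [h1 h2] := IH f2 (p + L) ux al E1 E2; split=> [[|k] kl|y yl].
- by rewrite /= addn0 [LHS]h2.
- by rewrite /= [LHS]h1 // mulSn addnA.
rewrite inE negb_or => /andP[yx yn]; rewrite [LHS]h2 // /f2 /=.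
by rewrite (negbTE yx); case: eqP => // ?; lia.
Qed.

Lemma query_run m c : m < 2 ^ w -> c < 2 ^ w ->
  mrun w I qall (nth 0 [:: m; c]) 0 <> 0 <->
  [&& m <= n, \sum_(x < n + m) Df x - \sum_(x < n) Df x <= c & c <= \sum_(x < m) Df x].
Proof.
move=> mw cw.
have LL : L < 2 ^ L by apply: ltn_expl.
have L8 : 8 <= L by apply: leq_addl.
have SW : S < 2 ^ w by apply: leq_trans (Sw : S ^ 31 <= 2 ^ w); rewrite -{1}(expn1 S) ltn_exp2l //; lia.
have W1 : 1 < 2 ^ w by lia.
have nL := n_2L.
rewrite /qall (mrun_cat _ _ qpre) (mrun_cat _ _ qhdr) (mrun_cat _ _ qarg) (mrun_cat _ _ (trl qmain)).
set f0 := nth 0 _; set f1 := mrun w I qpre f0.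
have f1v : [/\ f1 100 = 2 ^ L, f1 101 = fld I (L + 1) (w - (L + 1)), f1 0 = m & f1 1 = c].
  rewrite /f1 /qpre /= /eval_binop.
  have -> : word_of_bits w I (0 %% 2 ^ w) = fld I 0 w by rewrite mod0n.
  have vw := fld_lt I 0 w; rewrite (modn_small W1).
  have -> : (fld I 0 w + 2 ^ w - 1) %% 2 ^ w = fld I 0 w - 1.
    rewrite -addnBAC; last first.
      by rewrite fld_word0 muln_gt0 expn_gt0 addn1.
    by rewrite modnDr modn_small //; apply: leq_ltn_trans vw; apply: leq_subr.
  rewrite fld_word0 xor_low (modn_small (m := 2 ^ L.+1)); last by rewrite ltn_exp2l //; lia.
  rewrite (modn_small (m := 2)) ?expnS ?mulKn //; last lia.
  split=> //; rewrite (mulnC 2 (2 ^ L)) divnMl ?expn_gt0 //.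
  by move: (fld I _ _) => y; lia.
have f1e x : x != 100 -> x != 101 -> f1 x = f0 x.
  by move=> /negbTE x1 /negbTE x2; rewrite /f1 /mrun /qpre; cbn [foldl fst snd]; rewrite /= x1 x2.
case: f1v => f1a f1b f1c f1d; clearbody f1.
(* The number of bits of the first word beyond the header. *)
pose e := w - (L + 1) - 9 * L.
have [|h1 h2] := @qhdr_ok (iota 10 9) f1 (L + 1) e isT isT f1a.
  by rewrite f1b size_iota /e; congr (fld _ _ _); lia.
set f2 := mrun w I qhdr f1; rewrite -/(qhdr) -/f2 in h1 h2.
have f2v k : k < 9 -> f2 (10 + k) = header_val k.
  by move=> k9; rewrite -fld_header_val // -h1 ?size_iota // nth_iota.
have f2_0 : f2 0 = m by rewrite h2.
have f2_1 : f2 1 = c by rewrite h2.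
have f211 : f2 11 = n by rewrite (f2v 1).
have f2z x : x < 100 -> 1 < x -> (x < 10) || (18 < x) -> f2 x = 0.
  move=> x1 x2 x3; rewrite h2 //; last by rewrite mem_iota; lia.
  by rewrite f1e ?/f0 ?nth_default //=; apply/eqP; lia.
rewrite -/f2; clearbody f2.
have [[f3_22 f3_20 f3_101 f3_0 f3_1] f3e] := @qarg_ok w I f2 m c n W1 mw f2_0 f2_1 f211.
move: (mrun w I qarg f2) f3_22 f3_20 f3_101 f3_0 f3_1 f3e => f3 f3_22 f3_20 f3_101 f3_0 f3_1 f3e.
have f3v k : k < 9 -> f3 (10 + k) = header_val k.
  by move=> k9; rewrite f3e ?f2v //; do 9 (case: k k9 => [//|k] k9).
have f3z x : x < 100 -> x \notin [:: 22; 20; 101; 0; 1] -> (x < 10) || (18 < x) -> f3 x = 0.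
  move=> xl xn xm; rewrite f3e // f2z //.
  by move: xn; rewrite !inE; case: x {xl xm} => [|[]].
clear h1 h2 f2v f2_0 f2_1 f211 f2z f3e.
have E3 : env S f3 f3.
  move=> x xl; split=> //.
  have [x9|nx] := boolP (9 < x < 19).
    have -> : x = 10 + (x - 10) by lia.
    by rewrite f3v; [apply: leq_trans (header_val_lt _) LS|lia].
  have [|xn] := boolP (x \in [:: 22; 20; 101; 0; 1]); last by rewrite f3z //; lia.
  move=> hx; move: xl; rewrite !inE in hx.
  case/or4P: hx => [|||/orP[]] /eqP -> // _.
  - by rewrite f3_22; case: (m <= n); lia.
  - by rewrite f3_20; case: (leqP m n); rewrite ?muln1 ?muln0; lia.
  - by rewrite f3_0; lia.
  - by rewrite f3_1; lia.
(* For [m > n] the ranks are taken for length 0, and the factor from register 22 makes the answer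
   0. *)
pose m' := m * (m <= n).
have m'n : m' <= n by rewrite /m'; case: leqP => //=; lia.
have Q3' : qenv n r f3.
  split; split; [exact: (f3v 0)|exact: (f3v 1)|exact: (f3v 2)|exact: (f3v 3)|
     exact: (f3v 4)|exact: (f3v 5)|exact: (f3v 6)|exact: (f3v 7)|exact: (f3v 8)].
pose Post (F : nat -> nat) := [/\ F 40 = \sum_(x < m') Df x, F 41 = \sum_(x < n) Df x,
  F 42 = \sum_(x < n + m') Df x & F 22 = f3 22].
have HQ : Qp S I qmain f3 Post.
  by apply: (qmain_ok Q3' f3_20 m'n) => F e1 e2 e3 e4.
have wq : all (fun xe : nat * nexp => (xe.1 < rS) && wfe (fun _ _ => true) xe.2) qmain by [].
have [F' [EF [p1 p2 p3 p4] po]] := Qp_ok S0 (Sw : S ^ 31 <= 2 ^ w) w0 wq E3 HQ.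
move: (mrun w I (trl qmain) f3) EF po => f4 EF po.
have [e40 _] := EF 40 isT; have [e41 _] := EF 41 isT.
have [e42 s42] := EF 42 isT; have [e22 _] := EF 22 isT.
have m1 : (m <= n) <= 1 by case: (m <= n).
have HP := @qpost_ok w I f4 (m <= n) c _ _ _ W1 _ m1 (etrans e40 p1) (etrans e41 p2) (etrans e42 p3).
rewrite HP.
- rewrite /m'; case: (m <= n); by rewrite ?muln1.
- by rewrite e22 p4.
- by apply: sum_mono; apply: leq_addr.
- by rewrite -p3; apply: ltn_trans SW.
- by rewrite po.
Qed.

End QueryAll.

(** * From grammars to machines *)

Section GrammarTree.
Variables (g : nat) (G : grammar g).

Lemma nth_flatten3 (ss : seq (seq nat)) i d : all (fun s => size s == 3) ss -> d < 3 ->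
  nth 0 (flatten ss) (3 * i + d) = nth 0 (nth [::] ss i) d.
Proof.
elim: ss i => [|s ss IH] i /=; first by rewrite !nth_nil.
move=> /andP[/eqP s3 h] d3; rewrite nth_cat s3.
case: i => [|i]; first by rewrite muln0 add0n d3.
have -> : (3 * i.+1 + d < 3) = false by lia.
by rewrite (_ : 3 * i.+1 + d - 3 = 3 * i + d); [apply: IH|lia].
Qed.

Lemma size_encode r : size (@encode_rule g r) = 3.
Proof. by case: r. Qed.

Lemma grammar_memE (X : 'I_g) d : d < 3 ->
  grammar_mem G (3 * X + d) = nth 0 (encode_rule (rhs G X)) d.
Proof.
move=> d3; rewrite /grammar_mem nth_flatten3 //; last first.
  by apply/allP => s /mapP[Y _ ->]; rewrite size_encode.
by rewrite (nth_map X) ?size_enum_ord // nth_ord_enum.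
Qed.

Lemma grammar_mem_out i : 3 * g <= i -> grammar_mem G i = 0.
Proof.
move=> h; rewrite /grammar_mem nth_default // size_flatten /shape -map_comp.
rewrite (eq_map (g := fun=> 3)); last by move=> X /=; rewrite size_encode.
by rewrite sumnE big_map big_const_seq count_predT size_enum_ord iter_addn addn0.
Qed.

Lemma grammar_mem_lt i : grammar_mem G i < g + 2.
Proof.
have [h|h] := leqP (3 * g) i; first by rewrite grammar_mem_out // addn2.
have hX : i %/ 3 < g by rewrite ltn_divLR // mulnC.
have -> : i = 3 * Ordinal hX + i %% 3 by rewrite mulnC -divn_eq.
rewrite grammar_memE ?ltn_mod //; move: (i %% 3) (ltn_mod i 3) => d.
case: (rhs G _) => [b|X Y] /=; case: d => [|[|[|]]] //= _; try by rewrite addn2.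
- by case: b; rewrite addn2.
- by rewrite ltn_addr.
- by rewrite ltn_addr.
Qed.

(** Derivability expressed by a forest with one parse tree for each nonterminal of the sentential
    form. *)
Fixpoint der (u : sform g) (s : seq bool) : Prop := match u with
  | [::] => s = [::]
  | inl b :: u' => exists2 s', s = b :: s' & der u' s'
  | inr X :: u' => exists t s', [/\ s = yield t ++ s', wft (grammar_mem G) g t, root t = X & der u' s']
  end.

Lemma der_cat u v s : der (u ++ v) s <-> exists s1 s2, [/\ s = s1 ++ s2, der u s1 & der v s2].
Proof.
elim: u s => [|[b|X] u IH] s /=.
- by split=> [h|[s1 [s2 [-> -> h]]]] //; exists [::], s.
- split=> [[s' -> /IH[s1 [s2 [-> h1 h2]]]]|[s1 [s2 [-> [s' -> h1] h2]]]].
    by exists (b :: s1), s2; split=> //; exists s1.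
  by exists (s' ++ s2) => //; apply/IH; exists s', s2.
- split=> [[t [s' [-> h3 h4 /IH[s1 [s2 [-> h1 h2]]]]]]|[s1 [s2 [-> [t [s' [-> h3 h4 h1]]] h2]]]].
    by exists (yield t ++ s1), s2; split; [rewrite catA| exists t, s1|].
  by exists t, (s' ++ s2); rewrite catA; split=> //; apply/IH; exists s', s2.
Qed.

(** The trees that belong to the right-hand side of the rule become the children of a new node for
    [X]. *)
Lemma der_rewrites u v s : rewrites G u v -> der v s -> der u s.
Proof.
case=> {u v} u v X /der_cat[s1 [s2 [-> h1 /der_cat[s3 [s4 [-> h3 h4]]]]]].
apply/der_cat; exists s1, (s3 ++ s4); split=> //=.
have e0 : grammar_mem G (3 * X) = nth 0 (encode_rule (rhs G X)) 0.
  by rewrite -(@grammar_memE X 0) // addn0.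
have e1 := @grammar_memE X 1 isT; have e2 := @grammar_memE X 2 isT.
case: (rhs G X) e0 e1 e2 h3 => [b|Y Z] /= e0 e1 e2.
  by case=> s' -> ->; exists (Lf X b), s4.
case=> t1 [s' [-> w1 r1 [t2 [s'' [-> w2 r2 ->]]]]].
exists (Nd X t1 t2), s4; split=> //=; first by rewrite cats0.
by split=> //; split; rewrite ?r1 ?r2.
Qed.

(** The forest is built backwards along the derivation, starting from the terminal string, so the
    order of the rewriting steps does not matter. *)
Lemma generates_tree (s : seq bool) : generates G s ->
  exists t, [/\ wft (grammar_mem G) g t, root t = start G & yield t = s].
Proof.
rewrite /generates => h.
suff [t [s' [-> wt rt ->]]] : der [:: inr (start G)] s by exists t; rewrite cats0.
have : der (map inl s) s by elim: {h} s => //= b s IH; exists s.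
by elim: h => // u v x r _ IH /IH; apply: der_rewrites.
Qed.

End GrammarTree.

(** * The word size and the bound [S] *)

Lemma pow_word a U w : 0 < a -> 1 < U -> U ^ (a * a) <= 2 ^ w -> U ^ a.-1 <= 2 ^ (w %/ a).
Proof.
move=> a0 U1 h.
(* Comparing [a]-th powers gives [U ^ a < 2 ^ (w / a + 1)]; one factor [U >= 2] is then given up for
   the rounding in [w / a]. *)
have : (U ^ a) ^ a < (2 ^ (w %/ a).+1) ^ a.
  rewrite -!expnM; apply: leq_ltn_trans h _; rewrite ltn_exp2l //.
  by rewrite {1}(divn_eq w a) mulSn addnC ltn_add2r ltn_mod.
rewrite ltn_exp2r // expnS -{1}(prednK a0) expnS => h2.
have : 2 * U ^ a.-1 < 2 * 2 ^ (w %/ a) by apply: leq_ltn_trans h2; rewrite leq_mul2r U1 orbT.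
by rewrite ltn_pmul2l // => /ltnW.
Qed.

(** One factor 32 divides the memory into 32 arrays, the other leaves
    [(n + g) ^ 31 <= 2 ^ (w / 32)], from which all bounds by [S] follow. *)
Definition wide n g w : Prop := (n + g) ^ (32 * 32) <= 2 ^ w.

Definition sbig32 S w : Prop := S ^ 32 <= 2 ^ w.

Section Params.
Variables (n g w : nat).
Hypothesis n0 : 0 < n.
Hypothesis g0 : 0 < g.
Hypothesis Uw : wide n g w.
Notation U := (n + g).
Notation S := (2 ^ (w %/ 32)).

Let U2 : 1 < U. Proof. by rewrite -[2]/(1 + 1) leq_add. Qed.

Lemma par_pow m : m <= 31 -> U ^ m <= S.
Proof. by move=> h; apply: leq_trans (pow_word _ U2 Uw) => //; rewrite leq_exp2l. Qed.

Lemma par_pow2 c m : c + m <= 31 -> 2 ^ c * U ^ m <= S.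
Proof.
move=> h; apply: leq_trans (par_pow h); rewrite expnD leq_mul2r.
by case: c {h} => [|c]; rewrite ?expn0 ?leq_exp2r ?U2 ?orbT //.
Qed.

Lemma par_U3 : 2000 * ((n + 1) * (n + 1) * (n + 1)) + 2000 < S.
Proof.
have := @par_pow2 12 3 isT; apply: leq_trans.
have U3 : (n + 1) * (n + 1) * (n + 1) <= U ^ 3.
  by rewrite !expnSr expn0 mul1n; do !apply: leq_mul; rewrite leq_add2l.
have U1 : 0 < U ^ 3 by rewrite expn_gt0 ltnW.
rewrite -[2 ^ 12]/4096; move: U3 U1; move: (_ * _ * _) (U ^ 3) => x y; lia.
Qed.

Lemma par_g : 3 * g + 2 < S.
Proof.
have := @par_pow2 12 1 isT; rewrite expn1 -[2 ^ 12]/4096; move: S => s; lia.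
Qed.

Lemma par_n : 2000 * n < S.
Proof.
have := @par_pow2 12 1 isT; rewrite expn1 -[2 ^ 12]/4096; move: S => s; lia.
Qed.

Lemma par_S0 : 2000 < S.
Proof. by have := par_n; move: n0; move: S => s; lia. Qed.

Lemma par_S32 : S ^ 32 <= 2 ^ w.
Proof. by rewrite -expnM leq_exp2l // leq_trunc_div. Qed.

Lemma par_q : 31 <= w %/ 32.
Proof.
have pw c : c <= 31 -> c <= w %/ 32.
  move=> c31; have := @par_pow2 c 0; rewrite addn0 expn0 muln1 leq_exp2l //; exact.
exact: pw.
Qed.

Lemma par_w : w < S.
Proof.
have q31 := par_q; have E := divn_eq w 32; have r32 := ltn_pmod w (isT : 0 < 32).
move: (w %/ 32) (w %% 32) q31 E r32 => q r q31 -> r32.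
rewrite -(subnKC (leq_trans (isT : 10 <= 31) q31)) expnD -[2 ^ 10]/1024.
have := ltn_expl (q - 10) (isT : 1 < 2); move: (2 ^ (q - 10)) => e; lia.
Qed.

(** [2 ^ (8 * bb)] is the square of the fourth power of [2 ^ bb], hence at most [(16 * n) ^ 2]. *)
Lemma par_L bb : bbspec n bb -> 2 ^ (8 * bb + 8) <= S.
Proof.
move=> hb; have P4 := P4_le hb.
have h : 2 ^ (8 * bb + 8) <= 2 ^ 16 * U ^ 2.
  rewrite expnD (_ : 8 * bb = bb * 4 * 2); last lia.
  rewrite !expnM (_ : 2 ^ 16 * U ^ 2 = (16 * U) ^ 2 * 2 ^ 8).
    rewrite leq_mul2r leq_exp2r // orbC; apply/orP; left.
    by apply: leq_trans P4 _; rewrite leq_mul2l leq_addr orbT.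
  by rewrite (expnD 2 8 8) expnMn (_ : 16 ^ 2 = 2 ^ 8) // [RHS]mulnAC.
by apply: leq_trans h _; apply: par_pow2.
Qed.

Lemma par_Lw bb : bbspec n bb -> 10 * (8 * bb + 8) + 1 <= w.
Proof.
move=> /par_L; rewrite leq_exp2l // => h; have q31 := par_q.
apply: leq_trans (leq_trunc_div w 32); move: h q31; move: (w %/ 32) => q; lia.
Qed.
End Params.

(* The stride 2 ^ (w / 32) leaves room for 32 arrays. *)
Definition build_main : mcmd :=
  MSeq (MAsg 100 (MBin OpShl (MCst 1) (MBin OpDiv MWs (MCst 32))))
  (MSeq (trc build_cmd)
  (MSeq (MAsg 0 (MBin OpMul (MCst 31) (MVar 100))) (MAsg 1 (MVar 101)))).

Lemma wfc_build : wfc build_cmd. Proof. by vm_compute. Qed.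
Lemma mcwf_build : mcwf build_main.
Proof.
have mseqE a b : mcwf a -> mcwf b -> mcwf (MSeq a b) by move=> /= -> ->.
by apply: mseqE => //; apply: mseqE => //; apply: trc_wf; apply: wfc_build.
Qed.
Lemma mcwf_query : mcwf (mseq qall). Proof. by vm_compute. Qed.

Definition build_prog := cmpl 0 build_main.
Definition query_prog := cmpl 0 (mseq qall).

Section Main.
Variables (n g w : nat) (B : seq bool) (G : grammar g).
Hypothesis GB : generates G B.
Hypothesis Bn : size B = n.
Hypothesis Uw : wide n g w.

Lemma yield_gt0 t : 0 < size (yield t).
Proof. by elim: t => //= X l IHl r IHr; rewrite size_cat ltn_addr. Qed.

Lemma par_n0 : 0 < n.
Proof. by have [t [_ _ E]] := generates_tree GB; rewrite -Bn -E yield_gt0. Qed.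

Lemma par_g0 : 0 < g. Proof. exact: leq_ltn_trans (ltn_ord (start G)). Qed.

Lemma build_ok : exists tm b k T M1 M0 r s,
  [/\ tm <= (2 * build_cost n b k T + 3) * size build_prog,
      bspec g n b,
      [/\ k * b <= 2 * n + b, k <= n, T <= g & T <= k],
      winPf B M1 M0 /\ rrrP n (Dfun n M1 M0) r
    & halts_within w build_prog tm (init_grammar G) s /\ outputs_bits w s (rrr_bits r)].
Proof.
have n0 := par_n0; have g0 := par_g0.
pose S := 2 ^ (w %/ 32).
have S0 : 2000 < S := par_S0 n0 g0 Uw.
have Sg : 3 * g + 2 < S := par_g n0 g0 Uw.
have S3 : 2000 * ((n + 1) * (n + 1) * (n + 1)) + 2000 < S := par_U3 n0 g0 Uw.
have Sw : sbig32 S w := par_S32 w.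
have wS : w < S := par_w n0 g0 Uw.
have w31 := par_q n0 g0 Uw.
have w0 : 0 < w by case: (w) w31.
have S32w : 32 * S < 2 ^ w.
  apply: (@leq_trans (S ^ 2)).
    by rewrite expnS expn1 ltn_mul2r; apply/andP; split; lia.
  apply: leq_trans (Sw : S ^ 32 <= 2 ^ w).
  have S1 : 1 < S by lia.
  by rewrite (leq_exp2l 2 32 S1).
have [t [wt rt yt]] := generates_tree GB.
pose s0 := St (nth 0 [:: g; nat_of_ord (start G)]) (fun j => if j is 0 then grammar_mem G else fun=> 0) [::].
have S3' : 2000 * ((size (yield t) + 1) * (size (yield t) + 1) * (size (yield t) + 1)) + 2000 < S.
  by rewrite yt Bn.
have Sg' : 3 * g < S by apply: leq_ltn_trans Sg; apply: leq_addr.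
have z0 j i : 0 < j -> A s0 j i = 0 by case: j.
have [tm [s' [b [k [T [M1 [M0 [r [[X tml] [hb n0'] hk hW [hr hO]]]]]]]]]] :=
  build_spec (s := s0) Sg' S3' wt erefl (esym rt) erefl z0 erefl.
rewrite yt Bn in tml hb n0' hk hW hr; clear S3' S3.
have Sexp : (1 * 2 ^ (w %/ 32)) %% 2 ^ w = S.
  by rewrite mul1n modn_small // -/S; lia.
pose f1 := [eta nth 0 [:: g; nat_of_ord (start G)] with 100 |-> S].
(* The grammar ends at [3 * g < S], inside array 0, so all other arrays and the output area start
   out as 0. *)
have sim0 : sim w S s0 f1 (grammar_mem G).
  split=> //.
  - move=> x xl; rewrite /f1 /=; case: eqP => [E|_]; first by rewrite E in xl.
    split=> //; case: x xl => [|[|x]] _ /=; try lia; last by rewrite nth_nil; lia.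
    by apply: ltn_trans (ltn_ord _) _; lia.
  - case=> [|j] i jl iS /=.
      split; first by rewrite mul0n.
      by apply: leq_trans (grammar_mem_lt G i) _; lia.
    split; last by lia.
    by rewrite grammar_mem_out //; apply: (@leq_trans S); [lia|rewrite mulSn -addnA leq_addr].
  - move=> a aS /=; rewrite grammar_mem_out; last first.
      by apply: (@leq_trans S); [lia|rewrite -[31]/(30.+1) mulSn -addnA leq_addr].
    by rewrite /word_of_bits big1 // => i _; rewrite nth_nil.
  - by rewrite /=; lia.
have [t' [f' [M' [X' tl' sim']]]] := sim_exec S0 Sw wS w0 X wfc_build sim0.
have E1 : mev w (nth 0 [:: g; nat_of_ord (start G)]) (grammar_mem G)
   (MBin OpShl (MCst 1) (MBin OpDiv MWs (MCst 32))) = S.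
  have W32 : 32 < 2 ^ w by lia.
  by rewrite /= (modn_small W32) (modn_small (m := 1)) //; lia.
pose f2 := [eta f' with 0 |-> mev w f' M' (MBin OpMul (MCst 31) (MVar 100))].
pose f3 := [eta f2 with 1 |-> mev w f2 M' (MVar 101)].
have XX : mexec w build_main (nth 0 [:: g; nat_of_ord (start G)]) (grammar_mem G)
    (1 + (t' + (1 + 1))) f3 M'.
  apply: MXSeq; first by apply: MXAsg.
  rewrite E1; apply: MXSeq; first exact: X'.
  by apply: MXSeq; apply: MXAsg.
have [t3 [f4 [t3l hh fe]]] := mprog_ok XX mcwf_build.
have f40 : f4 0 = 31 * S.
  rewrite -fe // /f3 /f2 /= (sim_S sim') (modn_small (m := 31)); last lia.
  by rewrite modn_small //; lia.
have f41 : f4 1 = size (rrr_bits r) by rewrite -fe // /f3 /f2 /= (sim_P sim') hO.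
have szS := sim_size sim'; rewrite hO in szS.
have aS a : a * w < size (rrr_bits r) -> a < S.
  by move=> h; apply: leq_ltn_trans (ltn_trans h szS); apply: leq_pmulr.
exists t3, b, k, T, M1, M0, r, (State (size build_prog) f4 M').
split=> //; first last.
  split; first exact: hh.
  split=> //= a /aS h; rewrite f40; first by lia.
  by rewrite (sim_O sim' h) hO.
by apply: leq_trans t3l _; rewrite leq_mul2r; apply/orP; right; lia.
Qed.

Definition query_time := size qall * size query_prog.

Lemma query_ok M1 M0 r m c : winPf B M1 M0 -> rrrP n (Dfun n M1 M0) r -> m < 2 ^ w -> c < 2 ^ w ->
  exists s, [/\ halts_within w query_prog query_time (init_query w (rrr_bits r) m c) s,
    ram s =1 word_of_bits w (rrr_bits r) & reg s 0 <> 0 <-> jumbled_occurs B m c].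
Proof.
move=> hW hr mw cw; have n0 := par_n0; have g0 := par_g0.
have X := mseq_ok w (rrr_bits r) qall (nth 0 [:: m; c]).
have [t' [f' [tl hh fe]]] := mprog_ok X mcwf_query.
eexists; split; first exact: halts_mono hh tl.
  by [].
rewrite /= -fe // (jumbled_range _ _ hW) Bn.
pose S := 2 ^ (w %/ 32).
have S0 : 2000 < S := par_S0 n0 g0 Uw.
have S1 : 1 < S by lia.
have Sw : sbig S w.
  by rewrite /sbig; apply: leq_trans (par_S32 w); rewrite (leq_exp2l 31 32 S1).
have w31 := par_q n0 g0 Uw.
have w0 : 0 < w by case: (w) w31.
have D1 i : Dfun n M1 M0 i <= 1 by rewrite -Bn; apply: Dfun_le1 hW i.
have hb := rp_bb hr.
rewrite (query_run S0 Sw w0 hr n0 D1 (par_L n0 g0 Uw hb) (par_Lw n0 g0 Uw hb) (par_n n0 g0 Uw)) //.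
case: leqP => //= mn.
have D s : s <= n -> \sum_(x < s) Dfun n M1 M0 x = M1 s.
  by rewrite -Bn; apply: Dfun_sum1 hW s.
have D2 : \sum_(x < n + m) Dfun n M1 M0 x = M1 n + (m - M0 m).
  by move: mn; rewrite -Bn; apply: (Dfun_sum2 hW).
by rewrite D2 !D // addKn.
Qed.
End Main.

(** * Time and space bounds *)

Section Time.
Variables (n g b k T : nat).
Hypothesis n0 : 0 < n.
Hypothesis g0 : 0 < g.
Hypothesis hb : bspec g n b.
Hypothesis kb : k * b <= 2 * n + b.
Hypothesis kn : k <= n.
Hypothesis Tg : T <= g.
Hypothesis Tk : T <= k.

(** Cubes keep the comparison with [g ^ (2/3) * n ^ (4/3)] in the integers; [powR_cube] extracts the
    roots at the end. *)
Lemma cube_length : n ^ 3 <= g ^ 2 * n ^ 4.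
Proof. by rewrite (expnS n 3) mulnA leq_pmull // muln_gt0 expn_gt0 g0. Qed.

(* T <= g and b^3 g^2 = O(n^2) give T^6 b^6 <= g^2 (g^2 b^3)^2 = O(g^2 n^4). *)
Lemma cube_types : (T * T * ((b + 1) * (b + 1))) ^ 3 <= 16 ^ 3 * (g ^ 2 * n ^ 4).
Proof.
have -> : (T * T * ((b + 1) * (b + 1))) ^ 3 = T ^ 2 * (T ^ 4 * (b + 1) ^ 6).
  by rewrite !expnS !expn0; move: (b + 1) => c; lia.
have -> : 16 ^ 3 * (g ^ 2 * n ^ 4) = g ^ 2 * (16 ^ 3 * n ^ 4) by rewrite mulnCA.
apply: leq_mul; first by rewrite leq_exp2r.
(* The choice of [b] bounds only [b - 1] from above. For [b >= 2] one has [b + 1 <= 4 * (b - 1)];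
   for [b = 1] the bound [T <= k <= n] takes over. *)
have [->|[b2 h]] : b = 1 \/ 1 < b /\ (b - 1) * (b - 1) * (b - 1) * g * g < n * n.
  by case: hb => b0 _ []; [left|case: (leqP b 1) => [b1 _|]; [left; lia|right]].
  rewrite mulnC; apply: leq_mul; first by [].
  by rewrite leq_exp2r // (leq_trans Tk).
apply: (@leq_trans (g ^ 4 * (4 * (b - 1)) ^ 6)).
  apply: leq_mul; first by rewrite leq_exp2r.
  by rewrite leq_exp2r //; lia.
have -> : g ^ 4 * (4 * (b - 1)) ^ 6 = 4 ^ 6 * ((b - 1) * (b - 1) * (b - 1) * g * g) ^ 2.
  by rewrite expnMn mulnCA; congr (_ * _); rewrite !expnS !expn0; move: (b - 1) => c; lia.
have -> : 16 ^ 3 * n ^ 4 = 4 ^ 6 * (n * n) ^ 2.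
  by congr (_ * _); rewrite !expnS !expn0; lia.
by rewrite leq_pmul2l // leq_exp2r // ltnW.
Qed.

(* k b = O(n) and n^2 <= b^3 g^2 give k^6 b^6 = O(n^6) = O(n^4 b^3 g^2). *)
Lemma cube_pairs : (k * k * b) ^ 3 <= 9 ^ 3 * (g ^ 2 * n ^ 4).
Proof.
have bn := bspec_le g0 n0 hb; case: hb => b0 h _.
have b3 : 0 < b ^ 3 by rewrite expn_gt0 b0.
rewrite -(leq_pmul2r b3).
have -> : (k * k * b) ^ 3 * b ^ 3 = (k * b) ^ 6 by rewrite !expnS !expn0; lia.
apply: (@leq_trans ((3 * n) ^ 6)); first by rewrite leq_exp2r //; lia.
have -> : (3 * n) ^ 6 = 9 ^ 3 * n ^ 4 * (n * n) by rewrite expnMn -mulnA; congr (_ * _); rewrite !expnS !expn0; lia.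
have -> : 9 ^ 3 * (g ^ 2 * n ^ 4) * b ^ 3 = 9 ^ 3 * n ^ 4 * (b * b * b * g * g).
  by rewrite -!mulnA; congr (_ * _); rewrite !expnS !expn0; lia.
by rewrite leq_mul2l h orbT.
Qed.
End Time.

(** A closed form of what the construction finds by search; it makes the lower-order term a function
    of [n] alone. *)
Definition block_len n := (trunc_log 16 n).+1.
Definition block_len_bits n := (trunc_log 2 (block_len n)).+1.
(* Bounds all of the index but the codes of the complete blocks, with one bit to
   spare per block for rounding up their widths. *)
Definition overhead n := let r := RRR n (block_len n) (2 * block_len_bits n) id id id id id id in
  r_CODE r + r_nb r + r_bb r.

Lemma bbspec_block_len n : 0 < n -> bbspec n (block_len n).
Proof. by move=> n0; split=> //; rewrite subn1; apply: (@trunc_log_bounds 16 n). Qed.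
Lemma lgspec_block_len_bits n : lgspec (block_len n) (block_len_bits n).
Proof. by split=> //; rewrite subn1; apply: (@trunc_log_bounds 2 (block_len n)). Qed.
Lemma bbspec_uniq n bb : bbspec n bb -> bb = block_len n.
Proof.
by case=> b0; rewrite subn1 -{2}(prednK b0) => h; rewrite /block_len (trunc_log_eq _ h) // prednK.
Qed.
Lemma lgspec_uniq bb lg : lgspec bb lg -> lg = (trunc_log 2 bb).+1.
Proof.
by case=> b0; rewrite subn1 -{2}(prednK b0) => h; rewrite (trunc_log_eq _ h) // prednK.
Qed.

(** There are O(n / bb^2) superblocks of O(bb) bits and O(n / bb) blocks of O(lg) bits, and the
    decoding table times [bb] is O(P^4 lg) with [P^4 = O(n)]. So the overhead is O(n lg / bb). *)
Lemma overhead_bb n : 0 < n -> overhead n * block_len n <= 3300 * (n * block_len_bits n).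
Proof.
move=> n0; have hb := bbspec_block_len n0; have hl := lgspec_block_len_bits n.
rewrite /overhead; move: (block_len n) (block_len_bits n) hb hl => bb lg hb hl.
have bn := bb_le hb; have lb := lg_le hl; have P4 := P4_le hb.
have b0 : 0 < bb by case: hb.
have l0 : 0 < lg by case: hl.
rewrite /r_CODE /r_TAB /r_BLK /r_SB /r_nsb /r_nb /r_L /r_P /= addnK.
set q := (2 * n) %/ bb; set P := 2 ^ bb in P4 *.
have bP : bb + 1 <= P by rewrite addn1; apply: ltn_expl.
have qb : q * bb <= 2 * n by rewrite leq_trunc_div.
have qq : q %/ bb * bb <= q by rewrite leq_trunc_div.
have P4' : P * P * (P * P) <= 16 * n by move: P4; rewrite !expnS expn0 muln1 !mulnA.
have P2 : P * P <= 16 * n by apply: leq_trans P4'; rewrite leq_pmulr // muln_gt0 andbb; lia.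
have bb2 : bb * bb <= 16 * n by apply: leq_trans P2; apply: leq_mul; lia.
have nl : n <= n * lg by rewrite leq_pmulr.
have T1 : (q %/ bb + 1) * (2 * (8 * bb + 8)) * bb <= 64 * n + 512 * n.
  apply: (@leq_trans ((q %/ bb + 1) * (32 * bb) * bb)).
    by rewrite leq_mul2r leq_mul2l; apply/orP; right; apply/orP; right; lia.
  have -> : (q %/ bb + 1) * (32 * bb) * bb = 32 * (q %/ bb * bb * bb) + 32 * (bb * bb) by lia.
  have : q %/ bb * bb * bb <= 2 * n by apply: leq_trans qb; rewrite leq_mul2r qq orbT.
  by move: (_ * _ * _) bb2 => z; lia.
have T2 : (q + 1) * (4 * (2 * lg)) * bb <= 24 * (n * lg).
  have -> : (q + 1) * (4 * (2 * lg)) * bb = 8 * lg * (q * bb + bb) by lia.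
  have -> : 24 * (n * lg) = 8 * lg * (3 * n) by lia.
  by rewrite leq_mul2l; apply/orP; right; lia.
have T3 : (bb + 1) * P * ((bb + 1) * (2 * lg)) * bb <= 32 * (n * lg).
  have -> : (bb + 1) * P * ((bb + 1) * (2 * lg)) * bb = 2 * lg * (P * (bb + 1) * ((bb + 1) * bb)) by lia.
  have -> : 32 * (n * lg) = 2 * lg * (16 * n) by lia.
  rewrite leq_mul2l; apply/orP; right; apply: leq_trans P4'.
  by apply: leq_mul; apply: leq_mul => //; lia.
have T4 : (10 * (8 * bb + 8) + 1) * bb <= 2576 * n.
  apply: (@leq_trans (161 * bb * bb)); first by rewrite leq_mul2r; apply/orP; right; lia.
  by rewrite -mulnA; lia.
rewrite !mulnDl; move: T1 T2 T3 T4; rewrite !mulnDl.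
have T5 : q * bb + 1 * bb + bb * bb <= 19 * n by lia.
move: nl T5; clear.
move: (_ * lg) (q * bb + _) => x y.
rewrite -!mulnDl.
move: (_ * bb) => z.
lia.
Qed.

Lemma sq_exp m : m * m <= 8 * 2 ^ m.
Proof.
elim: m => // m IH; rewrite expnS; case: (leqP m 2) => m2; last by nia.
by case: m m2 IH => [|[|[|]]].
Qed.

(** [bb >= 2 ^ (lg - 1) >= lg^2 / 16] turns the factor [lg / bb] into [16 / lg]; for o(n) it is then
    enough that [lg] is unbounded. *)
Lemma overhead_lg n : 0 < n -> overhead n * block_len_bits n <= 3300 * (n * 16).
Proof.
move=> n0; have h := overhead_bb n0; have [b0 _] := bbspec_block_len n0.
have [l0 /andP[hl _]] := lgspec_block_len_bits n.
have l2 : block_len_bits n * block_len_bits n <= 16 * block_len n.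
  apply: leq_trans (sq_exp _) _; rewrite -(subnK l0) addn1 expnS mulnA.
  by rewrite leq_pmul2l.
rewrite -(leq_pmul2r b0) mulnAC.
apply: leq_trans (leq_mul h (leqnn _)) _.
by move: l2; move: (block_len n) (block_len_bits n) => x y l2; nia.
Qed.

Lemma block_len_bits_large M n : 16 ^ 2 ^ M <= n -> M < block_len_bits n.
Proof.
move=> h; rewrite ltnNge; apply/negP => lM.
have n0 : 0 < n by apply: leq_trans h; rewrite expn_gt0.
have [_ /andP[_ hb]] := bbspec_block_len n0; have [_ /andP[_ hl]] := lgspec_block_len_bits n.
move: h; apply/negP; rewrite -ltnNge; apply: leq_trans hb _.
by rewrite leq_exp2l //; apply: leq_trans (ltnW hl) _; rewrite leq_exp2l.
Qed.

(** * Ones, zeros and code widths in the complete blocks *)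

Section Counts.
Variables (B : seq bool) (M1 M0 : nat -> nat) (r : rrr).
Notation n := (size B).
Notation Df := (Dfun n M1 M0).
Hypothesis H : winPf B M1 M0.
Hypothesis hr : rrrP n Df r.
Notation bb := (r_bb r).
Notation F := ((2 * n) %/ bb).
Notation n1 := (count_mem true B).

(** The only window of full length is [B] itself, so maximum and minimum coincide. *)
Lemma win_M1n : M1 n = n1 /\ n - M0 n = n1.
Proof.
have [/(_ 0 (leqnn n)) [h3 h4] [[i [i1 h1]] [j [j1 h2]]]] := H (leqnn n).
have E x : x + n <= n -> win B x n = n1.
  by move=> h; rewrite winE (_ : x = 0) ?drop0 ?take_size //; lia.
have le : n1 <= n := count_size (pred1 true) B.
move: h1 h2 h3 h4; rewrite !E // => h1 h2 h3 h4; move: le h1 h2 h3 h4; move: n1 n (M1 n) (M0 n) => a c d e.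
by split; lia.
Qed.

(** Each half of D sums to the number of ones of [B], so D has [2 * n1] ones, and the complete
    blocks cover a prefix of D. *)
Lemma count_blocks : \sum_(i < F) r_KK r i <= 2 * n1 /\ \sum_(i < F) (bb - r_KK r i) <= 2 * (n - n1).
Proof.
have D1 i : Df i <= 1 by apply: Dfun_le1 H i.
have b0 : 0 < bb by case: (rp_bb hr).
have nbF : r_nb r = F + 1 by rewrite /r_nb (rp_n hr).
have EK i : i < F -> r_KK r i = \sum_(j < bb) Df (i * bb + j).
  by move=> iF; rewrite (rp_KK hr) ?pref_blk // nbF addn1 ltnS ltnW.
have K1 : \sum_(i < F) r_KK r i = \sum_(x < F * bb) Df x.
  rewrite -[F * bb]addn0 -sum_blocks big_ord0 addn0.
  by apply: eq_bigr => i _; apply: EK.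
have Kb i : i < F -> r_KK r i <= bb.
  by move=> iF; rewrite (rp_KK hr) ?pref_le // nbF addn1 ltnS ltnW.
have K0 : \sum_(i < F) (bb - r_KK r i) + \sum_(i < F) r_KK r i = F * bb.
  rewrite -big_split /= -[in RHS](card_ord F) -sum_nat_const.
  by apply: eq_bigr => i _; rewrite subnK // Kb.
have le : n1 <= n := count_size (pred1 true) B.
have S2 : \sum_(x < 2 * n) Df x = 2 * n1.
  have [e1 e2] := win_M1n.
  by rewrite mul2n -addnn (Dfun_sum2 H) // e1 e2 mul2n addnn.
have Fb : F * bb <= 2 * n by apply: leq_trunc_div.
(* The tail outside the complete blocks has no more ones than positions; this is what bounds the
   zeros of the complete blocks. *)
have T : \sum_(x < 2 * n) Df x <= \sum_(x < F * bb) Df x + (2 * n - F * bb).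
  have Tg a c : \sum_(x < a + c) Df x <= \sum_(x < a) Df x + c.
    rewrite big_split_ord leq_add2l -[leqRHS]muln1 -[in leqRHS](card_ord c) -sum_nat_const.
    exact: leq_sum.
  by have := Tg (F * bb) (2 * n - F * bb); rewrite subnKC.
split; first by rewrite K1 -S2; apply: sum_mono.
move: T K0 Fb le; rewrite -K1 S2; move: (F * bb) n1 n (\sum_(_ < _) r_KK r _) (\sum_(_ < _) (_ - _)).
clear; move=> fb c m x y; lia.
Qed.

(** By minimality of the width. For width 0 the class must be nonempty, which holds because the code
    of the block is below its size. *)
Lemma W_bound i : i < F -> 2 ^ r_WW r i <= 2 * cntk bb (2 ^ bb) (r_KK r i).
Proof.
have nbF : r_nb r = F + 1 by rewrite /r_nb (rp_n hr).
move=> iF; have ib : i < r_nb r by rewrite nbF addn1 ltnS ltnW.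
have [[_ h] _] := rp_WW hr ib; have o := rp_OF hr ib; rewrite /r_P in h o.
move: h o; move: (cntk _ _ _) (r_WW r i) (r_OF r i) => N W q.
case=> [->|h] hq; first by rewrite expn0; lia.
by case: W h => [|W]; rewrite ?expn0 ?subn1 /= ?expnS; lia.
Qed.

Lemma size_bound : size (rrr_bits r) + F <= overhead n + \sum_(i < F) r_WW r i.
Proof.
have nbF : r_nb r = F + 1 by rewrite /r_nb (rp_n hr).
rewrite size_index; have [lg hl El] := rp_l hr; have hb := rp_bb hr.
have -> : \sum_(i < r_nb r) r_WW r i = \sum_(i < F) r_WW r i + r_WW r F.
  by rewrite nbF addn1 big_ord_recr.
have hW : r_WW r F <= bb by have [_] := rp_WW hr (i := F) ltac:(by rewrite nbF addn1).
have -> : overhead n = r_CODE r + r_nb r + bb.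
  rewrite /overhead /block_len_bits -(bbspec_uniq hb) -(lgspec_uniq hl) -El.
  by rewrite /r_CODE /r_TAB /r_BLK /r_SB /r_nsb /r_nb /r_L /r_P /= (rp_n hr).
rewrite nbF; move: hW; move: F (\sum_(_ < _) _) (r_CODE r) => f a c; lia.
Qed.
End Counts.

From mathcomp Require Import all_order all_algebra.
From mathcomp Require Import all_classical all_reals all_analysis.
From mathcomp Require Import ring lra.
Import Order.TTheory GRing.Theory Num.Theory.
Import numFieldNormedType.Exports.
Local Open Scope classical_set_scope.
Local Open Scope ring_scope.

(** * The entropy bound and the final estimates *)

Section Entropy.
Variable R : realType.

Lemma sum_double (f : nat -> R) m :
  \sum_(y < (2 * m)%N) f y = \sum_(y < m) (f (2 * y)%N + f (2 * y + 1)%N).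
Proof.
elim: m => [|m IH]; first by rewrite muln0 !big_ord0.
by rewrite mulnSr addn2 !big_ord_recr /= IH -addrA addn1.
Qed.

(** The total probability of the strings of [b] independent bits, each 1 with probability [p]. *)
Lemma weight_sum (p q : R) b : p + q = 1 ->
  \sum_(y < (2 ^ b)%N) p ^+ pref y b * q ^+ (b - pref y b) = 1.
Proof.
move=> pq; elim: b => [|b IH].
  by rewrite expn0 big_ord1 pref0 expr0 mul1r.
rewrite expnS (sum_double (fun y => p ^+ pref y b.+1 * q ^+ (b.+1 - pref y b.+1))) -[RHS]IH.
apply: eq_bigr => y _; rewrite !prefSl.
have -> : ((2 * y) %% 2 = 0)%N by lia.
have -> : ((2 * y) %/ 2 = y)%N by lia.
have -> : ((2 * y + 1) %% 2 = 1)%N by lia.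
have -> : ((2 * y + 1) %/ 2 = y)%N by lia.
have := pref_le y b; move: (pref y b) => a ab.
rewrite add0n add1n subSn // subSS !exprS.
by rewrite -[RHS]mulr1 -pq; ring.
Qed.

(** All strings of a class have the same probability, and the class has probability at most 1. *)
Lemma cntk_weight (p q : R) b k : p + q = 1 -> 0 <= p -> 0 <= q ->
  (cntk b (2 ^ b) k)%:R * (p ^+ k * q ^+ (b - k)) <= 1.
Proof.
move=> pq p0 q0; rewrite -[leRHS](weight_sum b pq).
elim: (2 ^ b)%N => [|m IH]; first by rewrite /cntk /= mul0r big_ord0.
rewrite cntkS natrD mulrDl big_ord_recr /=; apply: lerD => //.
case: eqP => [->|_]; first by rewrite mul1r.
by rewrite mul0r mulr_ge0 // exprn_ge0.
Qed.

(** The product over all blocks of [2 ^ W <= 2 N] and of the previous bound; every block contributes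
    one factor 2 for the rounding of its width. *)
Lemma prod_weight (p q : R) b (W K : nat -> nat) F : p + q = 1 -> 0 <= p -> 0 <= q ->
  (forall i, (i < F)%N -> (2 ^ W i <= 2 * cntk b (2 ^ b) (K i))%N) ->
  2 ^+ (\sum_(i < F) W i)%N * (p ^+ (\sum_(i < F) K i)%N * q ^+ (\sum_(i < F) (b - K i))%N) <= 2 ^+ F.
Proof.
move=> pq p0 q0; elim: F => [|F IH] H; first by rewrite !big_ord0 !expr0 !mulr1.
rewrite !big_ord_recr /= !exprD exprSr.
have -> : forall x y z x' y' z' : R, x * x' * (y * y' * (z * z')) = (x * (y * z)) * (x' * (y' * z')).
  by move=> *; ring.
apply: ler_pM; rewrite ?mulr_ge0 ?exprn_ge0 //.
  by apply: IH => i iF; apply: H; rewrite ltnW.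
have h := H F (ltnSn F).
apply: (@le_trans _ _ ((2 * cntk b (2 ^ b) (K F))%:R * (p ^+ K F * q ^+ (b - K F)))).
  apply: ler_wpM2r; first by rewrite mulr_ge0 ?exprn_ge0.
  by rewrite -natrX ler_nat.
by rewrite natrM -mulrA ler_piMr // cntk_weight.
Qed.

(** For [c = 0] the power is 0 ^ 0 = 1 with logarithm 0, in accordance with the convention for empty
    summands of the entropy. *)
Lemma ln_self (c n : nat) : (0 < n)%N ->
  0 < (c%:R / n%:R : R) ^+ (2 * c) /\
  ln ((c%:R / n%:R : R) ^+ (2 * c)) = - (2 * c%:R * ln (n%:R / c%:R : R)).
Proof.
move=> n0; case: c => [|c]; first by rewrite muln0 expr0 ln1 !mulr0 mul0r oppr0.
have cp : 0 < c.+1%:R / n%:R :> R by rewrite divr_gt0 ?ltr0n.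
split; first by rewrite exprn_gt0.
by rewrite lnXn // -[n%:R / _]invf_div lnV ?posrE // mulrN opprK -[LHS]mulr_natl natrM.
Qed.

(** Taking binary logarithms: the product of powers in the hypothesis equals 2 to the power -2 n
    H_0. *)
Lemma entropy_bound (B : seq bool) (W F : nat) : (0 < size B)%N ->
  let n1 := count_mem true B in let n := size B in
  2 ^+ W * ((n1%:R / n%:R : R) ^+ (2 * n1) * ((n - n1)%:R / n%:R) ^+ (2 * (n - n1))) <= 2 ^+ F :> R ->
  W%:R <= 2 * n%:R * H0 R B + F%:R.
Proof.
move=> n0 n1 n; have le : (n1 <= n)%N := count_size (pred1 true) B.
have En0 : count_mem false B = (n - n1)%N.
  by rewrite /n -(count_predC (pred1 true) B) -/n1 addKn; apply: eq_count => -[].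
rewrite /H0 /log2 En0 -/n -/n1.
have [a0 aE] := @ln_self n1 n n0; have [b0 bE] := @ln_self (n - n1) n n0.
move=> h; have l2 : 0 < ln 2 :> R by rewrite ln_gt0 // ltr1n.
have nn : n%:R != 0 :> R by rewrite pnatr_eq0 -lt0n.
have p2 m : 0 < (2 : R) ^+ m by rewrite exprn_gt0.
have : ln (2 ^+ W * ((n1%:R / n%:R : R) ^+ (2 * n1) * ((n - n1)%:R / n%:R) ^+ (2 * (n - n1)))) <= ln (2 ^+ F : R).
  by rewrite ler_ln ?posrE ?mulr_gt0.
rewrite lnM ?posrE ?mulr_gt0 // lnM ?posrE // aE bE !lnXn // -[ln 2 *+ W]mulr_natl -[ln 2 *+ F]mulr_natl.
move: (ln (n%:R / n1%:R)) (ln (n%:R / (n - n1)%:R)) => x y h2.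
rewrite -(ler_pM2r l2) mulrDl.
have -> : 2 * n%:R * ((n - n1)%:R / n%:R * (y / ln 2) + n1%:R / n%:R * (x / ln 2)) * ln 2 =
  2 * n1%:R * x + 2 * (n - n1)%:R * y :> R.
  by field; rewrite nn gt_eqF.
by move: h2; lra.
Qed.

Lemma powR_cube (c x g n : nat) : (x ^ 3 <= c ^ 3 * (g ^ 2 * n ^ 4))%N ->
  x%:R <= c%:R * (g%:R `^ (2 / 3) * n%:R `^ (4 / 3)) :> R.
Proof.
move=> h; have Y0 : 0 <= c%:R * (g%:R `^ (2 / 3) * n%:R `^ (4 / 3)) :> R.
  by rewrite !mulr_ge0 // powR_ge0.
rewrite -(@ler_pXn2r _ 3) ?nnegrE //.
rewrite !exprMn -!(@powR_mulrn _ (_ `^ _)) ?powR_ge0 // -!powRrM.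
have -> : 2 / 3 * 3%:R = 2%:R :> R by field.
have -> : 4 / 3 * 3%:R = 4%:R :> R by field.
by rewrite !powR_mulrn // -!natrX -!natrM ler_nat.
Qed.

Lemma overhead_littleo : (fun n => (overhead n)%:R : R) =o_\oo (fun n : nat => n%:R : R).
Proof.
apply/eqoP => e e0; near=> n.
have n0 : (0 < n)%N by near: n; exact: nbhs_infty_gt.
rewrite !ger0_norm ?ler0n //.
(* With [lg > M] the factor [3300 * 16 / lg] drops below [e]; the doubly exponential threshold for
   [n] ensures this. *)
pose M := Num.truncn ((3300 * 16)%:R / e : R).
have M1 : (3300 * 16)%:R / e < M.+1%:R :> R by apply: truncnS_gt.
have nM : (16 ^ 2 ^ M <= n)%N by near: n; exact: nbhs_infty_ge.
have lM := block_len_bits_large nM; have := overhead_lg n0.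
have Mp : 0 < (block_len_bits n)%:R :> R by rewrite ltr0n.
rewrite -(ler_nat R) natrM => h.
rewrite -(ler_pM2r Mp); apply: le_trans h _.
have K : (3300 * 16)%:R <= e * (block_len_bits n)%:R.
  rewrite mulrC -ler_pdivrMr //; apply: ltW; apply: lt_le_trans M1 _.
  by rewrite ler_nat.
by rewrite mulnA mulnAC natrM [leRHS]mulrAC ler_wpM2r.
Unshelve. all: by end_near.
Qed.
End Entropy.

Lemma index_size (R : realType) (B : seq bool) M1 M0 r : (0 < size B)%N -> winPf B M1 M0 ->
  rrrP (size B) (Dfun (size B) M1 M0) r ->
  (size (rrr_bits r))%:R <= 2 * (size B)%:R * H0 R B + (overhead (size B))%:R :> R.
Proof.
move=> n0 HW hr; set n := size B in hr *; set n1 := count_mem true B.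
have le : (n1 <= n)%N := count_size (pred1 true) B.
pose F := ((2 * n) %/ r_bb r)%N; pose W := (\sum_(i < F) r_WW r i)%N.
have [K1 K0] := count_blocks HW hr; rewrite -/n1 -/n -/F in K1 K0.
have np : 0 < n%:R :> R by rewrite ltr0n.
pose p := n1%:R / n%:R : R; pose q := (n - n1)%:R / n%:R : R.
have p0 : 0 <= p by rewrite divr_ge0.
have q0 : 0 <= q by rewrite divr_ge0.
have pq : p + q = 1 by rewrite -mulrDl -natrD subnKC // divff // gt_eqF.
have p1 : p <= 1 by rewrite -pq lerDl.
have q1 : q <= 1 by rewrite -pq lerDr.
have hW : W%:R <= 2 * n%:R * H0 R B + F%:R.
  apply: entropy_bound => //; rewrite -/n -/n1 -/p -/q.
  (* The exponents of the complete blocks are at most [2 * n1] and [2 * (n - n1)]; as [p] and [q]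
     are at most 1, the larger exponents only decrease the product. *)
  apply: le_trans (prod_weight pq p0 q0 (W_bound hr)).
  rewrite ler_wpM2l ?exprn_ge0 // -/F.
  by apply: ler_pM; rewrite ?exprn_ge0 // ler_wiXn2l.
have := size_bound hr; rewrite -(ler_nat R) -/n -/F -/W !natrD => h.
by move: h hW; lra.
Qed.

Lemma build_time (R : realType) n g b k T tm P : (0 < n)%N -> (0 < g)%N -> bspec g n b ->
  [/\ k * b <= 2 * n + b, k <= n, T <= g & T <= k]%N ->
  (tm <= (2 * build_cost n b k T + 3) * P)%N ->
  tm%:R <= (2 * (4900 + 100 + 300 * 16 + 100 * 9) + 3) * P%:R *
    (g%:R `^ (2 / 3) * n%:R `^ (4 / 3)) :> R.
Proof.
move=> n0 g0 hb [kb kn Tg Tk] h; set Y := _ * _ `^ (4 / 3).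
have y0 : 1%:R <= 1%:R * Y by apply: powR_cube; rewrite mul1n muln_gt0 !expn_gt0 n0 g0.
have y1 : n%:R <= 1%:R * Y by apply: powR_cube; rewrite mul1n cube_length.
have y2 := powR_cube R (cube_types n0 g0 hb kb kn Tg Tk).
have y3 := powR_cube R (cube_pairs n0 g0 hb kb kn Tg Tk).
rewrite -/Y in y2 y3.
(* Each term of the cost is bounded by a multiple of [Y]: 1 and [n] by [Y], the tables by [16 * Y]
   and the pairs by [9 * Y]. *)
have c : (2 * build_cost n b k T + 3)%:R <= (2 * (4900 + 100 + 300 * 16 + 100 * 9) + 3) * Y.
  have lin (e a x b' c y d z f : nat) : (e * (a * x + b' + c * y + d * z) + f)%:R =
    e%:R * (a%:R * x%:R + b'%:R + c%:R * y%:R + d%:R * z%:R) + f%:R :> R.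
    by rewrite natrD natrM !natrD !natrM.
  rewrite /build_cost lin.
  move: (T * T * _)%N (k * k * b)%N y2 y3 => x z y2 y3; move: y0 y1 y2 y3.
  move: (n%:R : R) (x%:R : R) (z%:R : R) Y => u v t Y0; lra.
apply: (@le_trans _ _ ((2 * build_cost n b k T + 3)%:R * P%:R)).
  by rewrite -natrM ler_nat.
by rewrite mulrAC; apply: ler_wpM2r.
Qed.

Theorem theorem1 (R : realType) :
  exists (build query : program) (k Cq : nat) (Cb : R) (r : nat -> R),
    r =o_\oo (fun n : nat => n%:R : R) /\
    forall (n g w : nat) (B : n.-tuple bool) (G : grammar g),
      is_slp_for G B ->
      ((n + g) ^ k <= 2 ^ w)%N ->
      exists I : seq bool,
        [/\ (size I)%:R <= 2 * n%:R * H0 R B + r n,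
            exists (t : nat) (s : state),
              [/\ t%:R <= Cb * (g%:R `^ (2 / 3) * n%:R `^ (4 / 3)),
                  halts_within w build t (init_grammar G) s
                & outputs_bits w s I]
          & forall m c : nat, (m < 2 ^ w)%N -> (c < 2 ^ w)%N ->
              exists s : state,
                [/\ halts_within w query Cq (init_query w I m c) s,
                    ram s =1 word_of_bits w I
                  & reg s 0 <> 0%N <-> jumbled_occurs B m c]].
Proof.
(* Both time constants contain the lengths of the compiled programs, which depend on no input. *)
exists build_prog, query_prog, (32 * 32)%N, query_time,
  ((2 * (4900 + 100 + 300 * 16 + 100 * 9) + 3) * (size build_prog)%:R), (fun n => (overhead n)%:R).
split; first exact: overhead_littleo.
move=> n g w B G slp hw.
have GB : generates G B by apply/slp.
have Bn : size B = n by rewrite size_tuple.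
have n0 := par_n0 GB Bn; have g0 := par_g0 G.
have [tm [b [k [T [M1 [M0 [r [s [tml hb hk [hW hr] [hh ho]]]]]]]]]] := build_ok GB Bn hw.
exists (rrr_bits r); split.
- have := @index_size R B M1 M0 r; rewrite Bn; exact.
- by exists tm, s; split=> //; apply: build_time hb hk tml.
- by move=> m c mw cw; exact: (query_ok GB Bn hw hW hr mw cw).
Qed.
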